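(* Let $g\in\mathcal{D}$ and let $\omega(\sigma)=\sigma\,(1+\log(1/\sigma))$ for $0<\sigma\le1$. The Volterra operator $T_g$ is compact on $\mathrm{Bloch}(\mathbb{C}_+)\cap\mathcal{D}$ if and only if $g\in\mathrm{Bloch}_{\omega,0}(\mathbb{C}_+)$.
   Context: Notation: $\mathbb{C}_\theta=\{s\in\mathbb{C}:\mathrm{Re}(s)>\theta\}$, $\mathbb{C}_+=\mathbb{C}_0$. $\mathcal{D}$ is the set of Dirichlet series $\sum_{n\ge1}a_nn^{-s}$ converging in some half-plane; a Dirichlet series is said to belong to a space of analytic functions on a half-plane if its analytic extension does. $\mathrm{Bloch}(\mathbb{C}_+)$ is the space of analytic $f$ on $\mathbb{C}_+$ with norm $\|f\|_{\mathrm{Bloch}(\mathbb{C}_+)}=\sup_{\sigma>0,\,t\in\mathbb{R}}\sigma|f'(\sigma+it)|+|f(1)|<\infty$. For a weight $\omega:(0,1]\to(0,\infty)$, $\mathrm{Bloch}_\omega(\mathbb{C}_+)$ is the space of analytic $f$ on $\mathbb{C}_+$ with $$\operatorname*{ess\,sup}_{0<\sigma\le1,\ t\in\mathbb{R}}\omega(\sigma)|f'(\sigma+it)|+\sup_{s\in\mathbb{C}_1}|f(s)|<\infty ,$$ and $\mathrm{Bloch}_{\omega,0}(\mathbb{C}_+)$ is the set of $f\in\mathrm{Bloch}_\omega(\mathbb{C}_+)$ with $\lim_{\sigma\to0^+}\omega(\sigma)\sup_{t\in\mathbb{R}}|f'(\sigma+it)|=0$. For $g\in\mathcal{D}$ and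 a convergent Dirichlet series $f$, $T_gf(s)=-\int_s^\infty f(w)g'(w)\,dw$ (integration along the horizontal half-line, $\mathrm{Re}(s)$ large), again a convergent Dirichlet series. *)

(* Defs.v *)
From Stdlib Require Import Reals.
From Coquelicot Require Import Coquelicot.

Open Scope R_scope.
Open Scope C_scope.

(** * Suprema *)

Definition sup_on (S : C -> Prop) (u : C -> R) : Rbar :=
  Lub_Rbar (fun y => exists s, S s /\ y = u s).

(** Lebesgue-null subsets of the plane: for every [eps > 0], [A] is covered by
    countably many rectangles [[a n, b n] x [c n, d n]] of total area at most [eps]. *)
Definition null_set (A : C -> Prop) : Prop :=
  forall eps : posreal, exists a b c d : nat -> R,
    (forall n, (a n <= b n /\ c n <= d n)%R) /\
    (forall s, A s ->
       exists n, (a n <= Re s <= b n /\ c n <= Im s <= d n)%R) /\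
    (forall N, (sum_n (fun n => ((b n - a n) * (d n - c n))%R) N <= eps)%R).

Definition ess_sup_on (S : C -> Prop) (u : C -> R) : Rbar :=
  Glb_Rbar (fun M : R => null_set (fun s => S s /\ (M < u s)%R)).

(** * Half-planes and analytic functions *)

Definition half_plane (theta : R) (s : C) : Prop := (theta < Re s)%R.

(** Functions on a half-plane are represented by total functions [C -> C], whose
    values outside the half-plane are irrelevant.  [C_derive f s] is the complex
    derivative of [f] at [s] wherever [f] is complex differentiable. *)
Definition analytic_on (S : C -> Prop) (f : C -> C) : Prop :=
  forall s : C, S s -> ex_derive (K := C_AbsRing) (V := C_NormedModule) f s.

(** * Dirichlet series *)

Definition Cexp (z : C) : C :=
  ((exp (Re z) * cos (Im z))%R, (exp (Re z) * sin (Im z))%R).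

(** A Dirichlet series is given by its coefficients; sequences being indexed from
    [0], [a n] is the coefficient of [(n+1)^(-s) = exp (- s * ln (n+1))]. *)
Definition dirichlet_term (a : nat -> C) (s : C) (n : nat) : C :=
  a n * Cexp (- s * RtoC (ln (INR (S n)))).

Definition dirichlet_sum (a : nat -> C) (s : C) : C :=
  (Series (fun n => Re (dirichlet_term a s n)),
   Series (fun n => Im (dirichlet_term a s n))).

Definition in_D (a : nat -> C) : Prop :=
  exists theta : R, forall s, half_plane theta s ->
    ex_series (K := C_AbsRing) (V := C_NormedModule) (dirichlet_term a s).

(** [f] is the sum of the Dirichlet series [a] on some half-plane.  An analytic
    [f] on [half_plane 0] with this property is the analytic extension of [a]. *)
Definition represents (a : nat -> C) (f : C -> C) : Prop :=
  exists theta : R, forall s, half_plane theta s ->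
    is_series (K := C_AbsRing) (V := C_NormedModule) (dirichlet_term a s) (f s).

(** A Dirichlet series belongs to a space of functions analytic on
    [half_plane 0] when its analytic extension does. *)
Definition belongs_to (a : nat -> C) (X : (C -> C) -> Prop) : Prop :=
  exists f : C -> C, X f /\ represents a f.

(** * Bloch spaces *)

Definition bloch_norm (f : C -> C) : Rbar :=
  Rbar_plus
    (sup_on (half_plane 0) (fun s => (Re s * Cmod (C_derive f s))%R))
    (Cmod (f 1)).

Definition Bloch (f : C -> C) : Prop :=
  analytic_on (half_plane 0) f /\ Rbar_lt (bloch_norm f) p_infty.

Definition Bloch_D (f : C -> C) : Prop :=
  Bloch f /\ exists a, represents a f.

Definition strip (s : C) : Prop := (0 < Re s <= 1)%R.

Definition bloch_w_norm (w : R -> R) (f : C -> C) : Rbar :=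
  Rbar_plus
    (ess_sup_on strip (fun s => (w (Re s) * Cmod (C_derive f s))%R))
    (sup_on (half_plane 1) (fun s => Cmod (f s))).

Definition Bloch_w (w : R -> R) (f : C -> C) : Prop :=
  analytic_on (half_plane 0) f /\ Rbar_lt (bloch_w_norm w f) p_infty.

Definition vertical_sup (f : C -> C) (sigma : R) : Rbar :=
  sup_on (fun s => Re s = sigma) (fun s => Cmod (C_derive f s)).

(** The limit is spelled out with [eps] because [vertical_sup] is valued in [Rbar];
    the quantity is nonnegative, so only the upper bound is needed. *)
Definition Bloch_w0 (w : R -> R) (f : C -> C) : Prop :=
  Bloch_w w f /\
  forall eps : posreal,
    at_right 0 (fun sigma =>
      Rbar_lt (Rbar_mult (w sigma) (vertical_sup f sigma)) eps).

(** * The Volterra operator *)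

(** [h = T_g f], where [g] is the sum of the Dirichlet series [b]: for [Re s] large,
    [h s] is minus the integral of [f * g'] over the horizontal half-line
    [{s + x | x >= 0}].  Hence an [h] analytic on [half_plane 0] satisfying this is
    the analytic extension of [T_g f]. *)
Definition volterra (b : nat -> C) (f h : C -> C) : Prop :=
  exists theta : R, forall s, half_plane theta s ->
    is_RInt_gen (V := C_R_NormedModule)
      (fun x : R => f (s + RtoC x) * C_derive (dirichlet_sum b) (s + RtoC x))
      (at_point 0%R) (Rbar_locally p_infty) (- h s).

(** * Compact operators *)

(** [T], given by its graph, is a compact operator on the space [X] normed by [nrm]:
    it maps [X] to [X], and the image of any bounded sequence of [X] has a
    subsequence converging in [X]. *)
Definition compact_operator (X : (C -> C) -> Prop) (nrm : (C -> C) -> Rbar)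
    (T : (C -> C) -> (C -> C) -> Prop) : Prop :=
  (forall f, X f -> exists h, X h /\ T f h) /\
  (forall f h : nat -> C -> C,
     (forall k, X (f k) /\ X (h k) /\ T (f k) (h k)) ->
     (exists M : R, forall k, Rbar_le (nrm (f k)) M) ->
     exists (phi : nat -> nat) (l : C -> C),
       (forall k, (phi k < phi (S k))%nat) /\ X l /\
       forall eps : posreal,
         eventually (fun k =>
           Rbar_lt (nrm (fun s => h (phi k) s - l s)) eps)).

(* Main.v *)
(** A Bloch function [f] with a Dirichlet series has coefficients of at most linear growth (mean
    values of [f' n^s] over the line [Re s = 1]), hence [|f s| <= C (1 + log (1 / Re s))] near the
    imaginary axis. Since [(T_g f)' = f g'], the weight [sigma (1 + log (1 / sigma))] is what makes
    [T_g] bounded on Bloch functions.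

    If [g] satisfies the little-o condition, let [f_k] be bounded. Along a subsequence all the
    coefficients converge, so [f_k] converges uniformly on [Re s >= 4]; Taylor expansion in discs
    centred on [Re s = 6] carries uniform convergence to [Re s >= d] for every [d > 0]. Hence
    [sigma |f_k - f| |g'|] is uniformly small for [sigma >= d], and for [sigma < d] it is small by
    the little-o condition.

    Conversely [T_g 1] is [g] minus a constant. If the little-o condition fails at points
    [sigma_k + i t_k], take [N] close to [1 / sigma_k] and the Dirichlet polynomials
    [L_N(z)^2 / H_N], where [L_N(z) = sum_(m <= N) z^m / m], [H_N = L_N(1)] and
    [z = 2^(-(s - i t_k))]: they are bounded in the Bloch norm, of size [log (1 / sigma_k)] at
    [sigma_k + i t_k], and tend to [0] pointwise. A limit of their images has derivative zero, a
    contradiction. *)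

Require Import Defs.
From Stdlib Require Import Reals.
From Coquelicot Require Import Coquelicot.
From Stdlib Require Import Lra Lia Psatz ClassicalEpsilon.

Local Open Scope C_scope.

(** The set [Re s >= d] is unbounded, so local compactness is not enough: convergence must be
    uniform along vertical lines. Hence the disc argument is quantitative, with a smallness
    threshold that depends only on the radii and the bound and serves all vertical translates. The
    means of [f' n^s] start from [Re s = 1] because the Bloch bound there does not involve the
    unknown abscissa of convergence; this gives one half-plane, [Re s > 3], on which every Bloch
    function with a Dirichlet series equals that series, with tails controlled by the norm alone.
    The operator is given only by integrals far to the right, so [(T_g f)' = f g'] reaches the whole
    half-plane through the identity principle. In the test functions the square matters: [L_N] has
    bounded Bloch norm and the right size but does not tend to [0], [L_N / H_N] tends to [0] but
    stays bounded, and [L_N^2 / H_N] combines both virtues, its derivative being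
    [2 (L_N / H_N) L_N'] with [L_N / H_N] of modulus at most [1]. *)

Ltac max_bounds :=
  repeat match goal with
  | |- context [Rmax ?a ?b] => lazymatch goal with _ : (a <= Rmax a b)%R |- _ => fail | _ => pose proof (Rmax_l a b); pose proof (Rmax_r a b) end
  | _ : context [Rmax ?a ?b] |- _ => lazymatch goal with _ : (a <= Rmax a b)%R |- _ => fail | _ => pose proof (Rmax_l a b); pose proof (Rmax_r a b) end
  end.

Lemma lt_div_mult_l x k e : (0 < k -> x < e / k -> k * x < e)%R.
Proof. rewrite Rmult_comm. apply Rlt_div_r; auto. Qed.

Lemma lt_div_mult_r x k e : (0 < k -> x < e / k -> x * k < e)%R.
Proof. apply Rlt_div_r; auto. Qed.

Lemma Rle_eps a b : (forall eps, (0 < eps)%R -> (a <= b + eps)%R) -> (a <= b)%R.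
Proof. intros H. apply Rnot_lt_le. intros Hlt. specialize (H ((a - b) / 2)%R ltac:(lra)). lra. Qed.

Lemma pow_small q K eps : (0 <= q < 1 -> 0 <= K -> 0 < eps -> exists N, q ^ N * K <= eps)%R.
Proof.
  intros Hq HK He.
  destruct (pow_lt_1_zero q ltac:(rewrite Rabs_pos_eq; lra) (eps / (K + 1))%R) as [N HN].
  { apply Rdiv_lt_0_compat; lra. }
  specialize (HN N (le_n _)). assert (0 <= q ^ N)%R by (apply pow_le; lra). rewrite Rabs_pos_eq in HN by lra.
  apply lt_div_mult_r in HN; [|lra]. exists N. nra.
Qed.

Lemma inv_INR_small K eps : (0 <= K)%R -> (0 < eps)%R ->
  exists N, (1 <= N)%nat /\ forall n, (N <= n)%nat -> (K / INR n <= eps)%R.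
Proof.
  intros HK He. destruct (archimed_cor1 (eps / (K + 1))%R) as [N [HN1 HN2]]; [apply Rdiv_lt_0_compat; lra|].
  apply lt_div_mult_l in HN1; [|lra].
  exists N. split; [lia|]. intros n Hn.
  assert (HN0 : (0 < INR N)%R) by (apply lt_0_INR; lia).
  assert (/ INR n <= / INR N)%R by (apply Rinv_le_contravar; [exact HN0|apply le_INR; lia]).
  nra.
Qed.

Lemma Cmod_split (x y z : C) : x = y + z -> (Cmod x <= Cmod y + Cmod z)%R.
Proof. intros ->; apply Cmod_triangle. Qed.

Lemma Cmod_sub_sym (x y : C) : Cmod (x - y) = Cmod (y - x).
Proof. rewrite <- Cmod_opp; f_equal; ring. Qed.

Lemma Cmod_sub_split (x y z : C) : (Cmod (x - z) <= Cmod (x - y) + Cmod (y - z))%R.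
Proof. apply Cmod_split; ring. Qed.

Lemma Cmod_le_sub (x y : C) : (Cmod x <= Cmod y + Cmod (x - y))%R.
Proof. apply Cmod_split; ring. Qed.

Lemma Cmod_im_le (z : C) : (Rabs (Im z) <= Cmod z)%R.
Proof. eapply Rle_trans; [apply Rmax_r | apply Rmax_Cmod]. Qed.

Lemma Cmod_le_sum (z : C) : (Cmod z <= Rabs (Re z) + Rabs (Im z))%R.
Proof.
  pose proof (Rabs_pos (Re z)); pose proof (Rabs_pos (Im z)); pose proof (Cmod_ge_0 z).
  pose proof (Cmod2_alt z) as E. rewrite <- (pow2_abs (Re z)), <- (pow2_abs (Im z)) in E. nra.
Qed.

(** * Complex and real derivatives of complex functions *)

(* [j] is the identity of [C], or the inclusion of the real line. *)
Definition deriv_along {T : Type} (j f : T -> C) (z : T) (l : C) : Prop :=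
  forall eps : R, (0 < eps)%R -> exists d : R, (0 < d)%R /\
    forall w, (Cmod (j w - j z) < d)%R ->
      (Cmod (f w - f z - l * (j w - j z)) <= eps * Cmod (j w - j z))%R.

(** The generic definition is unfolded so that goals show [w - z] instead of an applied identity; it
    stays convertible to [deriv_along], hence the generic lemmas apply by [exact]. *)
Definition cderiv (f : C -> C) (z l : C) : Prop :=
  Eval cbv beta delta [deriv_along] in deriv_along (fun z => z) f z l.
Definition rderiv (u : R -> C) (t : R) (l : C) : Prop := deriv_along RtoC u t l.
Definition rdiff (u : R -> C) (t : R) : Prop := exists l, rderiv u t l.

Section DerivAlong.
Variables (T : Type) (j : T -> C).
Implicit Types (f g : T -> C) (z : T) (l m a : C).

Lemma deriv_ext f g z l : (forall w, f w = g w) -> deriv_along j f z l -> deriv_along j g z l.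
Proof.
  intros E H eps He. destruct (H eps He) as [d [Hd H']]. exists d; split; [exact Hd|].
  intros w Hw. rewrite <- !E. auto.
Qed.

Lemma deriv_cont f z l : deriv_along j f z l -> forall eps, (0 < eps)%R ->
  exists d, (0 < d)%R /\ forall w, (Cmod (j w - j z) < d)%R -> (Cmod (f w - f z) < eps)%R.
Proof.
  intros H eps Heps. destruct (H 1%R Rlt_0_1) as [d [Hd H1]].
  pose proof (Cmod_ge_0 l).
  exists (Rmin d (eps / (Cmod l + 2))); split; [apply Rmin_pos; [|apply Rdiv_lt_0_compat]; lra|].
  intros w Hw. specialize (H1 w (Rlt_le_trans _ _ _ Hw (Rmin_l _ _))).
  assert (Hw2 := Rlt_le_trans _ _ _ Hw (Rmin_r _ _)).
  pose proof (Cmod_split (f w - f z) (f w - f z - l * (j w - j z)) (l * (j w - j z)) ltac:(ring)) as T1.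
  rewrite Cmod_mult in T1.
  apply lt_div_mult_r in Hw2; [|lra].
  nra.
Qed.

Lemma deriv_affine (b c : C) z : deriv_along j (fun w => b + c * j w) z c.
Proof.
  exists 1%R; split; [lra|]. intros w _.
  replace (b + c * j w - (b + c * j z) - c * (j w - j z)) with (RtoC 0) by ring. rewrite Cmod_0.
  pose proof (Cmod_ge_0 (j w - j z)); nra.
Qed.

Lemma deriv_plus f g z l m :
  deriv_along j f z l -> deriv_along j g z m -> deriv_along j (fun w => f w + g w) z (l + m).
Proof.
  intros Hf Hg eps He.
  destruct (Hf (eps / 2)%R ltac:(lra)) as [d [Hd Hf']].
  destruct (Hg (eps / 2)%R ltac:(lra)) as [e [He' Hg']].
  exists (Rmin d e); split; [apply Rmin_pos; lra|].
  intros w Hw. specialize (Hf' w (Rlt_le_trans _ _ _ Hw (Rmin_l _ _))).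
  specialize (Hg' w (Rlt_le_trans _ _ _ Hw (Rmin_r _ _))).
  pose proof (Cmod_split (f w + g w - (f z + g z) - (l + m) * (j w - j z))
     (f w - f z - l * (j w - j z)) (g w - g z - m * (j w - j z)) ltac:(ring)). lra.
Qed.

Lemma deriv_comp (F : C -> C) g z l m :
  deriv_along j g z m -> cderiv F (g z) l -> deriv_along j (fun w => F (g w)) z (l * m).
Proof.
  intros Hg HF eps He.
  pose proof (Cmod_ge_0 l) as Hl. pose proof (Cmod_ge_0 m) as Hm.
  (* [e1] absorbs the Lipschitz constant [Cmod m + 1] of [g] near [z], which is available because
     [e2 <= 1]; [e2] absorbs the factor [Cmod l]. Each error then costs at most half of
     [eps * Cmod h]. *)
  set (e1 := (eps / 2 / (Cmod m + 1))%R). set (e2 := Rmin 1 (eps / 2 / (Cmod l + 1))).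
  assert (H1 : (0 < e1)%R) by (apply Rdiv_lt_0_compat; lra).
  assert (H2 : (0 < e2)%R) by (apply Rmin_pos; [lra|apply Rdiv_lt_0_compat; lra]).
  destruct (HF _ H1) as [d1 [Hd1 HF']].
  destruct (Hg _ H2) as [d2 [Hd2 Hg']].
  destruct (deriv_cont g z m Hg d1 Hd1) as [d3 [Hd3 Hc]].
  exists (Rmin d2 d3); split; [apply Rmin_pos; lra|].
  intros w Hw.
  specialize (Hg' w (Rlt_le_trans _ _ _ Hw (Rmin_l _ _))).
  specialize (Hc w (Rlt_le_trans _ _ _ Hw (Rmin_r _ _))).
  specialize (HF' (g w) Hc).
  set (h := j w - j z) in *. pose proof (Cmod_ge_0 h) as Hh.
  pose proof (Cmod_split (F (g w) - F (g z) - l * m * h)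
     (F (g w) - F (g z) - l * (g w - g z)) (l * (g w - g z - m * h)) ltac:(ring)) as T1.
  pose proof (Cmod_split (g w - g z) (g w - g z - m * h) (m * h) ltac:(ring)) as T2.
  rewrite (Cmod_mult l) in T1. rewrite (Cmod_mult m) in T2.
  assert (E1 : (e1 * (Cmod m + 1) = eps / 2)%R) by (unfold e1; field; lra).
  assert (E2 : (e2 <= 1 /\ e2 * (Cmod l + 1) <= eps / 2)%R).
  { split; [apply Rmin_l|]. apply Rle_trans with (eps / 2 / (Cmod l + 1) * (Cmod l + 1))%R.
    - apply Rmult_le_compat_r; [lra|apply Rmin_r].
    - right; field; lra. }
  assert (Hg1 : (Cmod (g w - g z) <= (Cmod m + 1) * Cmod h)%R) by nra.
  assert (Hg2 : (Cmod l * Cmod (g w - g z - m * h) <= eps / 2 * Cmod h)%R).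
  { apply Rle_trans with ((Cmod l + 1) * (e2 * Cmod h))%R; [|nra].
    apply Rmult_le_compat; try lra; apply Cmod_ge_0. }
  assert (Hg3 : (e1 * Cmod (g w - g z) <= eps / 2 * Cmod h)%R).
  { rewrite <- E1, Rmult_assoc. apply Rmult_le_compat_l; lra. }
  lra.
Qed.

End DerivAlong.

Lemma cderiv_is_derive (f : C -> C) (z l : C) :
  is_derive (K := C_AbsRing) (V := C_NormedModule) f z l <-> cderiv f z l.
Proof.
  split.
  - intros [_ H] eps Heps.
    specialize (H z (fun P HP => HP) (mkposreal eps Heps)).
    destruct H as [d Hd]. exists d; split; [apply cond_pos|].
    intros w Hw. specialize (Hd w Hw).
    replace (f w - f z - l * (w - z)) with (f w - f z - (w - z) * l) by ring. exact Hd.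
  - intros H; split.
    + apply is_linear_scal_l.
    + intros x Hx eps.
      replace x with z in *.
      2:{ apply (@is_filter_lim_locally_unique C_AbsRing (AbsRing_NormedModule C_AbsRing) z x Hx). }
      destruct (H eps (cond_pos eps)) as [d [Hd Hw]].
      exists (mkposreal d Hd). intros w Hb.
      change (Cmod (f w - f z - (w - z) * l) <= eps * Cmod (w - z))%R.
      replace (f w - f z - (w - z) * l) with (f w - f z - l * (w - z)) by ring.
      apply Hw, Hb.
Qed.

Lemma rderiv_R (u : R -> C) (t : R) (l : C) : rderiv u t l <->
  forall eps : R, (0 < eps)%R -> exists d : R, (0 < d)%R /\
    forall x : R, (Rabs (x - t) < d)%R ->
      (Cmod (u x - u t - l * RtoC (x - t)) <= eps * Rabs (x - t))%R.
Proof.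
  split; intros H eps He; destruct (H eps He) as [d [Hd H']]; exists d; (split; [exact Hd|]);
    intros x Hx; specialize (H' x); rewrite <- RtoC_minus, Cmod_R in *; auto.
Qed.

Lemma rderiv_is_derive (u : R -> C) (t : R) (l : C) :
  is_derive (K := R_AbsRing) (V := C_R_NormedModule) u t l <-> rderiv u t l.
Proof.
  assert (E : forall x eps,
    (Cmod (u x - u t - l * RtoC (x - t)) <= eps * Rabs (x - t))%R <->
    (norm (minus (minus (u x) (u t) : C_R_NormedModule) (scal (minus x t) l)) <= eps * norm (minus x t))%R).
  { intros x eps. rewrite <- Cmod_norm, scal_R_Cmult.
    replace (minus (minus (u x) (u t) : C_R_NormedModule) (RtoC (minus x t) * l))
      with (u x - u t - l * RtoC (x - t)); [tauto|].
    change (u x - u t - l * RtoC (x - t) = u x - u t - RtoC (x - t) * l). ring. }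
  rewrite rderiv_R. split.
  - intros [_ H] eps Heps.
    specialize (H t (fun P HP => HP) (mkposreal eps Heps)).
    destruct H as [d Hd]. exists d; split; [apply cond_pos|].
    intros x Hx. apply E, Hd, Hx.
  - intros H; split.
    + apply is_linear_scal_l.
    + intros x Hx eps.
      replace x with t in * by apply (is_filter_lim_locally_unique t x Hx).
      destruct (H eps (cond_pos eps)) as [d [Hd Hw]].
      exists (mkposreal d Hd). intros y Hy. apply E, Hw, Hy.
Qed.

Lemma cderiv_unique f z l l' : cderiv f z l -> cderiv f z l' -> l = l'.
Proof.
  intros H H'. rewrite <- cderiv_is_derive in *.
  rewrite <- (is_C_derive_unique f z l H). apply is_C_derive_unique, H'.
Qed.

Lemma cderiv_C_derive f z l : cderiv f z l -> C_derive f z = l.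
Proof. intros H; apply is_C_derive_unique, cderiv_is_derive, H. Qed.

Lemma analytic_cderiv S f s : analytic_on S f -> S s -> cderiv f s (C_derive f s).
Proof.
  intros H Hs. apply cderiv_is_derive, C_derive_correct; [exact s| apply H, Hs].
Qed.

Lemma cderiv_analytic S f (f' : C -> C) :
  (forall s, S s -> cderiv f s (f' s)) -> analytic_on S f.
Proof. intros H s Hs. exists (f' s). apply cderiv_is_derive, H, Hs. Qed.

Lemma cderiv_ext_loc f g z l d : (0 < d)%R ->
  (forall w, (Cmod (w - z) < d)%R -> f w = g w) -> cderiv f z l -> cderiv g z l.
Proof.
  intros Hd E H eps Heps. destruct (H eps Heps) as [d' [Hd' H']].
  exists (Rmin d d'); split; [apply Rmin_pos; lra|].
  intros w Hw. rewrite <- !E.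
  - apply H'. eapply Rlt_le_trans; [apply Hw | apply Rmin_r].
  - replace (z - z) with (RtoC 0) by ring. rewrite Cmod_0; lra.
  - eapply Rlt_le_trans; [apply Hw | apply Rmin_l].
Qed.

Lemma cderiv_ext f g z l : (forall w, f w = g w) -> cderiv f z l -> cderiv g z l.
Proof. exact (deriv_ext C (fun z => z) f g z l). Qed.

Lemma rderiv_ext u v t l : (forall x, u x = v x) -> rderiv u t l -> rderiv v t l.
Proof. exact (deriv_ext R RtoC u v t l). Qed.

Lemma cderiv_eq f z l l' : cderiv f z l -> l = l' -> cderiv f z l'.
Proof. intros H <-; exact H. Qed.

Lemma rderiv_eq u t l l' : rderiv u t l -> l = l' -> rderiv u t l'.
Proof. intros H <-; exact H. Qed.

Lemma cderiv_cont f z l : cderiv f z l -> forall eps, (0 < eps)%R ->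
  exists d, (0 < d)%R /\ forall w, (Cmod (w - z) < d)%R -> (Cmod (f w - f z) < eps)%R.
Proof. exact (deriv_cont C (fun z => z) f z l). Qed.

Lemma cderiv_affine (b c z : C) : cderiv (fun w => b + c * w) z c.
Proof. exact (deriv_affine C (fun z => z) b c z). Qed.

Lemma rderiv_line (z v : C) t : rderiv (fun x => z + v * RtoC x) t v.
Proof. apply deriv_affine. Qed.

Lemma cderiv_const a z : cderiv (fun _ => a) z 0.
Proof. apply (cderiv_ext (fun w => a + 0 * w)); [intros; ring|apply cderiv_affine]. Qed.

Lemma rderiv_const a t : rderiv (fun _ => a) t 0.
Proof. apply (rderiv_ext (fun x => a + 0 * RtoC x)); [intros; ring|apply rderiv_line]. Qed.

Lemma cderiv_id z : cderiv (fun w => w) z 1.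
Proof. apply (cderiv_ext (fun w => 0 + 1 * w)); [intros; ring|apply cderiv_affine]. Qed.

Lemma cderiv_plus f g z l m :
  cderiv f z l -> cderiv g z m -> cderiv (fun w => f w + g w) z (l + m).
Proof. exact (deriv_plus C (fun z => z) f g z l m). Qed.

Lemma rderiv_plus u v t l m :
  rderiv u t l -> rderiv v t m -> rderiv (fun x => u x + v x) t (l + m).
Proof. apply deriv_plus. Qed.

Lemma cderiv_comp f g z l m :
  cderiv g z m -> cderiv f (g z) l -> cderiv (fun w => f (g w)) z (l * m).
Proof. exact (deriv_comp C (fun z => z) f g z l m). Qed.

Lemma cderiv_rderiv_comp f (u : R -> C) t l m :
  rderiv u t m -> cderiv f (u t) l -> rderiv (fun x => f (u x)) t (l * m).
Proof. apply deriv_comp. Qed.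

Lemma cderiv_sqr z : cderiv (fun w => w * w) z (2 * z).
Proof.
  intros eps He. exists eps; split; [lra|]. intros w Hw.
  replace (w * w - z * z - 2 * z * (w - z)) with ((w - z) * (w - z)) by ring.
  rewrite Cmod_mult. pose proof (Cmod_ge_0 (w - z)); nra.
Qed.

Lemma cderiv_scal (a : C) f z l : cderiv f z l -> cderiv (fun w => a * f w) z (a * l).
Proof.
  intros H. apply (cderiv_ext (fun w => 0 + a * f w)); [intros; ring|].
  exact (cderiv_comp (fun w => 0 + a * w) f z a l H (cderiv_affine 0 a (f z))).
Qed.

Lemma rderiv_scal (a : C) u t l : rderiv u t l -> rderiv (fun x => a * u x) t (a * l).
Proof.
  intros H. apply (rderiv_ext (fun x => 0 + a * u x)); [intros; ring|].
  exact (cderiv_rderiv_comp (fun w => 0 + a * w) u t a l H (cderiv_affine 0 a (u t))).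
Qed.

Lemma cderiv_minus f g z l m :
  cderiv f z l -> cderiv g z m -> cderiv (fun w => f w - g w) z (l - m).
Proof.
  intros Hf Hg.
  replace (l - m) with (l + (-(1)) * m) by ring.
  apply (cderiv_ext (fun w => f w + (-(1)) * g w)); [intros; ring|].
  apply cderiv_plus; [exact Hf|]. apply cderiv_scal, Hg.
Qed.

Lemma rderiv_minus u v t l m :
  rderiv u t l -> rderiv v t m -> rderiv (fun x => u x - v x) t (l - m).
Proof.
  intros Hf Hg.
  replace (l - m) with (l + (-(1)) * m) by ring.
  apply (rderiv_ext (fun w => u w + (-(1)) * v w)); [intros; ring|].
  apply rderiv_plus; [exact Hf|]. apply rderiv_scal, Hg.
Qed.

(* Polarization reduces the product rule to that of the square. *)
Lemma cderiv_mult f g z l m :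
  cderiv f z l -> cderiv g z m -> cderiv (fun w => f w * g w) z (l * g z + f z * m).
Proof.
  intros Hf Hg.
  pose proof (cderiv_comp (fun w => w * w) (fun w => f w + g w) z _ _ (cderiv_plus _ _ _ _ _ Hf Hg) (cderiv_sqr _)) as H1.
  pose proof (cderiv_comp (fun w => w * w) (fun w => f w - g w) z _ _ (cderiv_minus _ _ _ _ _ Hf Hg) (cderiv_sqr _)) as H2.
  pose proof (cderiv_scal (/ 4) _ _ _ (cderiv_minus _ _ _ _ _ H1 H2)) as H3.
  replace (l * g z + f z * m) with
    (/ 4 * (2 * (f z + g z) * (l + m) - 2 * (f z - g z) * (l - m))).
  2:{ field; exact N4. }
  eapply cderiv_ext; [|exact H3]. intros w; cbv beta. field; exact N4.
Qed.

Lemma rderiv_mult u v t l m :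
  rderiv u t l -> rderiv v t m -> rderiv (fun x => u x * v x) t (l * v t + u t * m).
Proof.
  intros Hf Hg.
  pose proof (cderiv_rderiv_comp (fun w => w * w) _ t _ _ (rderiv_plus _ _ _ _ _ Hf Hg) (cderiv_sqr _)) as H1.
  pose proof (cderiv_rderiv_comp (fun w => w * w) _ t _ _ (rderiv_minus _ _ _ _ _ Hf Hg) (cderiv_sqr _)) as H2.
  pose proof (rderiv_scal (/ 4) _ _ _ (rderiv_minus _ _ _ _ _ H1 H2)) as H3.
  replace (l * v t + u t * m) with
    (/ 4 * (2 * (u t + v t) * (l + m) - 2 * (u t - v t) * (l - m))).
  2:{ field; exact N4. }
  eapply rderiv_ext; [|exact H3]. intros w; cbv beta. field; exact N4.
Qed.

Lemma cderiv_inv (z : C) : z <> RtoC 0 -> cderiv (fun w => / w) z (- / (z * z)).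
Proof.
  intros Hz eps He.
  assert (Hz' : (0 < Cmod z)%R) by (apply Cmod_gt_0, Hz).
  set (m := Cmod z) in *.
  (* The remainder equals [(w - z)^2 / (z^2 w)]. The radius [m / 2] gives [Cmod w >= m / 2], and the
     second radius then makes the cofactor of [Cmod (w - z)] at most [eps]. *)
  exists (Rmin (m / 2) (eps * (m * m * m / 2))); split.
  { apply Rmin_pos; [lra|]. repeat apply Rmult_lt_0_compat; lra. }
  intros w Hw.
  assert (H1 := Rlt_le_trans _ _ _ Hw (Rmin_l _ _)).
  assert (H2 := Rlt_le_trans _ _ _ Hw (Rmin_r _ _)).
  assert (Hw' : (m / 2 <= Cmod w)%R).
  { pose proof (Cmod_le_sub z w). rewrite Cmod_sub_sym in H. fold m in H. lra. }
  assert (Hw0 : w <> 0) by (apply Cmod_gt_0; lra).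
  replace (/ w - / z - - / (z * z) * (w - z)) with ((w - z) * (w - z) * / (z * z * w)) by (field; auto).
  rewrite !Cmod_mult, Cmod_inv, !Cmod_mult by (repeat apply Cmult_neq_0; auto).
  fold m. pose proof (Cmod_ge_0 (w - z)) as H0.
  rewrite (Rmult_comm eps), Rmult_assoc.
  apply Rmult_le_compat_l; [exact H0|].
  apply Rle_trans with (eps * (m * m * m / 2) * / (m * m * (m / 2)))%R.
  - apply Rmult_le_compat; try lra.
    + left; apply Rinv_0_lt_compat. repeat apply Rmult_lt_0_compat; lra.
    + apply Rinv_le_contravar; [repeat apply Rmult_lt_0_compat; lra|].
      apply Rmult_le_compat_l; [nra|exact Hw'].
  - right; field; lra.
Qed.

Lemma Cmod_mult_le x y a b : (Cmod x <= a -> Cmod y <= b -> Cmod (x * y) <= a * b)%R.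
Proof. rewrite Cmod_mult. apply Rmult_le_compat; auto using Cmod_ge_0. Qed.

Lemma rdiff_plus u v t : rdiff u t -> rdiff v t -> rdiff (fun x => u x + v x) t.
Proof. intros [l H] [m K]. exists (l + m). apply rderiv_plus; auto. Qed.
Lemma rdiff_minus u v t : rdiff u t -> rdiff v t -> rdiff (fun x => u x - v x) t.
Proof. intros [l H] [m K]. exists (l - m). apply rderiv_minus; auto. Qed.
Lemma rdiff_mult u v t : rdiff u t -> rdiff v t -> rdiff (fun x => u x * v x) t.
Proof. intros [l H] [m K]. eexists. apply rderiv_mult; eauto. Qed.
Lemma rdiff_const a t : rdiff (fun _ => a) t.
Proof. eexists; apply rderiv_const. Qed.
Lemma rdiff_scal a u t : rdiff u t -> rdiff (fun x => a * u x) t.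
Proof. intros [l H]. eexists. apply rderiv_scal; eauto. Qed.
Lemma rdiff_comp f (u : R -> C) t l : cderiv f (u t) l -> rdiff u t -> rdiff (fun x => f (u x)) t.
Proof. intros H [m K]. eexists. eapply cderiv_rderiv_comp; eauto. Qed.
Lemma rdiff_inv (u : R -> C) t : u t <> RtoC 0 -> rdiff u t -> rdiff (fun x => / u x) t.
Proof. intros H K. eapply (rdiff_comp Cinv); [apply cderiv_inv, H| exact K]. Qed.
Lemma rdiff_ext u v t : (forall x, u x = v x) -> rdiff u t -> rdiff v t.
Proof. intros E [l H]. exists l. eapply rderiv_ext; eauto. Qed.

(** * Integrals along paths *)

Definition CI (u : R -> C) (a b : R) : C := RInt (V := C_R_CompleteNormedModule) u a b.

(** Every integrand below is differentiable in its real parameter, so differentiability serves as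
    the single integrability condition and is checked by closure rules. *)
Definition rdiff_on (u : R -> C) (a b : R) : Prop := forall t, (a <= t <= b)%R -> rdiff u t.

Lemma rdiff_continuous u t : rdiff u t -> continuous (T := R_UniformSpace) (U := C_R_NormedModule) u t.
Proof.
  intros [l H]. apply rderiv_is_derive in H.
  apply (ex_derive_continuous (K := R_AbsRing) (V := C_R_NormedModule) u t). exists l; exact H.
Qed.

Lemma CI_correct u a b : (a <= b)%R -> rdiff_on u a b ->
  is_RInt (V := C_R_NormedModule) u a b (CI u a b).
Proof.
  intros Hab H. apply (RInt_correct (V := C_R_CompleteNormedModule)).
  apply (ex_RInt_continuous (V := C_R_CompleteNormedModule)).
  intros t Ht. rewrite Rmin_left, Rmax_right in Ht by lra. apply rdiff_continuous, H, Ht.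
Qed.

Lemma CI_unique u a b l : is_RInt (V := C_R_NormedModule) u a b l -> CI u a b = l.
Proof. intros H. apply (is_RInt_unique (V := C_R_CompleteNormedModule)), H. Qed.

Lemma CI_ext u v a b : (a <= b)%R -> (forall t, (a <= t <= b)%R -> u t = v t) -> CI u a b = CI v a b.
Proof.
  intros Hab E. apply (RInt_ext (V := C_R_CompleteNormedModule)).
  intros t Ht. rewrite Rmin_left, Rmax_right in Ht by lra. apply E; lra.
Qed.

Lemma CI_plus u v a b : (a <= b)%R -> rdiff_on u a b -> rdiff_on v a b ->
  CI (fun t => u t + v t) a b = CI u a b + CI v a b.
Proof.
  intros Hab Hu Hv. apply CI_unique.
  apply (is_RInt_plus (V := C_R_NormedModule)); apply CI_correct; auto.
Qed.

(** The integral is taken in a real vector space, so a complex scalar acts through the real and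
    imaginary parts of the product. *)
Lemma is_RInt_Cmult (c : C) (u : R -> C) a b l : is_RInt (V := C_R_NormedModule) u a b l ->
  is_RInt (V := C_R_NormedModule) (fun t => c * u t) a b (c * l).
Proof.
  intros H.
  pose proof (is_RInt_fct_extend_fst (U := R_NormedModule) (V := R_NormedModule) _ _ _ _ H) as H1.
  pose proof (is_RInt_fct_extend_snd (U := R_NormedModule) (V := R_NormedModule) _ _ _ _ H) as H2.
  apply (is_RInt_fct_extend_pair (U := R_NormedModule) (V := R_NormedModule)).
  - apply (is_RInt_ext (fun t => minus (scal (fst c) (fst (u t))) (scal (snd c) (snd (u t))))).
    { intros; reflexivity. }
    apply (is_RInt_minus (V := R_NormedModule)); apply (is_RInt_scal (V := R_NormedModule)); assumption.
  - apply (is_RInt_ext (fun t => plus (scal (fst c) (snd (u t))) (scal (snd c) (fst (u t))))).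
    { intros; reflexivity. }
    apply (is_RInt_plus (V := R_NormedModule)); apply (is_RInt_scal (V := R_NormedModule)); assumption.
Qed.

Lemma CI_scal c u a b : (a <= b)%R -> rdiff_on u a b ->
  CI (fun t => c * u t) a b = c * CI u a b.
Proof. intros Hab Hu. apply CI_unique, is_RInt_Cmult, CI_correct; auto. Qed.

Lemma CI_minus u v a b : (a <= b)%R -> rdiff_on u a b -> rdiff_on v a b ->
  CI (fun t => u t - v t) a b = CI u a b - CI v a b.
Proof.
  intros Hab Hu Hv. apply CI_unique.
  apply (is_RInt_minus (V := C_R_NormedModule)); apply CI_correct; auto.
Qed.

Lemma CI_const c a b : CI (fun _ => c) a b = RtoC (b - a) * c.
Proof.
  apply CI_unique. rewrite <- scal_R_Cmult. apply (is_RInt_const (V := C_R_NormedModule)).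
Qed.

Lemma CI_Chasles u a b c : (a <= b <= c)%R -> rdiff_on u a c ->
  CI u a c = CI u a b + CI u b c.
Proof.
  intros H Hu. apply CI_unique.
  apply (is_RInt_Chasles (V := C_R_NormedModule)) with b; apply CI_correct; try lra;
   intros t Ht; apply Hu; lra.
Qed.

Lemma CI_bound u a b M : (a <= b)%R -> rdiff_on u a b ->
  (forall t, (a <= t <= b)%R -> Cmod (u t) <= M)%R -> (Cmod (CI u a b) <= M * (b - a))%R.
Proof.
  intros Hab Hu HM. rewrite Cmod_norm, Rmult_comm.
  apply (norm_RInt_le_const (V := C_R_NormedModule) u a b); [exact Hab| |apply CI_correct; auto].
  intros t Ht. rewrite <- Cmod_norm. apply HM, Ht.
Qed.

Lemma is_RInt_rderiv (u u' : R -> C) a b : (a <= b)%R ->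
  (forall t, (a <= t <= b)%R -> rderiv u t (u' t)) -> rdiff_on u' a b ->
  is_RInt (V := C_R_NormedModule) u' a b (u b - u a).
Proof.
  intros Hab H H'.
  apply (is_RInt_derive (V := C_R_CompleteNormedModule) u u');
   intros t Ht; rewrite Rmin_left, Rmax_right in Ht by lra.
  - apply (rderiv_is_derive u), H, Ht.
  - apply rdiff_continuous, H', Ht.
Qed.

Lemma CI_FTC (u u' : R -> C) a b : (a <= b)%R ->
  (forall t, (a <= t <= b)%R -> rderiv u t (u' t)) -> rdiff_on u' a b ->
  CI u' a b = u b - u a.
Proof. intros; apply CI_unique, is_RInt_rderiv; auto. Qed.

(** * Goursat's theorem and primitives *)

Section Bisection.
Variable P : R -> R -> R -> R -> Prop.
Hypothesis Pquad : forall a b c d, (a <= b)%R -> (c <= d)%R ->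
  P a ((a + b) / 2) c ((c + d) / 2) -> P ((a + b) / 2) b c ((c + d) / 2) ->
  P a ((a + b) / 2) ((c + d) / 2) d -> P ((a + b) / 2) b ((c + d) / 2) d -> P a b c d.
Variables A B C D : R.
Hypothesis HAB : (A <= B)%R.
Hypothesis HCD : (C <= D)%R.
Hypothesis Ploc : forall x y, (A <= x <= B)%R -> (C <= y <= D)%R -> exists e, (0 < e)%R /\
  forall a b c d, (A <= a <= x)%R -> (x <= b <= B)%R -> (C <= c <= y)%R -> (y <= d <= D)%R ->
    (b - a < e)%R -> (d - c < e)%R -> P a b c d.

Let rect := (R * R * (R * R))%type.
Let Pr (r : rect) := P (fst (fst r)) (snd (fst r)) (fst (snd r)) (snd (snd r)).
(** Picks the first quarter on which [P] fails and falls back on the last one; by [Pquad], failure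
    on a rectangle is inherited by the chosen quarter. *)
Let next (r : rect) : rect :=
  let a := fst (fst r) in let b := snd (fst r) in let c := fst (snd r) in let d := snd (snd r) in
  let m := ((a + b) / 2)%R in let n := ((c + d) / 2)%R in
  if excluded_middle_informative (P a m c n) then
  if excluded_middle_informative (P m b c n) then
  if excluded_middle_informative (P a m n d) then (m, b, (n, d)) else (a, m, (n, d))
  else (m, b, (c, n)) else (a, m, (c, n)).
Let R_ (n : nat) : rect := Nat.iter n next (A, B, (C, D)).
Let a_ n := fst (fst (R_ n)).
Let b_ n := snd (fst (R_ n)).
Let c_ n := fst (snd (R_ n)).
Let d_ n := snd (snd (R_ n)).

Lemma bisection_step n :
  ((b_ (S n) - a_ (S n)) = (b_ n - a_ n) / 2 /\ (d_ (S n) - c_ (S n)) = (d_ n - c_ n) / 2)%R /\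
  ((a_ (S n) = a_ n \/ a_ (S n) = (a_ n + b_ n) / 2) /\ (c_ (S n) = c_ n \/ c_ (S n) = (c_ n + d_ n) / 2))%R /\
  ((a_ n <= b_ n)%R -> (c_ n <= d_ n)%R -> ~ Pr (R_ n) -> ~ Pr (R_ (S n))).
Proof.
  unfold a_, b_, c_, d_. change (R_ (S n)) with (next (R_ n)).
  unfold next, Pr; cbn.
  repeat destruct excluded_middle_informative; cbn; repeat split; try lra; auto;
  intros; try (intro; apply H1; apply Pquad; assumption); auto.
Qed.

(** A failure would be inherited by nested rectangles that halve at each step and shrink to a point,
    against [Ploc] there. It serves twice: for Goursat's theorem and, as a compactness principle,
    for coverings of a square. *)
Lemma bisection : P A B C D.
Proof.
  apply NNPP. intros HN.
  assert (Hw : forall n, (b_ n - a_ n = (B - A) * (/ 2) ^ n /\ d_ n - c_ n = (D - C) * (/ 2) ^ n)%R).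
  { induction n as [|n [IH1 IH2]].
    - unfold a_, b_, c_, d_, R_; cbn; lra.
    - destruct (bisection_step n) as [[H1 H2] _]. rewrite H1, H2, IH1, IH2; cbn; lra. }
  assert (Hp : forall n, (0 <= (/ 2) ^ n)%R) by (intros; apply pow_le; lra).
  assert (Hle : forall n, (a_ n <= b_ n /\ c_ n <= d_ n)%R).
  { intros n; destruct (Hw n); specialize (Hp n); split; nra. }
  assert (HPn : forall n, ~ Pr (R_ n)).
  { induction n as [|n IH]; [exact HN|]. destruct (Hle n). apply (bisection_step n); auto. }
  assert (Hmono : forall n, (a_ n <= a_ (S n) /\ b_ (S n) <= b_ n /\ c_ n <= c_ (S n) /\ d_ (S n) <= d_ n)%R).
  { intros n. destruct (bisection_step n) as [[H1 H2] [[[H3|H3] [H4|H4]] _]], (Hle n); lra. }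
  assert (Hmm : forall n k, (a_ n <= a_ (k + n) /\ b_ (k + n) <= b_ n /\ c_ n <= c_ (k + n) /\ d_ (k + n) <= d_ n)%R).
  { intros n; induction k as [|k IH]; [change (0 + n)%nat with n; lra|].
    pose proof (Hmono (k + n)%nat). change (S k + n)%nat with (S (k + n)). lra. }
  assert (Hab : forall n m, (a_ n <= b_ m /\ c_ n <= d_ m)%R).
  { intros n m. destruct (Nat.le_ge_cases n m).
    - replace m with ((m - n) + n)%nat by lia. pose proof (Hmm n (m - n)%nat). pose proof (Hle (m - n + n)%nat). lra.
    - replace n with ((n - m) + m)%nat by lia. pose proof (Hmm m (n - m)%nat). pose proof (Hle (n - m + m)%nat). lra. }
  destruct (completeness (fun x => exists n, x = a_ n)) as [x [Hx1 Hx2]].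
  { exists B. intros y [n ->]. apply (Hab n 0%nat). }
  { exists A, 0%nat; reflexivity. }
  destruct (completeness (fun x => exists n, x = c_ n)) as [y [Hy1 Hy2]].
  { exists D. intros z [n ->]. apply (Hab n 0%nat). }
  { exists C, 0%nat; reflexivity. }
  assert (Hin : forall n, (a_ n <= x <= b_ n /\ c_ n <= y <= d_ n)%R).
  { intros n; repeat split.
    - apply Hx1; exists n; reflexivity.
    - apply Hx2; intros z [m ->]; apply Hab.
    - apply Hy1; exists n; reflexivity.
    - apply Hy2; intros z [m ->]; apply Hab. }
  destruct (Hin 0%nat) as [Hx0 Hy0].
  destruct (Ploc x y Hx0 Hy0) as [e [He HP]].
  destruct (pow_lt_1_zero (/ 2) ltac:(rewrite Rabs_pos_eq; lra) (e / ((B - A) + (D - C) + 1))%R) as [N HN'].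
  { apply Rdiv_lt_0_compat; lra. }
  specialize (HN' N (le_n _)). rewrite Rabs_pos_eq in HN' by apply Hp.
  apply (Rmult_lt_compat_l ((B - A) + (D - C) + 1)) in HN'; [|lra].
  replace ((B - A + (D - C) + 1) * (e / (B - A + (D - C) + 1)))%R with e in HN' by (field; lra).
  apply (HPn N).
  destruct (Hw N) as [W1 W2]. specialize (Hp N).
  pose proof (Hmm 0%nat N) as HM. rewrite Nat.add_0_r in HM. change (a_ 0) with A in HM.
  change (b_ 0) with B in HM. change (c_ 0) with C in HM. change (d_ 0) with D in HM.
  destruct (Hin N).
  apply (HP (a_ N) (b_ N) (c_ N) (d_ N)); lra.
Qed.

End Bisection.

Lemma CI_swap u a b : (a <= b)%R -> rdiff_on u a b -> CI u b a = - CI u a b.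
Proof.
  intros Hab Hu. apply CI_unique. apply (is_RInt_swap (V := C_R_NormedModule)).
  apply CI_correct; auto.
Qed.

Section Oriented.
Variables (u : R -> C) (lo : R).
Hypothesis Hu : forall t, (lo < t)%R -> rdiff u t.

Lemma rdiff_on_ray a b : (lo < a)%R -> rdiff_on u a b.
Proof. intros Ha t Ht; apply Hu; lra. Qed.

Lemma CI_swap_ray a b : (lo < a)%R -> (lo < b)%R -> CI u b a = - CI u a b.
Proof.
  intros Ha Hb. destruct (Rle_or_lt a b).
  - apply CI_swap; [lra| apply rdiff_on_ray, Ha].
  - rewrite (CI_swap u b a); [ring|lra|apply rdiff_on_ray, Hb].
Qed.

Lemma CI_Chasles_ray a b c : (lo < a)%R -> (lo < b)%R -> (lo < c)%R ->
  CI u a c = CI u a b + CI u b c.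
Proof.
  assert (K : forall x y z, (lo < x)%R -> (x <= y <= z)%R -> CI u x z = CI u x y + CI u y z).
  { intros x y z Hx H. apply CI_Chasles; [exact H| apply rdiff_on_ray, Hx]. }
  intros Ha Hb Hc.
  destruct (Rle_or_lt a b), (Rle_or_lt b c).
  - apply K; lra.
  - rewrite (CI_swap_ray c b) by assumption. destruct (Rle_or_lt a c).
    + rewrite (K a c b) by lra. ring.
    + rewrite (CI_swap_ray c a), (K c a b) by lra. ring.
  - rewrite (CI_swap_ray b a) by assumption. destruct (Rle_or_lt a c).
    + rewrite (K b a c) by lra. ring.
    + rewrite (CI_swap_ray c a), (K b c a) by lra. ring.
  - rewrite (CI_swap_ray b a), (CI_swap_ray c b), (CI_swap_ray c a), (K c b a) by lra. ring.
Qed.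

(** Meant for the two legs of the path along which a primitive is incremented; the end points may
    come in either order. *)
Lemma CI_approx_ray (k : C) a b M : (lo < a)%R -> (lo < b)%R ->
  (forall t, (Rmin a b <= t <= Rmax a b)%R -> Cmod (u t - k) <= M)%R ->
  (Cmod (CI u a b - k * RtoC (b - a)) <= M * Rabs (b - a))%R.
Proof.
  assert (K : forall x y, (lo < x)%R -> (x <= y)%R -> (forall t, (x <= t <= y)%R -> Cmod (u t - k) <= M)%R ->
    (Cmod (CI u x y - k * RtoC (y - x)) <= M * (y - x))%R).
  { intros x y Hx Hxy H.
    replace (CI u x y - k * RtoC (y - x)) with (CI (fun t => u t - k) x y).
    - apply CI_bound; auto. intros t Ht. apply rdiff_minus; [apply Hu; lra|apply rdiff_const].
    - rewrite CI_minus; [rewrite CI_const; ring|exact Hxy|apply rdiff_on_ray, Hx|intros t _; apply rdiff_const]. }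
  intros Ha Hb H. destruct (Rle_or_lt a b).
  - rewrite Rmin_left, Rmax_right in H by lra. rewrite Rabs_pos_eq by lra. apply K; auto.
  - rewrite Rmin_right, Rmax_left in H by lra. rewrite Rabs_left by lra.
    replace (CI u a b - k * RtoC (b - a)) with (- (CI u b a - k * RtoC (a - b))).
    + rewrite Cmod_opp, Ropp_minus_distr. apply K; auto; lra.
    + rewrite (CI_swap_ray b a), !RtoC_minus by assumption. ring.
Qed.

End Oriented.

Lemma rderiv_horizontal y t : rderiv (fun x => (x, y)) t 1.
Proof.
  apply (rderiv_ext (fun x => (0%R, y) + 1 * RtoC x)); [|apply rderiv_line].
  intros x. apply injective_projections; simpl; ring.
Qed.

Lemma rderiv_vertical x t : rderiv (fun y => (x, y)) t Ci.
Proof.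
  apply (rderiv_ext (fun y => (x, 0%R) + Ci * RtoC y)); [|apply rderiv_line].
  intros y. apply injective_projections; simpl; ring.
Qed.

Lemma C_decomp (z w : C) : z - w = RtoC (Re z - Re w) + Ci * RtoC (Im z - Im w).
Proof.
  destruct z as [a b], w as [c d]. apply injective_projections; simpl; ring.
Qed.

(** The derivative is carried as a second function so that it can be an explicit formula such as
    [f s * G' s]; half-planes are the only domains that occur. *)
Definition holo (theta : R) (F F' : C -> C) : Prop :=
  forall s, (theta < Re s)%R -> cderiv F s (F' s).

(** The contour integral over the boundary run counterclockwise from the corner [(a, c)]; the top
    and left sides are traversed backwards. *)
Definition rect_int (F : C -> C) (a b c d : R) : C :=
  CI (fun x => F (x, c)) a b + Ci * CI (fun y => F (b, y)) c d
  - CI (fun x => F (x, d)) a b - Ci * CI (fun y => F (a, y)) c d.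

Section Goursat.
Variables (theta : R) (F F' : C -> C).
Hypothesis HF : holo theta F F'.

Lemma rdiff_horizontal y t : (theta < t)%R -> rdiff (fun x => F (x, y)) t.
Proof.
  intros Ht. apply (rdiff_comp F (fun x => (x, y)) t (F' (t, y))).
  - apply HF, Ht.
  - exists 1; apply rderiv_horizontal.
Qed.

Lemma rdiff_vertical x t : (theta < x)%R -> rdiff (fun y => F (x, y)) t.
Proof.
  intros Ht. apply (rdiff_comp F (fun y => (x, y)) t (F' (x, t))).
  - apply HF, Ht.
  - exists Ci; apply rderiv_vertical.
Qed.

Lemma rect_int_quad a b c d : (theta < a)%R -> (a <= b)%R -> (c <= d)%R ->
  rect_int F a b c d =
    rect_int F a ((a + b) / 2) c ((c + d) / 2) + rect_int F ((a + b) / 2) b c ((c + d) / 2)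
  + rect_int F a ((a + b) / 2) ((c + d) / 2) d + rect_int F ((a + b) / 2) b ((c + d) / 2) d.
Proof.
  intros Ha Hab Hcd. unfold rect_int.
  rewrite (CI_Chasles (fun x => F (x, c)) a ((a + b) / 2) b),
   (CI_Chasles (fun x => F (x, d)) a ((a + b) / 2) b),
   (CI_Chasles (fun y => F (a, y)) c ((c + d) / 2) d),
   (CI_Chasles (fun y => F (b, y)) c ((c + d) / 2) d);
   try lra; try (intros t Ht; apply rdiff_vertical; lra); try (intros t Ht; apply rdiff_horizontal; lra).
  ring.
Qed.

Lemma rect_int_bound a b c d M : (theta < a)%R -> (a <= b)%R -> (c <= d)%R ->
  (forall w, (a <= Re w <= b)%R -> (c <= Im w <= d)%R -> (Cmod (F w) <= M)%R) ->
  (Cmod (rect_int F a b c d) <= 2 * M * ((b - a) + (d - c)))%R.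
Proof.
  intros Ha Hab Hcd HM.
  eapply Rle_trans; [apply Cmod_triangle|]. rewrite Cmod_opp, Cmod_mult, Cmod_Ci, Rmult_1_l.
  eapply Rle_trans; [apply Rplus_le_compat_r, Cmod_triangle|]. rewrite Cmod_opp.
  eapply Rle_trans; [apply Rplus_le_compat_r, Rplus_le_compat_r, Cmod_triangle|].
  rewrite Cmod_mult, Cmod_Ci, Rmult_1_l.
  assert (H1 : (Cmod (CI (fun x => F (x, c)) a b) <= M * (b - a))%R).
  { apply CI_bound; [lra|intros t Ht; apply rdiff_horizontal; lra| intros t Ht; apply HM; cbn; lra]. }
  assert (H2 : (Cmod (CI (fun x => F (x, d)) a b) <= M * (b - a))%R).
  { apply CI_bound; [lra|intros t Ht; apply rdiff_horizontal; lra| intros t Ht; apply HM; cbn; lra]. }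
  assert (H3 : (Cmod (CI (fun y => F (a, y)) c d) <= M * (d - c))%R).
  { apply CI_bound; [lra|intros t Ht; apply rdiff_vertical; lra| intros t Ht; apply HM; cbn; lra]. }
  assert (H4 : (Cmod (CI (fun y => F (b, y)) c d) <= M * (d - c))%R).
  { apply CI_bound; [lra|intros t Ht; apply rdiff_vertical; lra| intros t Ht; apply HM; cbn; lra]. }
  lra.
Qed.

(** Each side contributes a difference of values of [U] at two corners, and these cancel in a round
    trip. It disposes of the affine part in Goursat's theorem. *)
Lemma rect_int_primitive U a b c d : (theta < a)%R -> (a <= b)%R -> (c <= d)%R ->
  holo theta U F -> rect_int F a b c d = 0.
Proof.
  intros Ha Hab Hcd HU.
  assert (Hh : forall y, CI (fun x => F (x, y)) a b = U (b, y) - U (a, y)).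
  { intros y. apply (CI_FTC (fun x => U (x, y))); [lra| |intros t Ht; apply rdiff_horizontal; lra].
    intros t Ht. rewrite <- (Cmult_1_r (F (t, y))).
    apply (cderiv_rderiv_comp U); [apply rderiv_horizontal| apply HU; cbn; lra]. }
  assert (Hv : forall x, (a <= x)%R -> Ci * CI (fun y => F (x, y)) c d = U (x, d) - U (x, c)).
  { intros x Hx. rewrite <- CI_scal; [|lra|intros t Ht; apply rdiff_vertical; lra].
    apply (CI_FTC (fun y => U (x, y))); [lra| |].
    - intros t Ht. rewrite (Cmult_comm Ci).
      apply (cderiv_rderiv_comp U); [apply rderiv_vertical| apply HU; cbn; lra].
    - intros t Ht. apply rdiff_scal, rdiff_vertical; lra. }
  unfold rect_int. rewrite !Hh, !Hv by lra. ring.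
Qed.

End Goursat.

Lemma rect_int_minus theta F F' G G' a b c d : holo theta F F' -> holo theta G G' ->
  (theta < a)%R -> (a <= b)%R -> (c <= d)%R ->
  rect_int (fun w => F w - G w) a b c d = rect_int F a b c d - rect_int G a b c d.
Proof.
  intros HF HG Ha Hab Hcd. unfold rect_int.
  rewrite !CI_minus; try lra;
    try (intros t Ht; eapply rdiff_horizontal; [eassumption|lra]);
    try (intros t Ht; eapply rdiff_vertical; [eassumption|lra]).
  ring.
Qed.

(** The bound by [eps] times the square of the half perimeter is compatible with bisection: there
    are four quarters, each with half the half perimeter. It holds near each point because the
    affine part of [F] integrates to zero and the rest is at most [eps / 2] times the half
    perimeter. *)
Lemma goursat theta F F' a b c d : holo theta F F' ->
  (theta < a)%R -> (a <= b)%R -> (c <= d)%R -> rect_int F a b c d = 0.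
Proof.
  intros HF Ha Hab Hcd. apply Cmod_eq_0, Rle_antisym; [|apply Cmod_ge_0].
  set (S := ((b - a) + (d - c))%R).
  assert (Key : forall eps, (0 < eps)%R -> (Cmod (rect_int F a b c d) <= eps * S ^ 2)%R).
  { intros eps He.
    apply (bisection (fun a b c d => (theta < a)%R -> (Cmod (rect_int F a b c d) <= eps * ((b - a) + (d - c)) ^ 2)%R)); auto.
    - clear - HF. intros a b c d Hab Hcd H1 H2 H3 H4 Ha.
      specialize (H1 Ha). specialize (H2 ltac:(lra)). specialize (H3 Ha). specialize (H4 ltac:(lra)).
      rewrite (rect_int_quad theta F F' HF a b c d) by lra.
      eapply Rle_trans; [apply Cmod_triangle|].
      eapply Rle_trans; [apply Rplus_le_compat_r, Cmod_triangle|].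
      eapply Rle_trans; [apply Rplus_le_compat_r, Rplus_le_compat_r, Cmod_triangle|].
      pose proof (Rplus_le_compat _ _ _ _ (Rplus_le_compat _ _ _ _ (Rplus_le_compat _ _ _ _ H1 H2) H3) H4) as H5.
      eapply Rle_trans; [exact H5|]. right; field.
    - intros x y Hx Hy.
      destruct (HF (x, y) ltac:(cbn; lra) (eps / 2)%R ltac:(lra)) as [e [He' Hloc]].
      exists (e / 2)%R; split; [lra|].
      revert x y Hx Hy e He' Hloc. clear S Hab Hcd Ha.
      generalize a b c d. clear a b c d. intros a0 b0 c0 d0 x y Hx Hy e He' Hloc a b c d Hax Hxb Hcy Hyd Hba Hdc Ha.
      set (z := (x, y) : C) in *. set (l := F' z) in *.
      (* [A] is the first-order expansion of [F] at [z], and [B] is a primitive of [A]. *)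
      set (A := fun w => F z + l * (w - z)).
      set (B := fun w => F z * (w - z) + l / 2 * ((w - z) * (w - z))).
      assert (dsub : forall w, cderiv (fun w => w - z) w 1).
      { intros w. replace (RtoC 1) with (1 - 0) by ring. apply cderiv_minus; [apply cderiv_id|apply cderiv_const]. }
      assert (HA : holo theta A (fun _ => l)).
      { intros w _. eapply cderiv_eq.
        - apply cderiv_plus; [apply cderiv_const| apply cderiv_scal, dsub].
        - ring. }
      assert (HB : holo theta B A).
      { intros w _. eapply cderiv_eq.
        - apply cderiv_plus; [apply cderiv_scal, dsub|]. apply cderiv_scal.
          apply (cderiv_mult (fun w => w - z) (fun w => w - z)); apply dsub.
        - unfold A. field; exact N2. }
      assert (E : rect_int F a b c d = rect_int (fun w => F w - A w) a b c d).
      { rewrite (rect_int_minus theta F F' A (fun _ => l)) by (auto; lra).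
        rewrite (rect_int_primitive theta A (fun _ => l) HA B) by (auto; lra). ring. }
      rewrite E.
      apply Rle_trans with (2 * (eps / 2 * ((b - a) + (d - c))) * ((b - a) + (d - c)))%R; [|right; field].
      apply (rect_int_bound theta _ (fun w => F' w - l)); try lra.
      { intros w Hw. apply cderiv_minus; [apply HF, Hw| apply HA, Hw]. }
      intros w Hw1 Hw2.
      assert (Hm : (Cmod (w - z) <= (b - a) + (d - c))%R).
      { eapply Rle_trans; [apply Cmod_le_sum|]. unfold z. unfold Cminus. rewrite re_plus, im_plus, re_opp, im_opp.
        cbn [Re Im fst snd]. apply Rplus_le_compat; apply Rabs_le; lra. }
      assert (Hl : (Cmod (w - z) < e)%R) by lra.
      specialize (Hloc w Hl). unfold A.
      replace (F w - (F z + l * (w - z))) with (F w - F z - l * (w - z)) by ring.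
      eapply Rle_trans; [exact Hloc|]. apply Rmult_le_compat_l; lra. }
  apply Rnot_lt_le. intros Hlt.
  assert (HS : (0 <= S ^ 2)%R) by (apply pow2_ge_0).
  (* With this [eps] the bound is at most half of the modulus itself, which is impossible for a
     positive modulus. *)
  specialize (Key (Cmod (rect_int F a b c d) / (2 * (S ^ 2 + 1)))%R ltac:(apply Rdiv_lt_0_compat; lra)).
  assert (Cmod (rect_int F a b c d) / (2 * (S ^ 2 + 1)) * S ^ 2 <= Cmod (rect_int F a b c d) / 2)%R; [|lra].
  apply Rle_trans with (Cmod (rect_int F a b c d) / (2 * (S ^ 2 + 1)) * (S ^ 2 + 1))%R.
  - apply Rmult_le_compat_l; [left; apply Rdiv_lt_0_compat; lra|lra].
  - right; field; lra.
Qed.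

Section Primitive.
Variables (theta : R) (F F' : C -> C).
Hypothesis HF : holo theta F F'.

(** Exchanging two opposite sides only changes the sign. The corners that are compared for a
    primitive come in any order. *)
Lemma goursat_oriented a b c d : (theta < a)%R -> (theta < b)%R -> rect_int F a b c d = 0.
Proof.
  intros Ha Hb.
  assert (K : forall a b c d, (theta < a)%R -> (a <= b)%R -> rect_int F a b c d = 0).
  { clear a b c d Ha Hb. intros a b c d Ha Hab. destruct (Rle_or_lt c d).
    - apply (goursat theta F F'); auto.
    - replace (rect_int F a b c d) with (- rect_int F a b d c).
      + rewrite (goursat theta F F') by (auto; lra). ring.
      + unfold rect_int. rewrite (CI_swap _ d c), (CI_swap (fun y => F (a, y)) d c); try lra;
        try (intros t Ht; eapply rdiff_vertical; [eassumption|lra]). ring. }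
  destruct (Rle_or_lt a b); [apply K; auto|].
  replace (rect_int F a b c d) with (- rect_int F b a c d).
  - rewrite K by (auto; lra). ring.
  - unfold rect_int. rewrite (CI_swap _ b a), (CI_swap (fun x => F (x, d)) b a); try lra;
        try (intros t Ht; eapply rdiff_horizontal; [eassumption|lra]). ring.
Qed.

(** The primitive integrates along the real axis up to [Re z] and then vertically. Goursat's theorem
    on the rectangle with corners [(Re z, 0)] and [(Re w, Im z)] turns its increment into the
    integral from [z] to [w] along one horizontal and one vertical leg, where [F] is close to
    [F z]. *)
Lemma primitive_exists : exists U, holo theta U F.
Proof.
  set (p := (theta + 1)%R).
  exists (fun z => CI (fun x => F (x, 0%R)) p (Re z) + Ci * CI (fun y => F (Re z, y)) 0 (Im z)).
  intros z Hz eps He.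
  destruct (cderiv_cont F z (F' z) (HF z Hz) (eps / 2)%R ltac:(lra)) as [d [Hd Hc]].
  exists (Rmin d (Re z - theta)); split; [apply Rmin_pos; lra|].
  intros w Hw.
  assert (Hw1 := Rlt_le_trans _ _ _ Hw (Rmin_l _ _)).
  assert (Hw2 := Rlt_le_trans _ _ _ Hw (Rmin_r _ _)).
  assert (Hre : (Rabs (Re w - Re z) <= Cmod (w - z))%R).
  { pose proof (re_le_Cmod (w - z)) as T. exact T. }
  assert (Him : (Rabs (Im w - Im z) <= Cmod (w - z))%R).
  { pose proof (Cmod_im_le (w - z)) as T. exact T. }
  assert (Hrew : (theta < Re w)%R).
  { pose proof (Rabs_def2 _ _ (Rle_lt_trans _ _ _ Hre Hw2)). lra. }
  assert (Hhr : forall y t, (theta < t)%R -> rdiff (fun x => F (x, y)) t) by (intros; apply (rdiff_horizontal theta F F' HF); auto).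
  assert (Hvr : forall x, (theta < x)%R -> forall lo t, (lo < t)%R -> rdiff (fun y => F (x, y)) t) by (intros; apply (rdiff_vertical theta F F' HF); auto).
  set (lo := (Rmin 0 (Rmin (Im z) (Im w)) - 1)%R).
  assert (Hlo : (lo < 0 /\ lo < Im z /\ lo < Im w)%R).
  { unfold lo. pose proof (Rmin_l 0 (Rmin (Im z) (Im w))). pose proof (Rmin_r 0 (Rmin (Im z) (Im w))).
    pose proof (Rmin_l (Im z) (Im w)). pose proof (Rmin_r (Im z) (Im w)). lra. }
  pose proof (goursat_oriented (Re z) (Re w) 0 (Im z) Hz Hrew) as G. unfold rect_int in G.
  rewrite (CI_Chasles_ray _ theta (Hhr 0%R) p (Re z) (Re w)) by (unfold p; lra).
  rewrite (CI_Chasles_ray _ lo (Hvr (Re w) Hrew lo) 0 (Im z) (Im w)) by lra.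
  set (I1 := CI (fun x => F (x, 0%R)) (Re z) (Re w)) in *.
  set (I2 := CI (fun y => F (Re w, y)) 0 (Im z)) in *.
  set (I4 := CI (fun y => F (Re z, y)) 0 (Im z)) in *.
  set (J1 := CI (fun x => F (x, Im z)) (Re z) (Re w)) in *.
  set (J2 := CI (fun y => F (Re w, y)) (Im z) (Im w)) in *.
  set (J0 := CI (fun x => F (x, 0%R)) p (Re z)).
  (* Both legs lie in the rectangle spanned by [z] and [w], hence within [Cmod (w - z)] of [z]. *)
  assert (Hcw : forall x y, (Rabs (x - Re z) <= Rabs (Re w - Re z))%R -> (Rabs (y - Im z) <= Rabs (Im w - Im z))%R ->
     (Cmod (F (x, y) - F z) <= eps / 2)%R).
  { left. apply Hc. apply Rle_lt_trans with (2 := Hw1).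
    apply Rsqr_incr_0_var; [|apply Cmod_ge_0]. unfold Rsqr.
    assert (E : forall q : C, (Cmod q * Cmod q = Rabs (Re q) * Rabs (Re q) + Rabs (Im q) * Rabs (Im q))%R).
    { intros q. pose proof (Cmod2_alt q) as E. rewrite <- (pow2_abs (Re q)), <- (pow2_abs (Im q)) in E. nra. }
    rewrite !E.
    apply Rplus_le_compat; apply Rmult_le_compat; try apply Rabs_pos; assumption. }
  assert (B1 : (Cmod (J1 - F z * RtoC (Re w - Re z)) <= eps / 2 * Rabs (Re w - Re z))%R).
  { apply (CI_approx_ray _ theta); auto. intros t Ht. apply Hcw.
    - unfold Rmin, Rmax in Ht. unfold Rabs. repeat destruct Rcase_abs; repeat destruct Rle_dec; lra.
    - rewrite Rminus_diag_eq, Rabs_R0 by reflexivity. apply Rabs_pos. }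
  assert (B2 : (Cmod (J2 - F z * RtoC (Im w - Im z)) <= eps / 2 * Rabs (Im w - Im z))%R).
  { apply (CI_approx_ray _ lo); try lra; [apply Hvr, Hrew|]. intros t Ht. apply Hcw; [lra|].
    unfold Rmin, Rmax in Ht. unfold Rabs. repeat destruct Rcase_abs; repeat destruct Rle_dec; lra. }
  replace (J0 + I1 + Ci * (I2 + J2) - (J0 + Ci * I4) - F z * (w - z))
    with ((J1 - F z * RtoC (Re w - Re z)) + Ci * (J2 - F z * RtoC (Im w - Im z)) + (I1 + Ci * I2 - J1 - Ci * I4)).
  2:{ rewrite (C_decomp w z). ring. }
  rewrite G, Cplus_0_r. eapply Rle_trans; [apply Cmod_triangle|].
  rewrite Cmod_mult, Cmod_Ci. nra.
Qed.

End Primitive.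

Lemma path_mvt (u u' : R -> C) a b M : (a <= b)%R ->
  (forall t, (a <= t <= b)%R -> rderiv u t (u' t)) -> rdiff_on u' a b ->
  (forall t, (a <= t <= b)%R -> Cmod (u' t) <= M)%R -> (Cmod (u b - u a) <= M * (b - a))%R.
Proof.
  intros Hab H H' HM. rewrite <- (CI_FTC u u' a b) by auto. apply CI_bound; auto.
Qed.

(** * Exponential and circles *)

Lemma Cexp_plus a b : Cexp (a + b) = Cexp a * Cexp b.
Proof.
  unfold Cexp. rewrite re_plus, im_plus, exp_plus, cos_plus, sin_plus.
  apply injective_projections; simpl; ring.
Qed.

Lemma Cexp_0 : Cexp 0 = 1.
Proof. unfold Cexp. simpl. rewrite exp_0, cos_0, sin_0. apply injective_projections; simpl; ring. Qed.

Lemma Cmod_Cexp z : Cmod (Cexp z) = exp (Re z).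
Proof.
  unfold Cexp, Cmod; cbn [fst snd].
  replace ((exp (Re z) * cos (Im z)) ^ 2 + (exp (Re z) * sin (Im z)) ^ 2)%R with (exp (Re z) ^ 2)%R.
  - apply sqrt_pow2. left; apply exp_pos.
  - pose proof (sin2_cos2 (Im z)) as H. unfold Rsqr in H.
    replace ((exp (Re z) * cos (Im z)) ^ 2 + (exp (Re z) * sin (Im z)) ^ 2)%R
     with (exp (Re z) ^ 2 * (sin (Im z) * sin (Im z) + cos (Im z) * cos (Im z)))%R by ring.
    rewrite H; ring.
Qed.

Lemma Cexp_neq_0 z : Cexp z <> 0.
Proof. apply Cmod_gt_0. rewrite Cmod_Cexp. apply exp_pos. Qed.

Lemma Cexp_opp z : Cexp (- z) = / Cexp z.
Proof.
  assert (H : Cexp z * Cexp (- z) = 1).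
  { rewrite <- Cexp_plus, Cplus_opp_r. apply Cexp_0. }
  rewrite <- (Cmult_1_l (Cexp (- z))), <- (Cinv_l (Cexp z)) by apply Cexp_neq_0.
  rewrite <- Cmult_assoc, H. ring.
Qed.

Lemma Cexp_R x : Cexp (RtoC x) = RtoC (exp x).
Proof.
  unfold Cexp. rewrite re_RtoC, im_RtoC, cos_0, sin_0. apply injective_projections; simpl; ring.
Qed.

Lemma rderiv_is_derive_pair (u v : R -> R) t a b : is_derive u t a -> is_derive v t b ->
  rderiv (fun x => (u x, v x)) t (a, b).
Proof.
  intros Hu Hv.
  assert (L : forall (u : R -> R) a, is_derive u t a -> rderiv (fun x => RtoC (u x)) t (RtoC a)).
  { clear. intros u a [_ H]. apply rderiv_R. intros eps He.
    destruct (H t (fun P HP => HP) (mkposreal eps He)) as [d Hd].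
    exists d; split; [apply cond_pos|]. intros x Hx. specialize (Hd x Hx).
    rewrite <- RtoC_mult, <- !RtoC_minus, Cmod_R.
    replace (u x - u t - a * (x - t))%R with (u x - u t - (x - t) * a)%R by ring. exact Hd. }
  eapply rderiv_eq.
  - apply (rderiv_ext (fun x => RtoC (u x) + Ci * RtoC (v x))).
    + intros x. apply injective_projections; simpl; ring.
    + apply rderiv_plus; [apply L, Hu| apply rderiv_scal, L, Hv].
  - apply injective_projections; simpl; ring.
Qed.

Lemma rderiv_Cexp_line (h : C) t : rderiv (fun x => Cexp (h * RtoC x)) t (h * Cexp (h * RtoC t)).
Proof.
  destruct h as [a b].
  apply (rderiv_ext (fun x => ((exp (a * x) * cos (b * x))%R, (exp (a * x) * sin (b * x))%R))).
  { intros x. unfold Cexp, Re, Im; simpl.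
    replace (a * x - b * 0)%R with (a * x)%R by ring. replace (a * 0 + b * x)%R with (b * x)%R by ring. reflexivity. }
  eapply rderiv_eq.
  - apply (rderiv_is_derive_pair (fun x => exp (a * x) * cos (b * x))%R (fun x => exp (a * x) * sin (b * x))%R).
    + auto_derive; [trivial|reflexivity].
    + auto_derive; [trivial|reflexivity].
  - unfold Cexp, Re, Im; simpl.
    replace (a * t - b * 0)%R with (a * t)%R by ring. replace (a * 0 + b * t)%R with (b * t)%R by ring.
    apply injective_projections; simpl; ring.
Qed.

Lemma rdiff_Cexp_line (h : C) t : rdiff (fun x => Cexp (h * RtoC x)) t.
Proof. eexists; apply rderiv_Cexp_line. Qed.

(** The mean value inequality on the segment from [0] to [h], where the modulus of the exponential
    is at most [exp 1 <= 3]. *)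
Lemma Cexp_sub_1_bound h : (Cmod h <= 1 -> Cmod (Cexp h - 1) <= 3 * Cmod h)%R.
Proof.
  intros Hh.
  pose proof (path_mvt (fun x => Cexp (h * RtoC x)) (fun t => h * Cexp (h * RtoC t)) 0 1 (3 * Cmod h)) as H.
  cbv beta in H. rewrite Cmult_1_r, Cmult_0_r, Cexp_0 in H.
  eapply Rle_trans; [apply H|]; try lra.
  - intros; apply rderiv_Cexp_line.
  - intros t _; apply rdiff_scal, rdiff_Cexp_line.
  - intros t Ht. rewrite Cmod_mult, Cmod_Cexp, Rmult_comm.
    apply Rmult_le_compat_r; [apply Cmod_ge_0|].
    apply Rle_trans with (exp 1); [|apply exp_le_3].
    rewrite re_scal_r. pose proof (re_le_Cmod h) as Hr. apply Rabs_le_between in Hr.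
    assert (Re h * t <= 1)%R by nra. destruct H0 as [H0|H0]; [left; apply exp_increasing, H0|rewrite H0; lra].
Qed.

Lemma Cexp_remainder h : (Cmod h <= 1 -> Cmod (Cexp h - 1 - h) <= 3 * Cmod h ^ 2)%R.
Proof.
  intros Hh.
  pose proof (path_mvt (fun x => Cexp (h * RtoC x) - h * RtoC x) (fun t => h * Cexp (h * RtoC t) - h) 0 1 (3 * Cmod h ^ 2)) as H.
  cbv beta in H. rewrite Cmult_1_r, Cmult_0_r, Cexp_0 in H.
  replace (Cexp h - 1 - h) with (Cexp h - h - (1 - 0)) by ring.
  eapply Rle_trans; [apply H|]; try lra.
  - intros t _. apply rderiv_minus; [apply rderiv_Cexp_line|].
    apply (rderiv_ext (fun x => 0 + h * RtoC x)); [intros; ring| apply rderiv_line].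
  - intros t _; apply rdiff_minus; [apply rdiff_scal, rdiff_Cexp_line|apply rdiff_const].
  - intros t Ht. replace (h * Cexp (h * RtoC t) - h) with (h * (Cexp (h * RtoC t) - 1)) by ring.
    pose proof (Cmod_ge_0 h) as H0.
    assert (Hht : (Cmod (h * RtoC t) <= Cmod h)%R).
    { rewrite Cmod_mult, Cmod_R, Rabs_pos_eq by lra. nra. }
    rewrite Cmod_mult. pose proof (Cexp_sub_1_bound (h * RtoC t) ltac:(lra)). nra.
Qed.

Lemma cderiv_Cexp z : cderiv Cexp z (Cexp z).
Proof.
  intros eps He.
  assert (Hp : (0 < Cmod (Cexp z))%R) by (rewrite Cmod_Cexp; apply exp_pos).
  exists (Rmin 1 (eps / (3 * Cmod (Cexp z)))); split.
  { apply Rmin_pos; [lra|]. apply Rdiv_lt_0_compat; lra. }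
  intros w Hw.
  assert (H1 := Rlt_le_trans _ _ _ Hw (Rmin_l _ _)).
  assert (H2 := Rlt_le_trans _ _ _ Hw (Rmin_r _ _)).
  replace (Cexp w - Cexp z - Cexp z * (w - z)) with (Cexp z * (Cexp (w - z) - 1 - (w - z))).
  2:{ replace (Cexp w) with (Cexp (z + (w - z))) by (f_equal; ring). rewrite Cexp_plus. ring. }
  rewrite Cmod_mult. pose proof (Cexp_remainder (w - z) ltac:(lra)) as T.
  pose proof (Cmod_ge_0 (w - z)).
  apply Rle_trans with (Cmod (Cexp z) * (3 * Cmod (w - z) ^ 2))%R.
  - apply Rmult_le_compat_l; lra.
  - apply lt_div_mult_l in H2; [|lra].
    replace (Cmod (Cexp z) * (3 * Cmod (w - z) ^ 2))%R with ((3 * Cmod (Cexp z) * Cmod (w - z)) * Cmod (w - z))%R by ring.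
    apply Rmult_le_compat_r; lra.
Qed.

Lemma cderiv_Cexp_lin (a b : C) z : cderiv (fun w => Cexp (a * w + b)) z (a * Cexp (a * z + b)).
Proof.
  eapply cderiv_eq.
  - apply (cderiv_comp Cexp (fun w => a * w + b)); [|apply cderiv_Cexp].
    apply cderiv_plus; [apply cderiv_scal, cderiv_id|apply cderiv_const].
  - ring.
Qed.

Definition circ (r t : R) : C := RtoC r * Cexp (Ci * RtoC t).

Lemma rderiv_circ r t : rderiv (circ r) t (Ci * circ r t).
Proof.
  eapply rderiv_eq; [apply rderiv_scal, rderiv_Cexp_line|]. unfold circ; ring.
Qed.

Lemma rdiff_circ r t : rdiff (circ r) t.
Proof. eexists; apply rderiv_circ. Qed.

Lemma Re_Ci_mult t : Re (Ci * RtoC t) = 0%R.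
Proof. simpl; ring. Qed.

Lemma Cmod_circ r t : (0 <= r)%R -> Cmod (circ r t) = r.
Proof.
  intros Hr. unfold circ. rewrite Cmod_mult, Cmod_R, Cmod_Cexp, Re_Ci_mult, exp_0, Rabs_pos_eq by exact Hr. ring.
Qed.

Lemma circ_neq_0 r t : (0 < r)%R -> circ r t <> 0.
Proof. intros Hr. apply Cmod_gt_0. rewrite Cmod_circ; lra. Qed.

Lemma Cexp_period (k : nat) : Cexp (Ci * RtoC (INR k * (2 * PI))) = 1.
Proof.
  unfold Cexp. rewrite Re_Ci_mult.
  replace (Im (Ci * RtoC (INR k * (2 * PI)))) with (0 + 2 * INR k * PI)%R by (simpl; ring).
  rewrite cos_period, sin_period, cos_0, sin_0, exp_0. apply injective_projections; simpl; ring.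
Qed.

Lemma circ_2PI r : circ r (2 * PI) = circ r 0.
Proof.
  unfold circ. pose proof (Cexp_period 1) as H. rewrite Rmult_1_l in H. rewrite H, Cmult_0_r, Cexp_0. reflexivity.
Qed.

Lemma re_sub (z w : C) : Re (z - w) = (Re z - Re w)%R.
Proof. reflexivity. Qed.
Lemma im_sub (z w : C) : Im (z - w) = (Im z - Im w)%R.
Proof. reflexivity. Qed.

Lemma Re_ball_gt theta c v r : (Cmod v <= r)%R -> (theta < Re c - r)%R -> (theta < Re (c + v))%R.
Proof.
  rewrite re_plus. pose proof (re_le_Cmod v) as H. apply Rabs_le_between in H. lra.
Qed.

Lemma circ_sub_ge r t v : (0 < r)%R -> (Cmod v < r)%R -> (r - Cmod v <= Cmod (circ r t - v))%R.
Proof.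
  intros Hr Hv. pose proof (Cmod_le_sub (circ r t) v). rewrite Cmod_circ in H by lra. lra.
Qed.

Lemma circ_sub_neq_0 r t v : (0 < r)%R -> (Cmod v < r)%R -> circ r t - v <> 0.
Proof. intros Hr Hv. apply Cmod_gt_0. pose proof (circ_sub_ge r t v Hr Hv). lra. Qed.

Lemma rdiff_circ_inv r v t : (0 < r)%R -> (Cmod v < r)%R -> rdiff (fun t => / (circ r t - v)) t.
Proof.
  intros Hr Hv. apply rdiff_inv; [apply circ_sub_neq_0; auto|].
  apply rdiff_minus; [apply rdiff_circ|apply rdiff_const].
Qed.

Ltac rdiff_auto :=
  intros; repeat first [ solve [auto] | apply rdiff_const | apply rdiff_circ | apply rdiff_circ_inv; solve [auto | lra]
    | apply rdiff_scal | apply rdiff_minus | apply rdiff_plus | apply rdiff_mult ].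

Lemma PI2_pos : (0 <= 2 * PI)%R.
Proof. pose proof PI_RGT_0; lra. Qed.

(** * Cauchy's formula *)

Lemma two_neq_0 : RtoC 2 <> 0.
Proof. intros E; apply RtoC_inj in E; lra. Qed.

Lemma TPI_neq_0 : RtoC (2 * PI) <> 0.
Proof. intros E; apply RtoC_inj in E. pose proof PI_RGT_0; lra. Qed.

Lemma cderiv_shift (a z : C) : cderiv (fun w => w - a) z 1.
Proof. eapply cderiv_eq; [apply cderiv_minus; [apply cderiv_id|apply cderiv_const]|ring]. Qed.

Lemma cderiv_translate f c v l : cderiv f (c + v) l -> cderiv (fun v => f (c + v)) v l.
Proof.
  intros H. eapply cderiv_eq.
  - apply (cderiv_comp f (fun v => c + v)); [|exact H].
    apply cderiv_plus; [apply cderiv_const|apply cderiv_id].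
  - ring.
Qed.

Lemma cderiv_untranslate f c l : cderiv (fun v => f (c + v)) 0 l -> cderiv f c l.
Proof.
  intros H. apply (cderiv_ext (fun w => f (c + (w - c)))); [intros; f_equal; ring|].
  eapply cderiv_eq.
  - apply (cderiv_comp (fun v => f (c + v)) (fun w => w - c)); [apply cderiv_shift|].
    replace (c - c) with (RtoC 0) by ring. exact H.
  - ring.
Qed.

Lemma half_plane_open theta (w : C) : (theta < Re w)%R ->
  forall z, (Cmod (z - w) < Re w - theta)%R -> (theta < Re z)%R.
Proof.
  intros Hw z Hz. pose proof (re_le_Cmod (z - w)) as H. rewrite re_sub in H.
  apply Rabs_le_between in H. lra.
Qed.

(** The first-order expansion of [F] at [w] is integrated along the segment from [w] to [z]: there
    [U] minus its quadratic part has a derivative of size at most [eps * Cmod (z - w)]. *)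
Lemma second_order theta U F F' w : holo theta U F -> holo theta F F' -> (theta < Re w)%R ->
  forall eps, (0 < eps)%R -> exists d, (0 < d)%R /\ forall z, (Cmod (z - w) < d)%R ->
  (Cmod (U z - U w - F w * (z - w) - F' w / 2 * ((z - w) * (z - w))) <= eps * (Cmod (z - w) * Cmod (z - w)))%R.
Proof.
  intros HU HF Hw eps He.
  destruct (HF w Hw eps He) as [d [Hd Hd']].
  exists (Rmin d (Re w - theta)); split; [apply Rmin_pos; lra|].
  intros z Hz.
  assert (H1 := Rlt_le_trans _ _ _ Hz (Rmin_l _ _)).
  assert (H2 := Rlt_le_trans _ _ _ Hz (Rmin_r _ _)).
  set (h := z - w) in *.
  assert (Hseg : forall t, (0 <= t <= 1)%R -> (Cmod (h * RtoC t) <= Cmod h)%R).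
  { intros t Ht. rewrite Cmod_mult, Cmod_R, Rabs_pos_eq by lra. pose proof (Cmod_ge_0 h); nra. }
  assert (Hin : forall t, (0 <= t <= 1)%R -> (theta < Re (w + h * RtoC t))%R).
  { intros t Ht. apply (half_plane_open theta w Hw). specialize (Hseg t Ht).
    replace (w + h * RtoC t - w) with (h * RtoC t) by ring. lra. }
  pose proof (path_mvt (fun t => U (w + h * RtoC t) - F w * (0 + h * RtoC t) - F' w / 2 * ((0 + h * RtoC t) * (0 + h * RtoC t)))
    (fun t => F (w + h * RtoC t) * h - F w * h - F' w / 2 * (2 * (0 + h * RtoC t) * h)) 0 1 (eps * (Cmod h * Cmod h))) as K.
  cbv beta in K.
  replace (U z - U w - F w * h - F' w / 2 * (h * h)) with
   (U (w + h * 1) - F w * (0 + h * 1) - F' w / 2 * ((0 + h * 1) * (0 + h * 1)) -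
    (U (w + h * 0) - F w * (0 + h * 0) - F' w / 2 * ((0 + h * 0) * (0 + h * 0)))).
  2:{ replace (w + h * 1) with z by (unfold h; ring). replace (w + h * 0) with w by ring. ring. }
  eapply Rle_trans; [apply K|]; try lra.
  - intros t Ht. apply rderiv_minus; [apply rderiv_minus|].
    + apply (cderiv_rderiv_comp U); [apply rderiv_line|apply HU, Hin, Ht].
    + apply rderiv_scal, rderiv_line.
    + apply rderiv_scal. apply (cderiv_rderiv_comp (fun w => w * w)); [apply rderiv_line|apply cderiv_sqr].
  - intros t Ht. assert (L : rdiff (fun t => 0 + h * RtoC t) t) by (eexists; apply rderiv_line).
    assert (L' : rdiff (fun t => w + h * RtoC t) t) by (eexists; apply rderiv_line).
    repeat first [apply rdiff_minus | apply rdiff_mult | apply rdiff_const | exact L].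
    apply (rdiff_comp F _ _ _ (HF _ (Hin t Ht)) L').
  - intros t Ht.
    replace (F (w + h * RtoC t) * h - F w * h - F' w / 2 * (2 * (0 + h * RtoC t) * h))
     with ((F (w + h * RtoC t) - F w - F' w * (w + h * RtoC t - w)) * h) by (field; apply two_neq_0).
    specialize (Hseg t Ht). specialize (Hd' (w + h * RtoC t)).
    replace (w + h * RtoC t - w) with (h * RtoC t) in * by ring.
    rewrite <- Rmult_assoc. apply Cmod_mult_le; [|lra].
    eapply Rle_trans; [apply Hd'; lra|]. apply Rmult_le_compat_l; lra.
Qed.

Definition quot (U : C -> C) (Fw w z : C) : C :=
  if Ceq_dec z w then Fw else (U z - U w) * / (z - w).

(* The singularity at [w] is removable because [U] has a second-order expansion there;
   hence Goursat's theorem applies to the quotient, which yields Cauchy's formula. *)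
Lemma quot_holo theta U F F' w : holo theta U F -> holo theta F F' -> (theta < Re w)%R ->
  exists q', holo theta (quot U (F w) w) q'.
Proof.
  intros HU HF Hw.
  assert (K : forall z, (theta < Re z)%R -> exists l, cderiv (quot U (F w) w) z l).
  { intros z Hz. destruct (Ceq_dec z w) as [->|Hzw].
    - exists (F' w / 2). intros eps He.
      destruct (second_order theta U F F' w HU HF Hw eps He) as [d [Hd H]].
      exists d; split; [exact Hd|]. intros z Hzd. specialize (H z Hzd).
      unfold quot. destruct (Ceq_dec w w) as [_|N]; [|congruence].
      destruct (Ceq_dec z w) as [->|N].
      + replace (F w - F w - F' w / 2 * (w - w)) with (RtoC 0) by ring. rewrite Cmod_0.
        pose proof (Cmod_ge_0 (w - w)); nra.
      + assert (Nz : z - w <> 0) by (apply Cminus_eq_contra, N).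
        assert (P : (0 < Cmod (z - w))%R) by (apply Cmod_gt_0, Nz).
        apply (Rmult_le_reg_r (Cmod (z - w))); [exact P|].
        rewrite <- Cmod_mult.
        replace (((U z - U w) * / (z - w) - F w - F' w / 2 * (z - w)) * (z - w))
          with (U z - U w - F w * (z - w) - F' w / 2 * ((z - w) * (z - w))).
        * rewrite Rmult_assoc; exact H.
        * field. auto using two_neq_0.
    - assert (Nz : z - w <> 0) by (apply Cminus_eq_contra, Hzw).
      eexists. apply (cderiv_ext_loc (fun z => (U z - U w) * / (z - w)) _ _ _ (Cmod (z - w))).
      + apply Cmod_gt_0, Nz.
      + intros x Hx. unfold quot. destruct (Ceq_dec x w) as [->|N]; [|reflexivity].
        rewrite Cmod_sub_sym in Hx. lra.
      + apply cderiv_mult.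
        * apply cderiv_minus; [apply HU, Hz|apply cderiv_const].
        * apply (cderiv_comp Cinv (fun z => z - w)); [apply cderiv_shift|apply cderiv_inv, Nz]. }
  exists (fun z => C_derive (quot U (F w) w) z). intros z Hz. destruct (K z Hz) as [l Hl].
  rewrite (cderiv_C_derive _ _ _ Hl). exact Hl.
Qed.

Lemma rdiff_on_circle theta F F' c r : holo theta F F' -> (0 <= r)%R -> (theta < Re c - r)%R ->
  forall t, rdiff (fun t => F (c + circ r t)) t.
Proof.
  intros HF Hr Hc t. apply (rdiff_comp F (fun t => c + circ r t) t (F' (c + circ r t))).
  - apply HF. apply (Re_ball_gt theta c _ r); [rewrite Cmod_circ; lra|exact Hc].
  - rdiff_auto.
Qed.

Lemma rderiv_on_circle theta F F' c r : holo theta F F' -> (0 <= r)%R -> (theta < Re c - r)%R ->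
  forall t, rderiv (fun t => F (c + circ r t)) t (F' (c + circ r t) * (Ci * circ r t)).
Proof.
  intros HF Hr Hc t. eapply rderiv_eq.
  - apply (cderiv_rderiv_comp F (fun t => c + circ r t)).
    + apply rderiv_plus; [apply rderiv_const|apply rderiv_circ].
    + apply HF. apply (Re_ball_gt theta c _ r); [rewrite Cmod_circ; lra|exact Hc].
  - ring.
Qed.

(** Differentiation under the integral sign, from a remainder that is quadratic in [h] uniformly in
    [t]; for the Cauchy kernels such remainders are explicit. *)
Lemma CI_param_deriv (K : C -> R -> C) (K' : R -> C) v d M : (0 < d)%R -> (0 <= M)%R ->
  (forall h, (Cmod h < d)%R -> rdiff_on (K (v + h)) 0 (2 * PI)) -> rdiff_on K' 0 (2 * PI) ->
  (forall h t, (Cmod h < d)%R -> (0 <= t <= 2 * PI)%R ->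
     (Cmod (K (v + h)%C t - K v t - h * K' t) <= M * (Cmod h * Cmod h))%R) ->
  cderiv (fun v => CI (K v) 0 (2 * PI)) v (CI K' 0 (2 * PI)).
Proof.
  intros Hd HM HK HK' HB eps He. pose proof PI_RGT_0 as Hpi.
  assert (HMp : (0 <= M * (2 * PI))%R) by (apply Rmult_le_pos; lra).
  exists (Rmin d (eps / (M * (2 * PI) + 1))); split.
  { apply Rmin_pos; [exact Hd|]. apply Rdiv_lt_0_compat; lra. }
  intros w Hw. set (h := w - v) in *.
  assert (H1 := Rlt_le_trans _ _ _ Hw (Rmin_l _ _)).
  assert (H2 := Rlt_le_trans _ _ _ Hw (Rmin_r _ _)).
  replace w with (v + h) by (unfold h; ring).
  assert (D0 : rdiff_on (K v) 0 (2 * PI)).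
  { replace v with (v + 0) by ring. apply HK. rewrite Cmod_0; exact Hd. }
  assert (D1 := HK h H1).
  assert (D2 : rdiff_on (fun t => h * K' t) 0 (2 * PI)) by (intros t Ht; apply rdiff_scal, HK', Ht).
  assert (E : CI (K (v + h)) 0 (2 * PI) - CI (K v) 0 (2 * PI) - CI K' 0 (2 * PI) * h
     = CI (fun t => K (v + h) t - K v t - h * K' t) 0 (2 * PI)).
  { rewrite (CI_minus (fun t => K (v + h) t - K v t) (fun t => h * K' t)); auto using PI2_pos.
    - rewrite (CI_minus (K (v + h)) (K v)) by (auto using PI2_pos). rewrite CI_scal by (auto using PI2_pos). ring.
    - intros t Ht; apply rdiff_minus; [apply D1|apply D0]; exact Ht. }
  rewrite E. eapply Rle_trans.
  - apply (CI_bound _ _ _ (M * (Cmod h * Cmod h))); [lra| |].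
    + intros t Ht; apply rdiff_minus; [apply rdiff_minus; [apply D1|apply D0]|apply D2]; exact Ht.
    + intros t Ht. apply HB; auto.
  - pose proof (Cmod_ge_0 h) as H0.
    apply lt_div_mult_l in H2; [|lra].
    replace (M * (Cmod h * Cmod h) * (2 * PI - 0))%R with ((M * (2 * PI) * Cmod h) * Cmod h)%R by ring.
    apply Rmult_le_compat_r; lra.
Qed.

Lemma rdiff_on_bounded u a b : (a <= b)%R -> rdiff_on u a b ->
  exists M, (0 <= M)%R /\ forall t, (a <= t <= b)%R -> (Cmod (u t) <= M)%R.
Proof.
  intros Hab Hu.
  destruct (bounded_continuity (V := C_R_NormedModule) u a b) as [M HM].
  { intros t Ht. apply rdiff_continuous, Hu, Ht. }
  assert (Ha := HM a ltac:(lra)). rewrite <- Cmod_norm in Ha. pose proof (Cmod_ge_0 (u a)).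
  exists M; split; [lra|]. intros t Ht. rewrite Cmod_norm. left; apply HM, Ht.
Qed.

Section Kernels.
Variables (r : R) (rho : R -> C) (v : C).
Hypothesis Hr : (0 < r)%R.
Hypothesis Hv : (Cmod v < r)%R.
Hypothesis Hrho : forall t, rdiff rho t.

(** With [x = circ r t - v] the remainder of the kernel is exactly [h^2 / (x^2 (x - h))]. For
    [Cmod h < d / 2] the factors [x] and [x - h] have modulus at least [d] and [d / 2]. *)
Lemma kernel_deriv_1 :
  cderiv (fun v => CI (fun t => rho t * / (circ r t - v)) 0 (2 * PI)) v
    (CI (fun t => rho t * (/ (circ r t - v) * / (circ r t - v))) 0 (2 * PI)).
Proof.
  destruct (rdiff_on_bounded rho 0 (2 * PI) PI2_pos (fun t _ => Hrho t)) as [M [HM0 HM]].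
  set (d := (r - Cmod v)%R). assert (Hd : (0 < d)%R) by (unfold d; lra).
  assert (Hh : forall h, (Cmod h < d / 2)%R -> (Cmod (v + h) < r)%R).
  { intros h Hh. pose proof (Cmod_triangle v h). unfold d in *. lra. }
  apply (CI_param_deriv (fun v t => rho t * / (circ r t - v)) _ v (d / 2) (M * (/ d * / d * / (d / 2)))%R).
  - lra.
  - assert (0 < / d)%R by (apply Rinv_0_lt_compat; lra). assert (0 < / (d / 2))%R by (apply Rinv_0_lt_compat; lra).
    repeat apply Rmult_le_pos; lra.
  - intros h Hh' t Ht. rdiff_auto.
  - intros t Ht. apply rdiff_mult; [apply Hrho|]. apply rdiff_mult; apply rdiff_circ_inv; auto.
  - intros h t Hh' Ht.
    set (x := circ r t - v).
    assert (N1 : x <> 0) by (apply circ_sub_neq_0; auto).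
    assert (N2 : x - h <> 0) by (unfold x; replace (circ r t - v - h) with (circ r t - (v + h)) by ring; apply circ_sub_neq_0; auto).
    replace (circ r t - (v + h)) with (x - h) by (unfold x; ring).
    replace (rho t * / (x - h) - rho t * / x - h * (rho t * (/ x * / x)))
      with (rho t * (/ x * / x * / (x - h)) * (h * h)) by (field; auto).
    assert (L1 : (d <= Cmod x)%R) by (apply circ_sub_ge; auto).
    assert (L2 : (d / 2 <= Cmod (x - h))%R) by (pose proof (Cmod_le_sub x h); lra).
    assert (I1 : (Cmod (/ x) <= / d)%R) by (rewrite Cmod_inv by auto; apply Rinv_le_contravar; lra).
    assert (I2 : (Cmod (/ (x - h)) <= / (d / 2))%R) by (rewrite Cmod_inv by auto; apply Rinv_le_contravar; lra).
    repeat apply Cmod_mult_le; auto; lra.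
Qed.

(** Only the existence of the derivative is recorded, which is what the differentiability of [F']
    requires. *)
Lemma kernel_deriv_2 : exists l,
  cderiv (fun v => CI (fun t => rho t * (/ (circ r t - v) * / (circ r t - v))) 0 (2 * PI)) v l.
Proof.
  destruct (rdiff_on_bounded rho 0 (2 * PI) PI2_pos (fun t _ => Hrho t)) as [M [HM0 HM]].
  set (d := (r - Cmod v)%R). assert (Hd : (0 < d)%R) by (unfold d; lra).
  assert (Hh : forall h, (Cmod h < d / 2)%R -> (Cmod (v + h) < r)%R).
  { intros h Hh. pose proof (Cmod_triangle v h). unfold d in *. lra. }
  exists (CI (fun t => rho t * (2 * (/ (circ r t - v) * / (circ r t - v) * / (circ r t - v)))) 0 (2 * PI)).
  apply (CI_param_deriv (fun v t => rho t * (/ (circ r t - v) * / (circ r t - v))) _ v (d / 2)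
    (M * (4 * (/ d * / d * / (d / 2) * / (d / 2))))%R).
  - lra.
  - assert (0 < / d)%R by (apply Rinv_0_lt_compat; lra). assert (0 < / (d / 2))%R by (apply Rinv_0_lt_compat; lra).
    repeat apply Rmult_le_pos; lra.
  - intros h Hh' t Ht. apply rdiff_mult; [apply Hrho|]. apply rdiff_mult; apply rdiff_circ_inv; auto.
  - intros t Ht. apply rdiff_mult; [apply Hrho|]. apply rdiff_scal.
    repeat apply rdiff_mult; apply rdiff_circ_inv; auto.
  - intros h t Hh' Ht.
    set (x := circ r t - v).
    assert (N1 : x <> 0) by (apply circ_sub_neq_0; auto).
    assert (N2 : x - h <> 0) by (unfold x; replace (circ r t - v - h) with (circ r t - (v + h)) by ring; apply circ_sub_neq_0; auto).
    replace (circ r t - (v + h)) with (x - h) by (unfold x; ring).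
    replace (rho t * (/ (x - h) * / (x - h)) - rho t * (/ x * / x) - h * (rho t * (2 * (/ x * / x * / x))))
      with (rho t * ((3 - 2 * h * / x) * (/ x * / x * / (x - h) * / (x - h))) * (h * h)) by (field; auto).
    assert (L1 : (d <= Cmod x)%R) by (apply circ_sub_ge; auto).
    assert (L2 : (d / 2 <= Cmod (x - h))%R) by (pose proof (Cmod_le_sub x h); lra).
    assert (I1 : (Cmod (/ x) <= / d)%R) by (rewrite Cmod_inv by auto; apply Rinv_le_contravar; lra).
    assert (I2 : (Cmod (/ (x - h)) <= / (d / 2))%R) by (rewrite Cmod_inv by auto; apply Rinv_le_contravar; lra).
    (* Here [h / x] has modulus at most [1 / 2], so the bound is [3 + 1]. *)
    assert (I3 : (Cmod (3 - 2 * h * / x) <= 4)%R).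
    { unfold Cminus. eapply Rle_trans; [apply Cmod_triangle|]. rewrite Cmod_opp, !Cmod_mult, !Cmod_R, !Rabs_pos_eq by lra.
      assert (Cmod h * Cmod (/ x) <= d / 2 * / d)%R by (apply Rmult_le_compat; try apply Cmod_ge_0; lra).
      replace (d / 2 * / d)%R with (/ 2)%R in H by (field; lra). lra. }
    repeat apply Cmod_mult_le; auto; lra.
Qed.

End Kernels.

(* The integral is constant in [v], its derivative being the integral of a derivative. *)
Lemma CI_circ_kernel r v : (0 < r)%R -> (Cmod v < r)%R ->
  CI (fun t => circ r t * / (circ r t - v)) 0 (2 * PI) = RtoC (2 * PI).
Proof.
  intros Hr Hv.
  assert (Hseg : forall t, (0 <= t <= 1)%R -> (Cmod (0 + v * RtoC t) < r)%R).
  { intros t Ht. rewrite Cplus_0_l, Cmod_mult, Cmod_R, Rabs_pos_eq by lra. pose proof (Cmod_ge_0 v); nra. }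
  assert (D : forall w, (Cmod w < r)%R -> cderiv (fun v => CI (fun t => circ r t * / (circ r t - v)) 0 (2 * PI)) w 0).
  { intros w Hw. eapply cderiv_eq; [apply (kernel_deriv_1 r (circ r) w Hr Hw (rdiff_circ r))|].
    (* [Ci / (circ r t - w)] is a primitive in [t] of the integrand, since the square of [Ci] is
       [- 1], and it takes the same value at [0] and [2 * PI]. *)
    rewrite (CI_FTC (fun t => Ci * / (circ r t - w))).
    - rewrite circ_2PI. ring.
    - apply PI2_pos.
    - intros t _. pose proof (circ_sub_neq_0 r t w Hr Hw) as N. eapply rderiv_eq.
      + apply rderiv_scal. apply (cderiv_rderiv_comp Cinv (fun t => circ r t - w)); [|apply cderiv_inv, N].
        apply rderiv_minus; [apply rderiv_circ|apply rderiv_const].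
      + transitivity (- (Ci * Ci) * (circ r t * (/ (circ r t - w) * / (circ r t - w)))); [field; exact N|].
        replace (Ci * Ci) with (- (1)) by (apply injective_projections; simpl; ring). ring.
    - intros t _. apply rdiff_mult; [apply rdiff_circ|]. apply rdiff_mult; apply rdiff_circ_inv; auto. }
  pose proof (path_mvt (fun x => CI (fun t => circ r t * / (circ r t - (0 + v * RtoC x))) 0 (2 * PI)) (fun _ => 0 * v) 0 1 0) as K.
  cbv beta in K. replace (0 + v * 1) with v in K by ring. replace (0 + v * 0) with (RtoC 0) in K by ring.
  (* At [v = 0] the integrand is the constant [1], which fixes the value of the integral. *)
  rewrite (CI_ext (fun t => circ r t * / (circ r t - 0)) (fun _ => 1) _ _ PI2_pos) in K.
  2:{ intros t _. replace (circ r t - 0) with (circ r t) by ring. apply Cinv_r, circ_neq_0, Hr. }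
  rewrite CI_const, Rminus_0_r, Cmult_1_r in K.
  apply Ceq_minus, Cmod_eq_0, Rle_antisym; [|apply Cmod_ge_0].
  rewrite Rmult_0_l in K. apply K; try lra.
  - intros t Ht. apply (cderiv_rderiv_comp (fun v => CI (fun t => circ r t * / (circ r t - v)) 0 (2 * PI)) (fun x => 0 + v * RtoC x));
      [apply rderiv_line|apply D, Hseg, Ht].
  - intros t _. rdiff_auto.
  - intros t _. rewrite Cmult_0_l, Cmod_0. lra.
Qed.

(** The quotient [q] is holomorphic, so it has a primitive and its integral over the circle
    vanishes; separating the two terms of its numerator leaves the kernel integral [2 * PI]. The
    formula is obtained first for [U], which is known to be twice differentiable. *)
Lemma cauchy_formula_of_primitive theta U F F' c r v : holo theta U F -> holo theta F F' ->
  (0 < r)%R -> (theta < Re c - r)%R -> (Cmod v < r)%R ->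
  CI (fun t => U (c + circ r t) * circ r t * / (circ r t - v)) 0 (2 * PI) = RtoC (2 * PI) * U (c + v).
Proof.
  intros HU HF Hr Hc Hv.
  assert (Hw : (theta < Re (c + v))%R) by (apply (Re_ball_gt theta c v r); lra).
  destruct (quot_holo theta U F F' (c + v) HU HF Hw) as [q' Hq].
  set (q := quot U (F (c + v)) (c + v)) in *.
  destruct (primitive_exists theta q q' Hq) as [Q HQ].
  assert (E0 : CI (fun t => q (c + circ r t) * (Ci * circ r t)) 0 (2 * PI) = 0).
  { rewrite (CI_FTC (fun t => Q (c + circ r t))).
    - rewrite circ_2PI. ring.
    - apply PI2_pos.
    - intros t _. apply (rderiv_on_circle theta Q q); auto; lra.
    - intros t _. apply rdiff_mult; [apply (rdiff_on_circle theta q q'); auto; lra|].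
      apply rdiff_scal, rdiff_circ. }
  rewrite (CI_ext _ (fun t => Ci * (U (c + circ r t) * circ r t * / (circ r t - v) - U (c + v) * (circ r t * / (circ r t - v)))) _ _ PI2_pos) in E0.
  2:{ intros t _. unfold q, quot. destruct Ceq_dec as [E|N].
      - exfalso. apply (circ_sub_neq_0 r t v Hr Hv).
        replace (circ r t - v) with (c + circ r t - (c + v)) by ring. rewrite E; ring.
      - replace (c + circ r t - (c + v)) with (circ r t - v) by ring. ring. }
  assert (D1 : rdiff_on (fun t => U (c + circ r t) * circ r t * / (circ r t - v)) 0 (2 * PI)).
  { intros t _. apply rdiff_mult; [apply rdiff_mult|].
    - apply (rdiff_on_circle theta U F); auto; lra.
    - apply rdiff_circ.
    - apply rdiff_circ_inv; auto. }
  assert (D2 : rdiff_on (fun t => circ r t * / (circ r t - v)) 0 (2 * PI)).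
  { intros t _. apply rdiff_mult; [apply rdiff_circ|apply rdiff_circ_inv; auto]. }
  assert (D3 : rdiff_on (fun t => U (c + v) * (circ r t * / (circ r t - v))) 0 (2 * PI)).
  { intros t Ht. apply rdiff_scal, D2, Ht. }
  rewrite CI_scal in E0; [|apply PI2_pos|].
  2:{ intros t Ht. apply rdiff_minus; [apply D1, Ht|apply D3, Ht]. }
  rewrite CI_minus in E0 by (auto using PI2_pos).
  rewrite CI_scal, CI_circ_kernel in E0 by (auto using PI2_pos).
  apply (f_equal (fun x => / Ci * x)) in E0.
  rewrite Cmult_assoc, Cinv_l, Cmult_1_l, Cmult_0_r in E0 by apply Ci_nz.
  apply Ceq_minus in E0. rewrite E0. ring.
Qed.

Section Cauchy.
Variables (theta : R) (F F' : C -> C).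
Hypothesis HF : holo theta F F'.

Lemma rdiff_circ_kernel (G : C -> C) c r t : (forall t, rdiff (fun t => G (c + circ r t)) t) ->
  rdiff (fun t => G (c + circ r t) * circ r t) t.
Proof. intros H. apply rdiff_mult; [apply H|apply rdiff_circ]. Qed.

(** Differentiating in [v] the formula for a primitive [U] of [F] expresses [F] by an integral of
    [U] against the squared kernel; integration by parts on the closed circle moves the derivative
    back onto [U]. *)
Theorem cauchy_formula c r v : (0 < r)%R -> (theta < Re c - r)%R -> (Cmod v < r)%R ->
  CI (fun t => F (c + circ r t) * circ r t * / (circ r t - v)) 0 (2 * PI) = RtoC (2 * PI) * F (c + v).
Proof.
  intros Hr Hc Hv.
  destruct (primitive_exists theta F F' HF) as [U HU].
  assert (DU : forall t, rdiff (fun t => U (c + circ r t)) t) by (apply (rdiff_on_circle theta U F); auto; lra).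
  assert (DF : forall t, rdiff (fun t => F (c + circ r t)) t) by (apply (rdiff_on_circle theta F F'); auto; lra).
  pose proof (kernel_deriv_1 r (fun t => U (c + circ r t) * circ r t) v Hr Hv (fun t => rdiff_circ_kernel U c r t DU)) as K.
  assert (K2 : cderiv (fun v => CI (fun t => U (c + circ r t) * circ r t * / (circ r t - v)) 0 (2 * PI)) v (RtoC (2 * PI) * F (c + v))).
  { apply (cderiv_ext_loc (fun v => RtoC (2 * PI) * U (c + v)) _ _ _ (r - Cmod v)); [lra| |].
    - intros w Hw. symmetry. apply (cauchy_formula_of_primitive theta U F F'); auto.
      pose proof (Cmod_le_sub w v). lra.
    - apply cderiv_scal, cderiv_translate, HU. apply (Re_ball_gt theta c v r); lra. }
  rewrite <- (cderiv_unique _ _ _ _ K K2).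
  assert (D1 : forall t, rdiff (fun t => F (c + circ r t) * circ r t * / (circ r t - v)) t).
  { intros t. apply rdiff_mult; [apply rdiff_circ_kernel, DF|apply rdiff_circ_inv; auto]. }
  assert (D2 : forall t, rdiff (fun t => U (c + circ r t) * circ r t * (/ (circ r t - v) * / (circ r t - v))) t).
  { intros t. apply rdiff_mult; [apply rdiff_circ_kernel, DU|]. apply rdiff_mult; apply rdiff_circ_inv; auto. }
  apply Ceq_minus. rewrite <- CI_minus by (try apply PI2_pos; intros t _; auto).
  replace (RtoC 0) with (/ Ci * (U (c + circ r (2 * PI)) * / (circ r (2 * PI) - v)) - / Ci * (U (c + circ r 0) * / (circ r 0 - v))).
  2:{ rewrite circ_2PI; ring. }
  apply (CI_FTC (fun t => / Ci * (U (c + circ r t) * / (circ r t - v)))).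
  - apply PI2_pos.
  - intros t _. eapply rderiv_eq.
    + apply rderiv_scal, rderiv_mult.
      * apply (rderiv_on_circle theta U F); auto; lra.
      * apply (cderiv_rderiv_comp Cinv (fun t => circ r t - v)).
        -- apply rderiv_minus; [apply rderiv_circ|apply rderiv_const].
        -- apply cderiv_inv, circ_sub_neq_0; auto.
    + cbv beta. field. split; [apply circ_sub_neq_0; auto|apply Ci_nz].
  - intros t _. apply rdiff_minus; auto.
Qed.

Lemma cauchy_formula_deriv c r v : (0 < r)%R -> (theta < Re c - r)%R -> (Cmod v < r)%R ->
  CI (fun t => F (c + circ r t) * circ r t * (/ (circ r t - v) * / (circ r t - v))) 0 (2 * PI) = RtoC (2 * PI) * F' (c + v).
Proof.
  intros Hr Hc Hv.
  assert (DF : forall t, rdiff (fun t => F (c + circ r t)) t) by (apply (rdiff_on_circle theta F F'); auto; lra).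
  pose proof (kernel_deriv_1 r (fun t => F (c + circ r t) * circ r t) v Hr Hv (fun t => rdiff_circ_kernel F c r t DF)) as K.
  apply (cderiv_unique _ _ _ _ K).
  apply (cderiv_ext_loc (fun v => RtoC (2 * PI) * F (c + v)) _ _ _ (r - Cmod v)); [lra| |].
  - symmetry. apply cauchy_formula; auto.
    pose proof (Cmod_le_sub w v). lra.
  - apply cderiv_scal, cderiv_translate, HF. apply (Re_ball_gt theta c v r); lra.
Qed.

(** Around [c], [F'] is an integral of [F] against the squared Cauchy kernel, and such integrals are
    differentiable in [v]. *)
Theorem holo_deriv : exists F'', holo theta F' F''.
Proof.
  exists (C_derive F'). intros c Hc.
  assert (K : exists l, cderiv F' c l).
  { set (r := ((Re c - theta) / 2)%R).
    assert (Hr : (0 < r)%R) by (unfold r; lra). assert (Hcr : (theta < Re c - r)%R) by (unfold r; lra).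
    assert (DF : forall t, rdiff (fun t => F (c + circ r t)) t) by (apply (rdiff_on_circle theta F F'); auto; lra).
    destruct (kernel_deriv_2 r (fun t => F (c + circ r t) * circ r t) 0 Hr ltac:(rewrite Cmod_0; lra)
       (fun t => rdiff_circ_kernel F c r t DF)) as [l Hl].
    exists (/ RtoC (2 * PI) * l). apply cderiv_untranslate.
    eapply cderiv_ext_loc; [exact Hr| |apply (cderiv_scal (/ RtoC (2 * PI))), Hl].
    intros w Hw. replace (w - 0) with w in Hw by ring. cbv beta. rewrite cauchy_formula_deriv by auto.
    field. apply TPI_neq_0. }
  destruct K as [l Hl]. rewrite (cderiv_C_derive _ _ _ Hl). exact Hl.
Qed.

Lemma cauchy_estimate c r B : (0 < r)%R -> (theta < Re c - r)%R ->
  (forall w, (Cmod (w - c) = r)%R -> (Cmod (F w) <= B)%R) -> (Cmod (F' c) <= B / r)%R.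
Proof.
  intros Hr Hc HB.
  assert (DF : forall t, rdiff (fun t => F (c + circ r t)) t) by (apply (rdiff_on_circle theta F F'); auto; lra).
  pose proof (cauchy_formula_deriv c r 0 Hr Hc ltac:(rewrite Cmod_0; lra)) as E.
  rewrite Cplus_0_r in E. pose proof PI_RGT_0.
  apply (Rmult_le_reg_l (2 * PI)); [lra|].
  replace (2 * PI * Cmod (F' c))%R with (Cmod (RtoC (2 * PI) * F' c)).
  2:{ rewrite Cmod_mult, Cmod_R, Rabs_pos_eq; lra. }
  rewrite <- E. replace (2 * PI * (B / r))%R with (B * / r * (2 * PI - 0))%R by (field; lra).
  rewrite (CI_ext _ (fun t => F (c + circ r t) * / (circ r t - 0)) _ _ PI2_pos).
  2:{ intros t _. field. apply circ_neq_0; auto. }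
  apply CI_bound; [lra| |].
  - intros t _. apply rdiff_mult; [apply DF|apply rdiff_circ_inv; [auto|rewrite Cmod_0; lra]].
  - intros t _. apply Cmod_mult_le.
    + apply HB. replace (c + circ r t - c) with (circ r t) by ring. apply Cmod_circ; lra.
    + replace (circ r t - 0) with (circ r t) by ring. rewrite Cmod_inv by (apply circ_neq_0; auto).
      rewrite Cmod_circ; lra.
Qed.

(** In Cauchy's formulas the kernels combine to [v^2 / (x (x - v))] with [x = circ r t]; the
    condition [Cmod v <= r / 2] keeps [x - v] at least [r / 2] in modulus, whence the factor [2]. *)
Lemma taylor_1 c r v B : (0 < r)%R -> (theta < Re c - r)%R -> (Cmod v <= r / 2)%R ->
  (forall w, (Cmod (w - c) = r)%R -> (Cmod (F w) <= B)%R) ->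
  (Cmod (F (c + v) - F c - F' c * v) <= 2 * B / (r * r) * (Cmod v * Cmod v))%R.
Proof.
  intros Hr Hc Hv HB. pose proof PI_RGT_0 as Hpi.
  assert (H0 : (Cmod 0 < r)%R) by (rewrite Cmod_0; lra). assert (H1 : (Cmod v < r)%R) by lra.
  assert (DF : forall t, rdiff (fun t => F (c + circ r t)) t) by (apply (rdiff_on_circle theta F F'); auto; lra).
  assert (DK : forall v, (Cmod v < r)%R -> rdiff_on (fun t => F (c + circ r t) * circ r t * / (circ r t - v)) 0 (2 * PI)).
  { intros v' Hv' t _. rdiff_auto. }
  assert (DK' : rdiff_on (fun t => v * (F (c + circ r t) * circ r t * (/ (circ r t - 0) * / (circ r t - 0)))) 0 (2 * PI)).
  { intros t _. apply rdiff_scal, rdiff_mult; [apply rdiff_circ_kernel, DF|apply rdiff_mult; apply rdiff_circ_inv; auto]. }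
  assert (E : RtoC (2 * PI) * (F (c + v) - F c - F' c * v) =
    CI (fun t => F (c + circ r t) * circ r t * / (circ r t - v) - F (c + circ r t) * circ r t * / (circ r t - 0)
      - v * (F (c + circ r t) * circ r t * (/ (circ r t - 0) * / (circ r t - 0)))) 0 (2 * PI)).
  { rewrite CI_minus; [|lra| |exact DK'].
    - rewrite CI_minus; [|lra|apply DK, H1|apply DK, H0].
      rewrite CI_scal; [|lra|].
      + rewrite !cauchy_formula, cauchy_formula_deriv, Cplus_0_r by auto. ring.
      + intros t _. apply rdiff_mult; [apply rdiff_circ_kernel, DF|apply rdiff_mult; apply rdiff_circ_inv; auto].
    - intros t Ht. apply rdiff_minus; apply DK; auto. }
  apply (Rmult_le_reg_l (2 * PI)); [lra|].
  replace (2 * PI * Cmod (F (c + v) - F c - F' c * v))%R with (Cmod (RtoC (2 * PI) * (F (c + v) - F c - F' c * v))).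
  2:{ rewrite Cmod_mult, Cmod_R, Rabs_pos_eq; lra. }
  rewrite E.
  replace (2 * PI * (2 * B / (r * r) * (Cmod v * Cmod v)))%R with ((B * (/ r * / (r / 2)) * (Cmod v * Cmod v)) * (2 * PI - 0))%R by (field; lra).
  apply CI_bound; [lra| |].
  - intros t Ht. apply rdiff_minus; [apply rdiff_minus; apply DK; auto|apply DK', Ht].
  - intros t _.
    pose proof (circ_neq_0 r t Hr) as N1. pose proof (circ_sub_neq_0 r t v Hr H1) as N2.
    replace (circ r t - 0) with (circ r t) by ring.
    replace (F (c + circ r t) * circ r t * / (circ r t - v) - F (c + circ r t) * circ r t * / circ r t - v * (F (c + circ r t) * circ r t * (/ circ r t * / circ r t)))
      with (F (c + circ r t) * (/ circ r t * / (circ r t - v)) * (v * v)) by (field; auto).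
    pose proof (circ_sub_ge r t v Hr H1).
    repeat apply Cmod_mult_le; try lra.
    + apply HB. replace (c + circ r t - c) with (circ r t) by ring. apply Cmod_circ; lra.
    + rewrite Cmod_inv, Cmod_circ by (auto; lra). lra.
    + rewrite Cmod_inv by auto. apply Rinv_le_contravar; lra.
Qed.

End Cauchy.

(** * Propagation of smallness, identity principle, Weierstrass' theorem *)

(** This is [2 * PI] times the [j]-th Taylor coefficient of [F] at [c], computed on the circle of
    radius [r]. *)
Definition taylor_coef (F : C -> C) (c : C) (j : nat) (r : R) : C :=
  CI (fun t => F (c + circ r t) * (/ circ r t) ^ j) 0 (2 * PI).

Lemma rdiff_pow u t j : rdiff u t -> rdiff (fun t => u t ^ j) t.
Proof.
  intros H; induction j as [|j IH]; simpl.
  - apply rdiff_const.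
  - apply rdiff_mult; auto.
Qed.

Lemma cderiv_pow f z l j : cderiv f z l -> exists m, cderiv (fun z => f z ^ j) z m.
Proof.
  intros H; induction j as [|j [m IH]]; simpl.
  - eexists; apply cderiv_const.
  - eexists; apply cderiv_mult; eauto.
Qed.

(** In the coordinate [c + exp (- xi)] a circle is run clockwise as [Im xi] grows, so its parameter
    has to be reflected. *)
Lemma CI_reflect u a b : (a <= b)%R -> rdiff_on u a b ->
  CI (fun t => u (a + b - t)%R) a b = CI u a b.
Proof.
  intros Hab Hu. apply CI_unique.
  pose proof (is_RInt_comp_lin (V := C_R_NormedModule) u (-1) (a + b) a b (- CI u a b)) as H.
  assert (H' : is_RInt (V := C_R_NormedModule) u (-1 * a + (a + b)) (-1 * b + (a + b)) (- CI u a b)).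
  { replace (-1 * a + (a + b))%R with b by ring. replace (-1 * b + (a + b))%R with a by ring.
    apply (is_RInt_swap (V := C_R_NormedModule)), CI_correct; auto. }
  specialize (H H'). apply (is_RInt_scal (V := C_R_NormedModule) _ a b (-1)) in H.
  rewrite !scal_R_Cmult in H. replace (RtoC (-1) * - CI u a b) with (CI u a b) in H by ring.
  eapply is_RInt_ext; [|exact H]. intros t _. cbv beta. rewrite !scal_R_Cmult.
  replace (-1 * t + (a + b))%R with (a + b - t)%R by ring.
  assert (E : RtoC (-1) * (RtoC (-1) * u (a + b - t)%R) = u (a + b - t)%R) by ring. exact E.
Qed.

Lemma circ_reflect r t : circ r (0 + 2 * PI - t) = RtoC r * Cexp (- (Ci * RtoC t)).
Proof.
  unfold circ. f_equal.
  replace (Ci * RtoC (0 + 2 * PI - t)) with (Ci * RtoC (INR 1 * (2 * PI)) + - (Ci * RtoC t)).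
  - rewrite Cexp_plus, Cexp_period. ring.
  - simpl INR. rewrite Rmult_1_l, Rplus_0_l, RtoC_minus. ring.
Qed.

(* In the logarithmic coordinate [z = c + exp (- xi)] the circles become vertical segments
   of length [2 PI], whose end points are identified: this is Goursat's theorem there. *)
Lemma taylor_coef_indep theta F F' c j r R0 : holo theta F F' -> (0 < r <= R0)%R -> (theta < Re c - R0)%R ->
  taylor_coef F c j r = taylor_coef F c j R0.
Proof.
  intros HF Hr Hc.
  (* [R1] leaves room beyond [R0], so that the line [Re xi = - ln R0] is interior to the half-plane
     on which [Phi] is holomorphic. *)
  set (R1 := ((R0 + (Re c - theta)) / 2)%R).
  set (Phi := fun xi => F (c + Cexp (- (1) * xi + 0)) * Cexp xi ^ j).
  assert (HPhi : exists Phi', holo (- ln R1) Phi Phi').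
  { assert (K : forall xi, (- ln R1 < Re xi)%R -> exists l, cderiv Phi xi l).
    { intros xi Hxi. destruct (cderiv_pow Cexp xi _ j (cderiv_Cexp xi)) as [m Hm].
      eexists. apply cderiv_mult; [|exact Hm].
      apply (cderiv_comp F (fun xi => c + Cexp (- (1) * xi + 0))).
      - apply cderiv_plus; [apply cderiv_const|apply cderiv_Cexp_lin].
      - apply HF. apply (Re_ball_gt theta c _ R1); [|unfold R1; lra].
        rewrite Cmod_Cexp. replace (Re (- (1) * xi + 0)) with (- Re xi)%R by (unfold Re; simpl; ring).
        rewrite <- (exp_ln R1) by (unfold R1; lra). left; apply exp_increasing; lra. }
    exists (C_derive Phi). intros xi Hxi. destruct (K xi Hxi) as [l Hl].
    rewrite (cderiv_C_derive _ _ _ Hl). exact Hl. }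
  destruct HPhi as [Phi' HPhi].
  assert (HL : (ln r <= ln R0)%R) by (apply ln_le; lra).
  assert (HL' : (ln R0 < ln R1)%R) by (apply ln_increasing; unfold R1; lra).
  pose proof (goursat _ Phi Phi' (- ln R0) (- ln r) 0 (2 * PI) HPhi ltac:(lra) ltac:(lra) PI2_pos) as G.
  unfold rect_int in G.
  rewrite (CI_ext (fun x => Phi (x, 2 * PI)%R) (fun x => Phi (x, 0%R))) in G; [|lra|].
  2:{ intros x _. unfold Phi.
      replace ((x, (2 * PI)%R) : C) with ((x, 0%R) + Ci * RtoC (INR 1 * (2 * PI))).
      2:{ apply injective_projections; simpl; ring. }
      replace (- (1) * ((x, 0%R) + Ci * RtoC (INR 1 * (2 * PI))) + 0) with (- (1) * (x, 0%R) + 0 + - (Ci * RtoC (INR 1 * (2 * PI)))) by ring.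
      rewrite !Cexp_plus, Cexp_opp, Cexp_period, Cexp_0. f_equal.
      - f_equal. f_equal. field.
      - f_equal. ring. }
  assert (V : forall q, (0 < q <= R0)%R -> taylor_coef F c j q = CI (fun y => Phi (- ln q, y)%R) 0 (2 * PI)).
  { intros q Hq. unfold taylor_coef. rewrite <- CI_reflect; [|apply PI2_pos|].
    - apply CI_ext; [apply PI2_pos|]. intros t _. rewrite circ_reflect. unfold Phi.
      replace (- (1) * (((- ln q)%R, t) : C) + 0) with (RtoC (ln q) + - (Ci * RtoC t)).
      2:{ apply injective_projections; simpl; ring. }
      replace ((((- ln q)%R, t) : C)) with (- (RtoC (ln q) + - (Ci * RtoC t))).
      2:{ apply injective_projections; simpl; ring. }
      rewrite (Cexp_opp (RtoC (ln q) + - (Ci * RtoC t))), Cexp_plus, Cexp_R, exp_ln by lra. reflexivity.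
    - intros t _. apply rdiff_mult.
      + apply (rdiff_on_circle theta F F'); auto; lra.
      + apply rdiff_pow, rdiff_inv; [apply circ_neq_0; lra|apply rdiff_circ]. }
  rewrite (V r), (V R0) by lra.
  set (H0 := CI (fun x => Phi (x, 0%R)) (- ln R0) (- ln r)) in *.
  apply Ceq_minus.
  set (X := CI (fun y => Phi ((- ln r)%R, y)) 0 (2 * PI)) in *.
  set (Y := CI (fun y => Phi ((- ln R0)%R, y)) 0 (2 * PI)) in *.
  replace (H0 + Ci * X - H0 - Ci * Y) with (Ci * (X - Y)) in G by ring.
  replace (X - Y) with (/ Ci * (Ci * (X - Y))) by (field; apply Ci_nz). rewrite G. ring.
Qed.

Section Propagation.
Variables (theta : R) (F F' : C -> C).
Hypothesis HF : holo theta F F'.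

(** Taylor expansion of order [J] at [c]. As the coefficients do not depend on the radius, they are
    estimated on the small circle, where [F] is small, and the remainder on the large one, where [F]
    is only bounded. *)
Lemma propagation c r rho R0 B eta v J : (0 < r <= rho)%R -> (rho < R0)%R -> (theta < Re c - R0)%R ->
  (forall t, (0 <= t <= 2 * PI)%R -> (Cmod (F (c + circ R0 t)) <= B)%R) ->
  (forall t, (0 <= t <= 2 * PI)%R -> (Cmod (F (c + circ r t)) <= eta)%R) ->
  (Cmod v <= rho)%R ->
  (Cmod (F (c + v)) <= eta * INR J * (rho / r) ^ J + B * (rho / R0) ^ J * (R0 / (R0 - rho)))%R.
Proof.
  intros Hr HR Hc HB Heta Hv. pose proof PI_RGT_0 as Hpi.
  assert (H1 : (Cmod v < R0)%R) by lra.
  assert (Hq : (1 <= rho / r)%R).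
  { apply (Rmult_le_reg_r r); [lra|]. unfold Rdiv. rewrite Rmult_assoc, Rinv_l; lra. }
  assert (Heta0 : (0 <= eta)%R).
  { eapply Rle_trans; [apply Cmod_ge_0|]. apply (Heta 0%R). lra. }
  assert (DF : forall q, (0 <= q <= R0)%R -> forall t, rdiff (fun t => F (c + circ q t)) t) by (intros; apply (rdiff_on_circle theta F F'); auto; lra).
  set (Rem := fun J => CI (fun t => F (c + circ R0 t) * (v * / circ R0 t) ^ J * (circ R0 t * / (circ R0 t - v))) 0 (2 * PI)).
  assert (Dinv : forall q t, (0 < q)%R -> rdiff (fun t => / circ q t) t).
  { intros q t Hq0. apply rdiff_inv; [apply circ_neq_0; lra|apply rdiff_circ]. }
  assert (DR : forall J, rdiff_on (fun t => F (c + circ R0 t) * (v * / circ R0 t) ^ J * (circ R0 t * / (circ R0 t - v))) 0 (2 * PI)).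
  { intros J' t _. apply rdiff_mult; [apply rdiff_mult|].
    - apply DF; lra.
    - apply rdiff_pow, rdiff_scal, Dinv; lra.
    - rdiff_auto. }
  (* This is [x / (x - v) = 1 + (v / x) (x / (x - v))] at [x = circ R0 t], integrated. *)
  assert (Hrem : forall J, Rem J = v ^ J * taylor_coef F c J r + Rem (S J)).
  { intros J'. rewrite (taylor_coef_indep theta F F' c J' r R0 HF) by lra.
    unfold Rem, taylor_coef. rewrite <- CI_scal; [|lra|].
    2:{ intros t _. apply rdiff_mult; [apply DF; lra|apply rdiff_pow, Dinv; lra]. }
    rewrite <- CI_plus; [|lra| |apply DR].
    2:{ intros t _. apply rdiff_scal, rdiff_mult; [apply DF; lra|apply rdiff_pow, Dinv; lra]. }
    apply CI_ext; [lra|]. intros t _. rewrite Cpow_S, Cpow_mult_l.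
    pose proof (circ_neq_0 R0 t ltac:(lra)) as N1. pose proof (circ_sub_neq_0 R0 t v ltac:(lra) H1) as N2.
    field. auto. }
  assert (Hcoef : forall j, (j < J)%nat -> (Cmod (v ^ j * taylor_coef F c j r) <= 2 * PI * (eta * (rho / r) ^ J))%R).
  { intros j Hj.
    apply Rle_trans with (rho ^ j * (eta * (/ r) ^ j * (2 * PI - 0)))%R.
    - apply Cmod_mult_le.
      + rewrite Cmod_pow. apply pow_incr. split; [apply Cmod_ge_0|exact Hv].
      + apply CI_bound; [lra| |].
        * intros t _. apply rdiff_mult; [apply DF; lra|apply rdiff_pow, Dinv; lra].
        * intros t Ht. apply Cmod_mult_le; [apply Heta, Ht|].
          rewrite Cmod_pow, Cmod_inv, Cmod_circ by (try apply circ_neq_0; lra). lra.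
    - replace (rho ^ j * (eta * (/ r) ^ j * (2 * PI - 0)))%R with (2 * PI * (eta * (rho / r) ^ j))%R.
      2:{ unfold Rdiv. rewrite Rpow_mult_distr. ring. }
      apply Rmult_le_compat_l; [lra|]. apply Rmult_le_compat_l; [exact Heta0|].
      apply Rle_pow; [exact Hq|lia]. }
  assert (Hsum : forall j, (j <= J)%nat -> (Cmod (Rem 0%nat) <= INR j * (2 * PI * (eta * (rho / r) ^ J)) + Cmod (Rem j))%R).
  { induction j as [|j IH]; intros Hj; [simpl INR; lra|].
    specialize (IH ltac:(lia)). specialize (Hcoef j ltac:(lia)). rewrite S_INR.
    pose proof (Cmod_triangle (v ^ j * taylor_coef F c j r) (Rem (S j))) as T. rewrite <- Hrem in T. lra. }
  specialize (Hsum J (le_n _)).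
  assert (E0 : Rem 0%nat = RtoC (2 * PI) * F (c + v)).
  { rewrite <- (cauchy_formula theta F F' HF c R0 v) by lra. unfold Rem. apply CI_ext; [apply PI2_pos|]. intros; simpl; ring. }
  assert (HRJ : (Cmod (Rem J) <= 2 * PI * (B * (rho / R0) ^ J * (R0 / (R0 - rho))))%R).
  { replace (2 * PI * (B * (rho / R0) ^ J * (R0 / (R0 - rho))))%R
      with (B * (rho * / R0) ^ J * (R0 * / (R0 - rho)) * (2 * PI - 0))%R by (unfold Rdiv; ring).
    unfold Rem. apply CI_bound; [apply PI2_pos|apply DR|]. intros t Ht.
    apply Cmod_mult_le; [apply Cmod_mult_le|].
    - apply HB, Ht.
    - rewrite Cmod_pow, Cmod_mult, Cmod_inv, Cmod_circ by (try apply circ_neq_0; lra).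
      apply pow_incr. split.
      + apply Rmult_le_pos; [apply Cmod_ge_0|left; apply Rinv_0_lt_compat; lra].
      + apply Rmult_le_compat_r; [left; apply Rinv_0_lt_compat; lra|exact Hv].
    - apply Cmod_mult_le; [rewrite Cmod_circ; lra|].
      rewrite Cmod_inv by (apply circ_sub_neq_0; lra).
      apply Rinv_le_contravar; [lra|]. pose proof (circ_sub_ge R0 t v ltac:(lra) H1). lra. }
  rewrite E0, Cmod_mult, Cmod_R, (Rabs_pos_eq (2 * PI)) in Hsum by lra.
  apply (Rmult_le_reg_l (2 * PI)); [lra|]. lra.
Qed.

End Propagation.

(** [J] is fixed first to make the remainder small, then [eta] to beat the growth [(rho / r) ^ J] of
    the polynomial part. [eta] is chosen before [F], [c] and [theta], which is the uniformity
    required along vertical lines. *)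
Lemma small_on_larger_disc B r rho R0 eps : (0 <= B)%R -> (0 < r <= rho)%R -> (rho < R0)%R -> (0 < eps)%R ->
  exists eta, (0 < eta)%R /\ forall theta (F F' : C -> C) (c v : C), holo theta F F' -> (theta < Re c - R0)%R ->
    (forall t, (0 <= t <= 2 * PI)%R -> (Cmod (F (c + circ R0 t)%C) <= B)%R) ->
    (forall t, (0 <= t <= 2 * PI)%R -> (Cmod (F (c + circ r t)%C) <= eta)%R) ->
    (Cmod v <= rho)%R -> (Cmod (F (c + v)%C) <= eps)%R.
Proof.
  intros HB Hr HR He.
  assert (Hq : (0 <= rho / R0 < 1)%R).
  { split; [apply Rdiv_le_0_compat; lra|]. apply (Rmult_lt_reg_r R0); [lra|].
    unfold Rdiv. rewrite Rmult_assoc, Rinv_l; lra. }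
  destruct (pow_small (rho / R0) (B * (R0 / (R0 - rho))) (eps / 2)) as [J HJ]; [exact Hq| |lra|].
  { apply Rmult_le_pos; [exact HB|]. apply Rdiv_le_0_compat; lra. }
  set (W := (INR J * (rho / r) ^ J)%R).
  assert (HW : (0 <= W)%R).
  { apply Rmult_le_pos; [apply pos_INR|]. apply pow_le, Rdiv_le_0_compat; lra. }
  assert (Heta : (0 < eps / 2 / (W + 1))%R) by (apply Rdiv_lt_0_compat; lra).
  exists (eps / 2 / (W + 1))%R. split; [exact Heta|].
  intros theta F F' c v HF Hc HFB HFe Hv.
  eapply Rle_trans; [apply (propagation theta F F' HF c r rho R0 B (eps / 2 / (W + 1)) v J); assumption|].
  replace (eps / 2 / (W + 1) * INR J * (rho / r) ^ J)%R with (eps / 2 / (W + 1) * W)%R by (unfold W; ring).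
  assert (eps / 2 / (W + 1) * (W + 1) = eps / 2)%R by (field; lra). nra.
Qed.

(** A single disc suffices: its centre has the height of [s] and lies so far to the right that the
    circle of radius [1 / 2] is in the zero region, while [s] belongs to a disc still contained in
    the half-plane. *)
Lemma identity_zero theta F F' theta1 : holo theta F F' -> (forall s, (theta1 < Re s)%R -> F s = 0) ->
  forall s, (theta < Re s)%R -> F s = 0.
Proof.
  intros HF H0 s Hs.
  set (x := (Rmax (Rmax theta1 (Re s)) theta + 1)%R).
  assert (Hx : (theta1 + 1 <= x /\ Re s + 1 <= x /\ theta + 1 <= x)%R) by (unfold x; max_bounds; lra).
  set (c := (x, Im s) : C).
  set (rho := (x - Re s)%R). set (R0 := ((rho + (x - theta)) / 2)%R).
  assert (HR : (1 <= rho /\ rho < R0 /\ theta < Re c - R0)%R) by (unfold c, R0, rho; cbn [Re fst]; unfold Re in *; lra).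
  assert (Hv : (Cmod (s - c) <= rho)%R).
  { replace (s - c) with (RtoC (Re s - x)).
    - rewrite Cmod_R, Rabs_left1; unfold rho; lra.
    - apply injective_projections; unfold c, Re, Im; simpl; ring. }
  destruct (rdiff_on_bounded (fun t => F (c + circ R0 t)) 0 (2 * PI) PI2_pos) as [B [HB0 HB]].
  { intros t _. apply (rdiff_on_circle theta F F'); auto; lra. }
  apply Cmod_eq_0, Rle_antisym; [|apply Cmod_ge_0]. apply Rle_eps. intros eps He. rewrite Rplus_0_l.
  destruct (small_on_larger_disc B (1 / 2) rho R0 eps HB0) as [eta [Heta K]]; [lra|lra|exact He|].
  replace s with (c + (s - c)) by ring.
  apply (K theta F F'); auto; [lra|]. intros t _. rewrite H0; [rewrite Cmod_0; lra|].
  apply (Re_ball_gt theta1 c _ (1 / 2)); [rewrite Cmod_circ; lra|unfold c; cbn [Re fst]; lra].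
Qed.

Lemma holo_minus theta F F' G G' : holo theta F F' -> holo theta G G' ->
  holo theta (fun s => F s - G s) (fun s => F' s - G' s).
Proof. intros HF HG s Hs. apply cderiv_minus; auto. Qed.

Lemma identity_eq theta F F' G G' theta1 : holo theta F F' -> holo theta G G' ->
  (forall s, (theta1 < Re s)%R -> F s = G s) -> forall s, (theta < Re s)%R -> F s = G s.
Proof.
  intros HF HG H s Hs. apply Ceq_minus.
  apply (identity_zero theta (fun s => F s - G s) (fun s => F' s - G' s) theta1 (holo_minus _ _ _ _ _ HF HG)); auto.
  intros w Hw. rewrite H by exact Hw. ring.
Qed.

Definition clim (u : nat -> C) (l : C) : Prop :=
  forall eps : R, (0 < eps)%R -> exists N, forall n, (N <= n)%nat -> (Cmod (u n - l) <= eps)%R.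

Lemma clim_cauchy u :
  (forall eps : R, (0 < eps)%R -> exists N, forall m n, (N <= m)%nat -> (N <= n)%nat -> (Cmod (u m - u n) <= eps)%R) ->
  exists l, clim u l.
Proof.
  intros H.
  destruct (Rcomplete.R_complete (fun n => Re (u n))) as [a Ha].
  { intros eps He. destruct (H (eps / 2)%R ltac:(lra)) as [N HN]. exists N. intros n m Hn Hm.
    unfold Rdist. pose proof (re_le_Cmod (u n - u m)) as T. rewrite re_sub in T. specialize (HN n m Hn Hm). lra. }
  destruct (Rcomplete.R_complete (fun n => Im (u n))) as [b Hb].
  { intros eps He. destruct (H (eps / 2)%R ltac:(lra)) as [N HN]. exists N. intros n m Hn Hm.
    unfold Rdist. pose proof (Cmod_im_le (u n - u m)) as T. rewrite im_sub in T. specialize (HN n m Hn Hm). lra. }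
  exists (a, b). intros eps He.
  destruct (Ha (eps / 2)%R ltac:(lra)) as [N1 H1]. destruct (Hb (eps / 2)%R ltac:(lra)) as [N2 H2].
  exists (max N1 N2). intros n Hn. specialize (H1 n ltac:(lia)). specialize (H2 n ltac:(lia)).
  unfold Rdist in *. eapply Rle_trans; [apply Cmod_le_sum|]. rewrite re_sub, im_sub.
  cbn [Re Im fst snd]. lra.
Qed.

Lemma clim_Cmod_le u l M : clim u l -> (exists N, forall n, (N <= n)%nat -> (Cmod (u n) <= M)%R) -> (Cmod l <= M)%R.
Proof.
  intros H [N0 HM]. apply Rle_eps. intros eps He. destruct (H eps He) as [N HN].
  specialize (HN (max N N0) ltac:(lia)). specialize (HM (max N N0) ltac:(lia)).
  pose proof (Cmod_le_sub l (u (max N N0))). rewrite Cmod_sub_sym in HN. lra.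
Qed.

Lemma clim_unique u l l' : clim u l -> clim u l' -> l = l'.
Proof.
  intros H H'. apply Ceq_minus, Cmod_eq_0, Rle_antisym; [|apply Cmod_ge_0].
  apply Rle_eps. intros eps He.
  destruct (H (eps / 2)%R ltac:(lra)) as [N HN]. destruct (H' (eps / 2)%R ltac:(lra)) as [N' HN'].
  specialize (HN (max N N') ltac:(lia)). specialize (HN' (max N N') ltac:(lia)).
  pose proof (Cmod_sub_split l (u (max N N')) l'). rewrite Cmod_sub_sym in HN. lra.
Qed.

Lemma clim_ext u v l : (forall n, u n = v n) -> clim u l -> clim v l.
Proof. intros E H eps He. destruct (H eps He) as [N HN]. exists N. intros n Hn. rewrite <- E; auto. Qed.

Lemma clim_const l : clim (fun _ => l) l.
Proof. exists 0%nat. intros n _. replace (l - l) with (RtoC 0) by ring. rewrite Cmod_0; lra. Qed.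

Lemma clim_plus u v l m : clim u l -> clim v m -> clim (fun n => u n + v n) (l + m).
Proof.
  intros H H' eps He.
  destruct (H (eps / 2)%R ltac:(lra)) as [N HN]. destruct (H' (eps / 2)%R ltac:(lra)) as [N' HN'].
  exists (max N N'). intros n Hn. specialize (HN n ltac:(lia)). specialize (HN' n ltac:(lia)).
  pose proof (Cmod_split (u n + v n - (l + m)) (u n - l) (v n - m) ltac:(ring)). lra.
Qed.

Lemma clim_scal a u l : clim u l -> clim (fun n => a * u n) (a * l).
Proof.
  intros H eps He. pose proof (Cmod_ge_0 a).
  destruct (H (eps / (Cmod a + 1))%R ltac:(apply Rdiv_lt_0_compat; lra)) as [N HN].
  exists N. intros n Hn. specialize (HN n Hn).
  replace (a * u n - a * l) with (a * (u n - l)) by ring. rewrite Cmod_mult.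
  apply Rle_trans with ((Cmod a + 1) * (eps / (Cmod a + 1)))%R.
  - apply Rmult_le_compat; try lra; apply Cmod_ge_0.
  - right; field; lra.
Qed.

Lemma clim_minus u v l m : clim u l -> clim v m -> clim (fun n => u n - v n) (l - m).
Proof.
  intros H H'. replace (l - m) with (l + - (1) * m) by ring.
  apply (clim_ext (fun n => u n + - (1) * v n)); [intros; ring|].
  apply clim_plus; [exact H|]. apply clim_scal, H'.
Qed.

(* Pointwise limits suffice: the first-order Taylor remainders are uniform, so that the
   derivatives inherit Cauchyness from the difference quotients. *)
Section Weierstrass.
Variables (theta : R) (Fn Fn' : nat -> C -> C) (F : C -> C).
Hypothesis HFn : forall n, holo theta (Fn n) (Fn' n).
Hypothesis Hbd : forall c, (theta < Re c)%R -> exists r B, (0 < r)%R /\ (theta < Re c - r)%R /\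
  forall n w, (Cmod (w - c) <= r)%R -> (Cmod (Fn n w) <= B)%R.
Hypothesis Hlim : forall s, (theta < Re s)%R -> clim (fun n => Fn n s) (F s).

Theorem weierstrass : exists F', holo theta F F' /\ forall s, (theta < Re s)%R -> clim (fun n => Fn' n s) (F' s).
Proof.
  assert (K : forall c, (theta < Re c)%R -> exists l, cderiv F c l /\ clim (fun n => Fn' n c) l).
  { intros c Hc. destruct (Hbd c Hc) as [r [B [Hr [Hcr HB]]]].
    assert (HB0 : (0 <= B)%R).
    { eapply Rle_trans; [apply Cmod_ge_0|]. apply (HB 0%nat c). replace (c - c) with (RtoC 0) by ring. rewrite Cmod_0; lra. }
    set (K := (2 * B / (r * r))%R).
    assert (HK : (0 <= K)%R) by (unfold K; apply Rdiv_le_0_compat; [lra|nra]).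
    assert (HT : forall n v, (Cmod v <= r / 2)%R -> (Cmod (Fn n (c + v) - Fn n c - Fn' n c * v) <= K * (Cmod v * Cmod v))%R).
    { intros n v Hv. apply (taylor_1 theta (Fn n) (Fn' n) (HFn n)); auto. intros w Hw; apply HB; lra. }
    assert (Hin : forall v, (Cmod v <= r / 2)%R -> (theta < Re (c + v))%R) by (intros v Hv; apply (Re_ball_gt theta c v (r / 2)); lra).
    destruct (clim_cauchy (fun n => Fn' n c)) as [l Hl].
    { intros eps He.
      (* At step [d] the two Taylor remainders cost [2 * K * d^2], at most [eps * d / 2], and the
         four values within [d * eps / 8] of their limits cost the other half. *)
      set (d := Rmin (r / 2) (eps / (4 * (K + 1)))).
      assert (Hd : (0 < d)%R) by (apply Rmin_pos; [lra|apply Rdiv_lt_0_compat; lra]).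
      assert (Hd1 : (d <= r / 2)%R) by apply Rmin_l.
      assert (Hd2 : (4 * K * d <= eps)%R).
      { apply Rle_trans with (4 * (K + 1) * d)%R; [nra|].
        apply Rle_trans with (4 * (K + 1) * (eps / (4 * (K + 1))))%R; [apply Rmult_le_compat_l; [lra|apply Rmin_r]|].
        right; field; lra. }
      assert (Cd : Cmod (RtoC d) = d) by (rewrite Cmod_R, Rabs_pos_eq; lra).
      destruct (Hlim (c + RtoC d) (Hin (RtoC d) ltac:(lra)) (d * eps / 8)%R ltac:(nra)) as [N1 HN1].
      destruct (Hlim c Hc (d * eps / 8)%R ltac:(nra)) as [N2 HN2].
      exists (max N1 N2). intros m n Hm Hn.
      apply (Rmult_le_reg_r d); [exact Hd|].
      rewrite <- Cd at 1. rewrite <- Cmod_mult.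
      pose proof (HT m (RtoC d) ltac:(lra)) as Tm. pose proof (HT n (RtoC d) ltac:(lra)) as Tn.
      rewrite Cd in Tm, Tn.
      pose proof (HN1 m ltac:(lia)) as A1. pose proof (HN1 n ltac:(lia)) as A2.
      pose proof (HN2 m ltac:(lia)) as A3. pose proof (HN2 n ltac:(lia)) as A4.
      pose proof (Cmod_split ((Fn' m c - Fn' n c) * RtoC d)
        ((Fn n (c + RtoC d) - Fn n c - Fn' n c * RtoC d) - (Fn m (c + RtoC d) - Fn m c - Fn' m c * RtoC d))
        (((Fn m (c + RtoC d) - F (c + RtoC d)) - (Fn n (c + RtoC d) - F (c + RtoC d)))
          - ((Fn m c - F c) - (Fn n c - F c))) ltac:(ring)) as T.
      pose proof (Cmod_triangle (Fn n (c + RtoC d) - Fn n c - Fn' n c * RtoC d) (- (Fn m (c + RtoC d) - Fn m c - Fn' m c * RtoC d))) as T1.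
      rewrite Cmod_opp in T1.
      pose proof (Cmod_triangle ((Fn m (c + RtoC d) - F (c + RtoC d)) - (Fn n (c + RtoC d) - F (c + RtoC d))) (- ((Fn m c - F c) - (Fn n c - F c)))) as T2.
      rewrite Cmod_opp in T2.
      pose proof (Cmod_triangle (Fn m (c + RtoC d) - F (c + RtoC d)) (- (Fn n (c + RtoC d) - F (c + RtoC d)))) as T3.
      rewrite Cmod_opp in T3.
      pose proof (Cmod_triangle (Fn m c - F c) (- (Fn n c - F c))) as T4.
      rewrite Cmod_opp in T4.
      unfold Cminus in *. nra. }
    exists l; split; [|exact Hl].
    assert (HTl : forall v, (Cmod v <= r / 2)%R -> (Cmod (F (c + v) - F c - l * v) <= K * (Cmod v * Cmod v))%R).
    { intros v Hv. apply (clim_Cmod_le (fun n => Fn n (c + v) - Fn n c - v * Fn' n c)).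
      - replace (l * v) with (v * l) by ring. apply clim_minus; [apply clim_minus|].
        + apply Hlim, Hin, Hv.
        + apply Hlim, Hc.
        + apply clim_scal, Hl.
      - exists 0%nat. intros n _. replace (v * Fn' n c) with (Fn' n c * v) by ring. apply HT, Hv. }
    intros eps He. exists (Rmin (r / 2) (eps / (K + 1))).
    split; [apply Rmin_pos; [lra|apply Rdiv_lt_0_compat; lra]|].
    intros w Hw.
    assert (H1 := Rlt_le_trans _ _ _ Hw (Rmin_l _ _)).
    assert (H2 := Rlt_le_trans _ _ _ Hw (Rmin_r _ _)).
    specialize (HTl (w - c) ltac:(lra)). replace (c + (w - c)) with w in HTl by ring.
    pose proof (Cmod_ge_0 (w - c)).
    apply lt_div_mult_l in H2; [|lra].
    eapply Rle_trans; [exact HTl|]. rewrite <- Rmult_assoc. apply Rmult_le_compat_r; lra. }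
  exists (C_derive F). split; intros s Hs; destruct (K s Hs) as [l [H1 H2]]; rewrite (cderiv_C_derive _ _ _ H1); assumption.
Qed.
End Weierstrass.

(** * Dirichlet series *)

(** Indexed by the number of terms rather than by the last index, so that inductions start from the
    empty sum. *)
Fixpoint csum (u : nat -> C) (n : nat) : C :=
  match n with O => 0 | S k => csum u k + u k end.

Lemma csum_sum_n u n : sum_n (G := C_NormedModule) u n = csum u (S n).
Proof.
  induction n as [|n IH].
  - rewrite sum_O. symmetry. apply Cplus_0_l.
  - rewrite sum_Sn, IH. reflexivity.
Qed.

Lemma csum_ext u v n : (forall k, (k < n)%nat -> u k = v k) -> csum u n = csum v n.
Proof.
  induction n as [|n IH]; intros H; simpl; [reflexivity|].
  rewrite IH, H; auto.
Qed.

Lemma csum_plus u v n : csum (fun k => u k + v k) n = csum u n + csum v n.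
Proof. induction n as [|n IH]; simpl; [ring|rewrite IH; ring]. Qed.

Lemma csum_minus u v n : csum (fun k => u k - v k) n = csum u n - csum v n.
Proof. induction n as [|n IH]; simpl; [ring|rewrite IH; ring]. Qed.

Lemma csum_scal a u n : csum (fun k => a * u k) n = a * csum u n.
Proof. induction n as [|n IH]; simpl; [ring|rewrite IH; ring]. Qed.

Lemma csum_scal_r a u n : csum (fun k => u k * a) n = csum u n * a.
Proof. induction n as [|n IH]; simpl; [ring|rewrite IH; ring]. Qed.

Lemma csum_zero (u : nat -> C) n : (forall k, (k < n)%nat -> u k = 0) -> csum u n = 0.
Proof. induction n as [|n IH]; intros H; simpl; [reflexivity|]. rewrite IH, H by auto. ring. Qed.

Lemma csum_swap (u : nat -> nat -> C) m n :
  csum (fun i => csum (fun j => u i j) n) m = csum (fun j => csum (fun i => u i j) m) n.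
Proof.
  induction m as [|m IH]; simpl.
  - symmetry; apply csum_zero; reflexivity.
  - rewrite IH, csum_plus. reflexivity.
Qed.

Lemma csum_extend (u : nat -> C) m n : (m <= n)%nat -> (forall k, (m <= k < n)%nat -> u k = 0) -> csum u n = csum u m.
Proof.
  intros Hmn H. induction n as [|n IH].
  - replace m with 0%nat by lia. reflexivity.
  - destruct (Nat.eq_dec m (S n)) as [->|N]; [reflexivity|].
    simpl. rewrite H by lia. rewrite IH by (try lia; intros; apply H; lia). ring.
Qed.

Lemma csum_single (p : nat) (c : C) n :
  csum (fun k => if Nat.eqb p (S k) then c else 0) n = if andb (Nat.leb 1 p) (Nat.leb p n) then c else 0.
Proof.
  induction n as [|n IH]; simpl csum.
  - destruct p; simpl; reflexivity.
  - rewrite IH. destruct (Nat.eqb_spec p (S n)) as [->|N].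
    + rewrite Nat.leb_refl. replace (Nat.leb (S n) n) with false by (symmetry; apply Nat.leb_gt; lia). simpl. ring.
    + replace (Nat.leb p (S n)) with (Nat.leb p n); [ring|].
      destruct (Nat.leb_spec p n), (Nat.leb_spec p (S n)); auto; lia.
Qed.

Lemma clim_shift u l : clim (fun n => u (S n)) l <-> clim u l.
Proof.
  split; intros H eps He; destruct (H eps He) as [N HN].
  - exists (S N). intros n Hn. destruct n as [|n]; [lia|]. apply HN; lia.
  - exists N. intros n Hn. apply HN; lia.
Qed.

Lemma is_series_clim u l : is_series (K := C_AbsRing) (V := C_NormedModule) u l <-> clim (csum u) l.
Proof.
  rewrite <- clim_shift. split.
  - intros H eps He.
    assert (L : locally (T := C_UniformSpace) l (fun z => (Cmod (z - l) <= eps)%R)).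
    { apply locally_C. exists (mkposreal eps He). intros z Hz. left. exact Hz. }
    destruct (H _ L) as [N HN]. exists N. intros n Hn. rewrite <- csum_sum_n. apply HN, Hn.
  - intros H P HP. apply locally_C in HP. destruct HP as [e HP].
    destruct (H (e / 2)%R) as [N HN]; [pose proof (cond_pos e); lra|].
    exists N. intros n Hn. apply HP.
    change (Cmod (sum_n (G := C_NormedModule) u n - l) < e)%R. rewrite csum_sum_n.
    specialize (HN n Hn). pose proof (cond_pos e). lra.
Qed.

Lemma clim_is_lim_seq_Re u l : clim u l -> is_lim_seq (fun n => Re (u n)) (Re l).
Proof.
  intros H. apply is_lim_seq_spec. intros eps. destruct (H (eps / 2)%R) as [N HN]; [pose proof (cond_pos eps); lra|].
  exists N. intros n Hn. specialize (HN n Hn). pose proof (re_le_Cmod (u n - l)) as T. rewrite re_sub in T.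
  pose proof (cond_pos eps). lra.
Qed.

Lemma clim_is_lim_seq_Im u l : clim u l -> is_lim_seq (fun n => Im (u n)) (Im l).
Proof.
  intros H. apply is_lim_seq_spec. intros eps. destruct (H (eps / 2)%R) as [N HN]; [pose proof (cond_pos eps); lra|].
  exists N. intros n Hn. specialize (HN n Hn). pose proof (Cmod_im_le (u n - l)) as T. rewrite im_sub in T.
  pose proof (cond_pos eps). lra.
Qed.

Lemma csum_Re_Im u n : Re (csum u (S n)) = sum_n (fun k => Re (u k)) n /\ Im (csum u (S n)) = sum_n (fun k => Im (u k)) n.
Proof.
  induction n as [|n [IH1 IH2]].
  - rewrite !sum_O. simpl csum. rewrite Cplus_0_l. split; reflexivity.
  - rewrite !sum_Sn, <- IH1, <- IH2. split; reflexivity.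
Qed.

Lemma dirichlet_sum_clim a s l : clim (csum (dirichlet_term a s)) l -> dirichlet_sum a s = l.
Proof.
  intros H. unfold dirichlet_sum. apply clim_shift in H.
  rewrite (is_series_unique (fun n => Re (dirichlet_term a s n)) (Re l)),
    (is_series_unique (fun n => Im (dirichlet_term a s n)) (Im l)).
  - symmetry; apply surjective_pairing.
  - apply (is_lim_seq_ext (fun n => Im (csum (dirichlet_term a s) (S n))) _ (Finite (Im l))).
    + apply csum_Re_Im.
    + apply clim_is_lim_seq_Im, H.
  - apply (is_lim_seq_ext (fun n => Re (csum (dirichlet_term a s) (S n))) _ (Finite (Re l))).
    + apply csum_Re_Im.
    + apply clim_is_lim_seq_Re, H.
Qed.

Lemma clim_bounded u l : clim u l -> exists B, forall n, (Cmod (u n) <= B)%R.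
Proof.
  intros H. destruct (H 1%R Rlt_0_1) as [N HN].
  assert (K : forall N, exists B, forall n, (n < N)%nat -> (Cmod (u n) <= B)%R).
  { clear. induction N as [|N [B IH]].
    - exists 0%R. intros; lia.
    - exists (Rmax B (Cmod (u N))). intros n Hn. destruct (Nat.eq_dec n N) as [->|].
      + apply Rmax_r.
      + eapply Rle_trans; [apply IH; lia|apply Rmax_l]. }
  destruct (K N) as [B HB]. exists (Rmax B (Cmod l + 1)). intros n.
  destruct (Nat.lt_ge_cases n N).
  - eapply Rle_trans; [apply HB; lia|apply Rmax_l].
  - eapply Rle_trans; [|apply Rmax_r]. pose proof (Cmod_le_sub (u n) l). specialize (HN n H0). lra.
Qed.

Lemma clim_mult u v l m : clim u l -> clim v m -> clim (fun n => u n * v n) (l * m).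
Proof.
  intros Hu Hv. destruct (clim_bounded v m Hv) as [B HB].
  assert (HB0 : (0 <= B)%R) by (eapply Rle_trans; [apply Cmod_ge_0|apply (HB 0%nat)]).
  intros eps He. pose proof (Cmod_ge_0 l).
  destruct (Hu (eps / 2 / (B + 1))%R ltac:(apply Rdiv_lt_0_compat; lra)) as [N1 H1].
  destruct (Hv (eps / 2 / (Cmod l + 1))%R ltac:(apply Rdiv_lt_0_compat; lra)) as [N2 H2].
  exists (max N1 N2). intros n Hn. specialize (H1 n ltac:(lia)). specialize (H2 n ltac:(lia)). specialize (HB n).
  pose proof (Cmod_split (u n * v n - l * m) ((u n - l) * v n) (l * (v n - m)) ltac:(ring)) as T.
  assert (T1 : (Cmod ((u n - l) * v n) <= eps / 2 / (B + 1) * (B + 1))%R) by (apply Cmod_mult_le; lra).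
  assert (T2 : (Cmod (l * (v n - m)) <= (Cmod l + 1) * (eps / 2 / (Cmod l + 1)))%R) by (apply Cmod_mult_le; lra).
  replace (eps / 2 / (B + 1) * (B + 1))%R with (eps / 2)%R in T1 by (field; lra).
  replace ((Cmod l + 1) * (eps / 2 / (Cmod l + 1)))%R with (eps / 2)%R in T2 by (field; lra).
  lra.
Qed.

(* Comparison with the telescoping series of [1/n - 1/(n+1)]. *)
Lemma csum_tail u K M N : (0 <= K)%R -> (forall n, (1 <= n)%nat -> (Cmod (u n) <= K * / (INR (S n)) ^ 2)%R) ->
  (1 <= M <= N)%nat -> (Cmod (csum u N - csum u M) <= K * (/ INR M - / INR N))%R.
Proof.
  intros HK Hu HM. induction N as [|N IH]; [lia|].
  destruct (Nat.eq_dec M (S N)) as [->|Hne].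
  - replace (csum u (S N) - csum u (S N)) with (RtoC 0) by ring. rewrite Cmod_0. lra.
  - specialize (IH ltac:(lia)). simpl csum.
    pose proof (Cmod_split (csum u N + u N - csum u M) (csum u N - csum u M) (u N) ltac:(ring)) as T.
    specialize (Hu N ltac:(lia)).
    assert (HN : (1 <= INR N)%R) by (apply (le_INR 1); lia).
    rewrite S_INR in *.
    assert (/ (INR N + 1) ^ 2 <= / INR N - / (INR N + 1))%R.
    { replace (/ INR N - / (INR N + 1))%R with (/ (INR N * (INR N + 1)))%R by (field; lra).
      apply Rinv_le_contravar; nra. }
    nra.
Qed.

Lemma csum_conv u K : (0 <= K)%R -> (forall n, (1 <= n)%nat -> (Cmod (u n) <= K * / (INR (S n)) ^ 2)%R) ->
  exists l, clim (csum u) l /\ forall M, (1 <= M)%nat -> (Cmod (l - csum u M) <= K / INR M)%R.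
Proof.
  intros HK Hu.
  assert (T : forall M N, (1 <= M <= N)%nat -> (Cmod (csum u N - csum u M) <= K / INR M)%R).
  { intros M N HM. eapply Rle_trans; [apply (csum_tail u K); auto|].
    assert (0 < / INR N)%R by (apply Rinv_0_lt_compat, lt_0_INR; lia). nra. }
  destruct (clim_cauchy (csum u)) as [l Hl].
  { intros eps He. destruct (inv_INR_small K (eps / 2) HK ltac:(lra)) as [N [HN1 HN]].
    specialize (HN N (le_n _)).
    exists N. intros m n Hm Hn.
    pose proof (T N m ltac:(lia)) as T1. pose proof (T N n ltac:(lia)) as T2. rewrite Cmod_sub_sym in T2.
    pose proof (Cmod_sub_split (csum u m) (csum u N) (csum u n)). lra. }
  exists l; split; [exact Hl|]. intros M HM.
  apply (clim_Cmod_le (fun n => csum u n - csum u M)).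
  - apply clim_minus; [exact Hl|apply clim_const].
  - exists M. intros n Hn. apply T; lia.
Qed.

Lemma csum_bound2 u K N : (0 <= K)%R -> (forall n, (Cmod (u n) <= K * / (INR (S n)) ^ 2)%R) -> (Cmod (csum u N) <= 2 * K)%R.
Proof.
  intros HK Hu. destruct N as [|N]; [simpl; rewrite Cmod_0; lra|].
  pose proof (csum_tail u K 1 (S N) HK (fun n _ => Hu n) ltac:(lia)) as T.
  assert (0 < / INR (S N))%R by (apply Rinv_0_lt_compat, lt_0_INR; lia).
  pose proof (Cmod_le_sub (csum u (S N)) (csum u 1)) as T2.
  assert (E : csum u 1 = u 0%nat) by (simpl; ring). rewrite E in *.
  specialize (Hu 0%nat). simpl INR in *. nra.
Qed.

(** * Dirichlet series with polynomially bounded coefficients *)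

Definition lnS (n : nat) : R := ln (INR (S n)).

Lemma lnS_0 : lnS 0 = 0%R.
Proof. apply ln_1. Qed.

Lemma INR_S_pos n : (0 < INR (S n))%R.
Proof. apply lt_0_INR; lia. Qed.

Lemma exp_lnS n : exp (lnS n) = INR (S n).
Proof. apply exp_ln, INR_S_pos. Qed.

Lemma lnS_ge n : (1 <= n)%nat -> (ln 2 <= lnS n)%R.
Proof.
  intros Hn. apply ln_le; [lra|]. change 2%R with (INR 2). apply le_INR; lia.
Qed.

Lemma ln2_pos : (0 < ln 2)%R.
Proof. rewrite <- ln_1. apply ln_increasing; lra. Qed.

Lemma lnS_pos n : (0 <= lnS n)%R.
Proof.
  destruct n; [rewrite lnS_0; lra|]. pose proof (lnS_ge (S n) ltac:(lia)). pose proof ln2_pos. lra.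
Qed.

Lemma exp_le_compat x y : (x <= y)%R -> (exp x <= exp y)%R.
Proof. intros [H| ->]; [left; apply exp_increasing, H|lra]. Qed.

Lemma exp_m2_lnS n : exp (-2 * lnS n) = (/ (INR (S n)) ^ 2)%R.
Proof.
  replace (-2 * lnS n)%R with (- (lnS n + lnS n))%R by ring.
  rewrite exp_Ropp, exp_plus, exp_lnS. f_equal; ring.
Qed.

Definition dexp (n : nat) (s : C) : C := Cexp (- s * RtoC (lnS n)).

Lemma dirichlet_term_dexp a s n : dirichlet_term a s n = a n * dexp n s.
Proof. reflexivity. Qed.

Lemma Cmod_dexp n s : Cmod (dexp n s) = exp (- Re s * lnS n).
Proof. unfold dexp. rewrite Cmod_Cexp, re_scal_r, re_opp. reflexivity. Qed.

Lemma dexp_0 s : dexp 0 s = 1.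
Proof. unfold dexp. rewrite lnS_0, Cmult_0_r. apply Cexp_0. Qed.

Lemma dirichlet_term_0 a s : dirichlet_term a s 0 = a 0%nat.
Proof. rewrite dirichlet_term_dexp, dexp_0. ring. Qed.

(** Index [0] is excluded because the later coefficient estimate carries the factor [lnS n], which
    vanishes there; the constant coefficient is treated apart. *)
Definition poly_bounded (a : nat -> C) (K k : R) : Prop :=
  forall n, (1 <= n)%nat -> (Cmod (a n) <= K * exp (k * lnS n))%R.

Lemma poly_bounded_nonneg a K k : poly_bounded a K k -> (0 <= K)%R.
Proof.
  intros H. specialize (H 1%nat (le_n _)). pose proof (Cmod_ge_0 (a 1%nat)).
  pose proof (exp_pos (k * lnS 1)). nra.
Qed.

Lemma poly_bounded_weaken a K K' k k' : (K <= K')%R -> (k <= k')%R -> poly_bounded a K k -> poly_bounded a K' k'.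
Proof.
  intros HK Hk H n Hn. pose proof (poly_bounded_nonneg a K k H). eapply Rle_trans; [apply H, Hn|].
  apply Rmult_le_compat; try lra; [left; apply exp_pos|].
  apply exp_le_compat. pose proof (lnS_pos n). nra.
Qed.

(** Two powers of [n + 1] are spent on summability; what remains of the exponent is bounded at base
    [2], which gives the exponential decay of the series minus its constant term as [Re s] grows. *)
Lemma dirichlet_term_bound a K k s n : poly_bounded a K k -> (k + 2 <= Re s)%R -> (1 <= n)%nat ->
  (Cmod (dirichlet_term a s n) <= K * exp (- (Re s - k - 2) * ln 2) * / (INR (S n)) ^ 2)%R.
Proof.
  intros H Hs Hn. rewrite dirichlet_term_dexp, Cmod_mult, Cmod_dexp, <- exp_m2_lnS.
  pose proof (poly_bounded_nonneg a K k H).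
  apply Rle_trans with (K * exp (k * lnS n) * exp (- Re s * lnS n))%R.
  { apply Rmult_le_compat_r; [left; apply exp_pos|apply H, Hn]. }
  rewrite !Rmult_assoc, <- !exp_plus. apply Rmult_le_compat_l; [lra|]. apply exp_le_compat.
  pose proof (lnS_ge n Hn). nra.
Qed.

Section DirichletSum.
Variables (a : nat -> C) (K k : R).
Hypothesis Ha : poly_bounded a K k.

Lemma dirichlet_sum_facts s : (k + 2 <= Re s)%R ->
  clim (csum (dirichlet_term a s)) (dirichlet_sum a s) /\
  (Cmod (dirichlet_sum a s - a 0%nat) <= K * exp (- (Re s - k - 2) * ln 2))%R /\
  (forall M, (1 <= M)%nat -> (Cmod (dirichlet_sum a s - csum (dirichlet_term a s) M) <= K / INR M)%R).
Proof.
  intros Hs. pose proof (poly_bounded_nonneg a K k Ha) as HK.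
  pose proof (exp_pos (- (Re s - k - 2) * ln 2)) as He.
  assert (He1 : (exp (- (Re s - k - 2) * ln 2) <= 1)%R).
  { rewrite <- exp_0. apply exp_le_compat. pose proof ln2_pos. nra. }
  destruct (csum_conv (dirichlet_term a s) (K * exp (- (Re s - k - 2) * ln 2))) as [l [Hl Hl2]].
  { nra. }
  { intros n Hn. apply dirichlet_term_bound; auto. }
  rewrite (dirichlet_sum_clim a s l Hl). repeat split; auto.
  - specialize (Hl2 1%nat (le_n _)). simpl in Hl2. rewrite dirichlet_term_0, Cplus_0_l in Hl2.
    unfold Rdiv in Hl2. rewrite Rinv_1, Rmult_1_r in Hl2. exact Hl2.
  - intros M HM. eapply Rle_trans; [apply Hl2, HM|].
    apply Rmult_le_compat_r; [left; apply Rinv_0_lt_compat, lt_0_INR; lia|]. nra.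
Qed.

Lemma dirichlet_sum_is_series s : (k + 2 <= Re s)%R ->
  is_series (K := C_AbsRing) (V := C_NormedModule) (dirichlet_term a s) (dirichlet_sum a s).
Proof. intros Hs. apply is_series_clim, dirichlet_sum_facts, Hs. Qed.

Lemma dirichlet_partial_bound s N : (k + 2 <= Re s)%R -> (Cmod (csum (dirichlet_term a s) N) <= Cmod (a 0%nat) + 2 * K)%R.
Proof.
  intros Hs. pose proof (poly_bounded_nonneg a K k Ha) as HK.
  destruct N as [|N]; [simpl; rewrite Cmod_0; pose proof (Cmod_ge_0 (a 0%nat)); lra|].
  assert (H1 : (Cmod (csum (dirichlet_term a s) (S N) - csum (dirichlet_term a s) 1) <= K * (/ INR 1 - / INR (S N)))%R).
  { apply csum_tail; [exact HK| |lia]. intros n Hn. eapply Rle_trans; [apply (dirichlet_term_bound a K k); auto|].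
    rewrite Rmult_assoc. apply Rmult_le_compat_l; [exact HK|].
    rewrite <- (Rmult_1_l (/ INR (S n) ^ 2)) at 2. apply Rmult_le_compat_r.
    - left; apply Rinv_0_lt_compat, pow_lt, INR_S_pos.
    - rewrite <- exp_0. apply exp_le_compat. pose proof ln2_pos. nra. }
  assert (0 < / INR (S N))%R by (apply Rinv_0_lt_compat, INR_S_pos).
  pose proof (Cmod_le_sub (csum (dirichlet_term a s) (S N)) (csum (dirichlet_term a s) 1)) as T.
  assert (E : csum (dirichlet_term a s) 1 = a 0%nat) by (simpl; rewrite dirichlet_term_0; ring).
  rewrite E in *. simpl (INR 1) in H1. nra.
Qed.

Lemma cderiv_dexp n s : cderiv (dexp n) s (- RtoC (lnS n) * dexp n s).
Proof.
  apply (cderiv_ext (fun s => Cexp (- RtoC (lnS n) * s + 0))).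
  { intros w. unfold dexp. f_equal. ring. }
  eapply cderiv_eq; [apply cderiv_Cexp_lin|]. unfold dexp. f_equal. f_equal. ring.
Qed.

Definition dirichlet_deriv (n : nat) : C := - RtoC (lnS n) * a n.

(** The partial sums are bounded uniformly on [Re s >= k + 2], so Weierstrass' theorem applies and
    also gives the convergence of the differentiated series. *)
Lemma dirichlet_sum_holo : holo (k + 2) (dirichlet_sum a) (dirichlet_sum dirichlet_deriv).
Proof.
  destruct (weierstrass (k + 2) (fun N s => csum (dirichlet_term a s) N)
    (fun N s => csum (dirichlet_term dirichlet_deriv s) N) (dirichlet_sum a)) as [F' [H1 H2]].
  - intros N s Hs. induction N as [|N IH]; simpl; [apply cderiv_const|].
    apply cderiv_plus; [exact IH|]. eapply cderiv_eq; [apply cderiv_scal, cderiv_dexp|].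
    rewrite dirichlet_term_dexp. unfold dirichlet_deriv. ring.
  - intros c Hc. exists ((Re c - (k + 2)) / 2)%R, (Cmod (a 0%nat) + 2 * K)%R. split; [lra|]. split; [lra|].
    intros N w Hw. apply dirichlet_partial_bound.
    replace w with (c + (w - c)) by ring. left.
    apply (Re_ball_gt _ _ _ _ Hw). lra.
  - intros s Hs. apply dirichlet_sum_facts. lra.
  - intros s Hs. rewrite (dirichlet_sum_clim _ _ _ (H2 s Hs)). apply H1, Hs.
Qed.

End DirichletSum.

(** A term at the real point [theta + 1] is a difference of two partial sums, which are bounded;
    solving for [a n] gives the exponent [theta + 1]. *)
Lemma in_D_poly_bounded a : in_D a -> exists K k, poly_bounded a K k.
Proof.
  intros [theta H].
  destruct (H (RtoC (theta + 1))) as [l Hl]; [unfold half_plane; rewrite re_RtoC; lra|].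
  apply is_series_clim in Hl. destruct (clim_bounded _ _ Hl) as [B HB].
  exists (2 * B)%R, (theta + 1)%R. intros n _.
  assert (T : (Cmod (dirichlet_term a (RtoC (theta + 1)) n) <= 2 * B)%R).
  { pose proof (HB n) as H1. pose proof (HB (S n)) as H2. simpl in H2.
    pose proof (Cmod_split (dirichlet_term a (RtoC (theta + 1)) n) (csum (dirichlet_term a (RtoC (theta + 1))) n + dirichlet_term a (RtoC (theta + 1)) n) (- csum (dirichlet_term a (RtoC (theta + 1))) n) ltac:(ring)) as T.
    rewrite Cmod_opp in T. lra. }
  rewrite dirichlet_term_dexp, Cmod_mult, Cmod_dexp, re_RtoC in T.
  replace (Cmod (a n)) with (Cmod (a n) * exp (- (theta + 1) * lnS n) * exp ((theta + 1) * lnS n))%R.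
  - apply Rmult_le_compat_r; [left; apply exp_pos|exact T].
  - rewrite Rmult_assoc, <- exp_plus. replace (- (theta + 1) * lnS n + (theta + 1) * lnS n)%R with 0%R by ring.
    rewrite exp_0; ring.
Qed.

Lemma represents_in_D a f : represents a f -> in_D a.
Proof. intros [theta H]. exists theta. intros s Hs. exists (f s). apply H, Hs. Qed.

Lemma represents_sum a f : represents a f -> exists theta, forall s, (theta < Re s)%R -> f s = dirichlet_sum a s.
Proof.
  intros [theta H]. exists theta. intros s Hs. symmetry. apply dirichlet_sum_clim, is_series_clim, H, Hs.
Qed.

Lemma poly_bounded_represents a K k f theta : poly_bounded a K k ->
  (forall s, (theta < Re s)%R -> f s = dirichlet_sum a s) -> represents a f.
Proof.
  intros Ha H. exists (Rmax theta (k + 2)). intros s Hs. unfold half_plane in Hs.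
  max_bounds.
  rewrite H by lra. apply (dirichlet_sum_is_series a K k Ha). lra.
Qed.

(* Index [n] stands for the integer [n + 1]. *)
Definition dconv (a b : nat -> C) (n : nat) : C :=
  csum (fun d => csum (fun e => if Nat.eqb (S d * S e) (S n) then a d * b e else 0) (S n)) (S n).

Lemma csum_norm_le u N c : (forall k, (k < N)%nat -> (Cmod (u k) <= c)%R) -> (Cmod (csum u N) <= INR N * c)%R.
Proof.
  induction N as [|N IH]; intros H.
  - simpl. rewrite Cmod_0; lra.
  - simpl csum. rewrite S_INR. pose proof (Cmod_triangle (csum u N) (u N)).
    specialize (IH ltac:(intros; apply H; lia)). specialize (H N ltac:(lia)). lra.
Qed.

Lemma lnS_mult d e n : (S d * S e)%nat = S n -> (lnS d + lnS e)%R = lnS n.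
Proof.
  intros H. unfold lnS. rewrite <- ln_mult by apply INR_S_pos. rewrite <- mult_INR, H. reflexivity.
Qed.

Section Product.
Variables (a b : nat -> C) (K k : R).
Hypothesis Ha : forall n, (Cmod (a n) <= K * exp (k * lnS n))%R.
Hypothesis Hb : forall n, (Cmod (b n) <= K * exp (k * lnS n))%R.

Lemma dconv_bound_nonneg : (0 <= K)%R.
Proof. apply (poly_bounded_nonneg a K k). intros n _; apply Ha. Qed.

(** At most [(n + 1)^2] pairs [(d, e)] are summed, and each product is at most [K^2 (n + 1)^k],
    because [lnS] is additive on factorizations. *)
Lemma dconv_poly_bounded : poly_bounded (dconv a b) (K * K) (k + 2).
Proof.
  intros n _.
  eapply Rle_trans.
  - apply csum_norm_le with (c := (INR (S n) * (K * K * exp (k * lnS n)))%R). intros d Hd.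
    apply csum_norm_le. intros e He'. destruct (Nat.eqb_spec (S d * S e) (S n)) as [E|_].
    + apply Rle_trans with (K * exp (k * lnS d) * (K * exp (k * lnS e)))%R; [apply Cmod_mult_le; auto|].
      rewrite <- (lnS_mult d e n E), Rmult_plus_distr_l, exp_plus. right; ring.
    + rewrite Cmod_0. pose proof (exp_pos (k * lnS n)). nra.
  - replace ((k + 2) * lnS n)%R with (k * lnS n + lnS n + lnS n)%R by ring.
    rewrite !exp_plus, exp_lnS. right; ring.
Qed.

Variable s : C.
Hypothesis Hs : (k + 3 <= Re s)%R.
Let A := dirichlet_term a s.
Let B := dirichlet_term b s.

Lemma term_bound3 (x : nat -> C) n : (forall n, (Cmod (x n) <= K * exp (k * lnS n))%R) ->
  (Cmod (dirichlet_term x s n) <= K * exp (-3 * lnS n))%R.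
Proof.
  intros Hx. rewrite dirichlet_term_dexp, Cmod_mult, Cmod_dexp.
  apply Rle_trans with (K * exp (k * lnS n) * exp (- Re s * lnS n))%R.
  { apply Rmult_le_compat_r; [left; apply exp_pos|apply Hx]. }
  rewrite Rmult_assoc, <- exp_plus. apply Rmult_le_compat_l; [apply dconv_bound_nonneg|].
  apply exp_le_compat. pose proof (lnS_pos n). nra.
Qed.

(** The inner ranges are first extended from [S n] to [N], which adds only zeros because both
    factors of [S n] are at most [S n]; exchanging the sums then leaves one indicator per pair. *)
Lemma dconv_partial N : csum (dirichlet_term (dconv a b) s) N =
  csum (fun d => csum (fun e => if Nat.leb (S d * S e) N then A d * B e else 0) N) N.
Proof.
  rewrite (csum_ext _ (fun n => csum (fun d => csum (fun e => if Nat.eqb (S d * S e) (S n) then A d * B e else 0) N) N)).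
  - rewrite csum_swap. apply csum_ext. intros d Hd. rewrite csum_swap. apply csum_ext. intros e He'.
    rewrite csum_single. replace (Nat.leb 1 (S d * S e)) with true; [reflexivity|].
    symmetry; apply Nat.leb_le; lia.
  - intros n Hn. rewrite dirichlet_term_dexp. unfold dconv. rewrite <- csum_scal_r.
    rewrite (csum_extend (fun d => csum (fun e => if Nat.eqb (S d * S e) (S n) then A d * B e else 0) N) (S n) N).
    + apply csum_ext. intros d Hd. rewrite <- csum_scal_r.
      rewrite (csum_extend (fun e => if Nat.eqb (S d * S e) (S n) then A d * B e else 0) (S n) N).
      * apply csum_ext. intros e He'. destruct (Nat.eqb_spec (S d * S e) (S n)) as [E|_]; [|ring].
        unfold A, B. rewrite !dirichlet_term_dexp. unfold dexp. rewrite <- (lnS_mult d e n E), RtoC_plus.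
        replace (- s * (RtoC (lnS d) + RtoC (lnS e))) with (- s * RtoC (lnS d) + - s * RtoC (lnS e)) by ring.
        rewrite Cexp_plus. ring.
      * lia.
      * intros e He'. destruct (Nat.eqb_spec (S d * S e) (S n)) as [E|_]; [nia|reflexivity].
    + lia.
    + intros d Hd. apply csum_zero. intros e He'. destruct (Nat.eqb_spec (S d * S e) (S n)) as [E|_]; [nia|reflexivity].
Qed.

(* The square [d, e <= N] minus the hyperbolic region [d e <= N] contributes [O(1/N)]:
   there [(d e)^-3 <= (d e)^-2 / N]. *)
Lemma dconv_partial_close N : (1 <= N)%nat ->
  (Cmod (csum A N * csum B N - csum (dirichlet_term (dconv a b) s) N) <= 4 * (K * K) / INR N)%R.
Proof.
  intros HN. assert (HNp : (0 < INR N)%R) by (apply lt_0_INR; lia).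
  assert (HiN : (0 < / INR N)%R) by (apply Rinv_0_lt_compat, HNp).
  assert (HKK : (0 <= K * K)%R) by (pose proof dconv_bound_nonneg; nra).
  rewrite dconv_partial.
  replace (csum A N * csum B N - csum (fun d => csum (fun e => if Nat.leb (S d * S e) N then A d * B e else 0) N) N)
    with (csum (fun d => csum (fun e => if Nat.leb (S d * S e) N then 0 else A d * B e) N) N).
  2:{ rewrite <- (csum_scal_r (csum B N) A N).
      rewrite <- (csum_minus (fun k => A k * csum B N) (fun d => csum (fun e => if Nat.leb (S d * S e) N then A d * B e else 0) N)).
      apply csum_ext. intros d _. rewrite <- (csum_scal (A d) B N).
      rewrite <- (csum_minus (fun e => A d * B e) (fun e => if Nat.leb (S d * S e) N then A d * B e else 0)).
      apply csum_ext. intros e _. destruct Nat.leb; ring. }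
  replace (4 * (K * K) / INR N)%R with (2 * (2 * (K * K * / INR N)))%R by (unfold Rdiv; ring).
  apply csum_bound2; [nra|]. intros d.
  replace (2 * (K * K * / INR N) * / INR (S d) ^ 2)%R with (2 * (K * K * / INR N * / INR (S d) ^ 2))%R by ring.
  assert (Hd2 : (0 < / INR (S d) ^ 2)%R) by (apply Rinv_0_lt_compat, pow_lt, INR_S_pos).
  apply csum_bound2; [apply Rmult_le_pos; [nra|lra]|]. intros e.
  assert (He2 : (0 < / INR (S e) ^ 2)%R) by (apply Rinv_0_lt_compat, pow_lt, INR_S_pos).
  destruct (Nat.leb_spec (S d * S e) N) as [_|Hlt].
  - rewrite Cmod_0. repeat apply Rmult_le_pos; try lra; apply dconv_bound_nonneg.
  - apply Rle_trans with (K * exp (-3 * lnS d) * (K * exp (-3 * lnS e)))%R.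
    { apply Cmod_mult_le; apply term_bound3; auto. }
    assert (E3 : forall n, exp (-3 * lnS n) = (/ INR (S n) * / INR (S n) ^ 2)%R).
    { intros n. replace (-3 * lnS n)%R with (- lnS n + -2 * lnS n)%R by ring.
      rewrite exp_plus, exp_m2_lnS, exp_Ropp, exp_lnS. reflexivity. }
    rewrite !E3.
    replace (K * (/ INR (S d) * / INR (S d) ^ 2) * (K * (/ INR (S e) * / INR (S e) ^ 2)))%R
      with (K * K * / (INR (S d) * INR (S e)) * / INR (S d) ^ 2 * / INR (S e) ^ 2)%R.
    2:{ pose proof (INR_S_pos d); pose proof (INR_S_pos e). field. split; lra. }
    apply Rmult_le_compat_r; [lra|]. apply Rmult_le_compat_r; [lra|]. apply Rmult_le_compat_l; [lra|].
    apply Rinv_le_contravar; [exact HNp|]. rewrite <- mult_INR. apply le_INR; lia.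
Qed.

Lemma dirichlet_product : dirichlet_sum (dconv a b) s = dirichlet_sum a s * dirichlet_sum b s.
Proof.
  apply dirichlet_sum_clim.
  destruct (dirichlet_sum_facts a K k (fun n _ => Ha n) s ltac:(lra)) as [Ca _].
  destruct (dirichlet_sum_facts b K k (fun n _ => Hb n) s ltac:(lra)) as [Cb _].
  pose proof (clim_mult _ _ _ _ Ca Cb) as Cab.
  apply (clim_ext (fun N => csum A N * csum B N - (csum A N * csum B N - csum (dirichlet_term (dconv a b) s) N))); [intros; ring|].
  replace (dirichlet_sum a s * dirichlet_sum b s) with (dirichlet_sum a s * dirichlet_sum b s - 0) by ring.
  apply clim_minus; [exact Cab|].
  intros eps He. assert (HKK : (0 <= 4 * (K * K))%R) by (pose proof dconv_bound_nonneg; nra).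
  destruct (inv_INR_small _ eps HKK He) as [N [HN1 HN]].
  exists N. intros n Hn. replace (csum A n * csum B n - csum (dirichlet_term (dconv a b) s) n - 0)
    with (csum A n * csum B n - csum (dirichlet_term (dconv a b) s) n) by ring.
  eapply Rle_trans; [apply dconv_partial_close; lia|apply HN, Hn].
Qed.

End Product.

Lemma C_pair (s : C) : s = (Re s, Im s).
Proof. apply surjective_pairing. Qed.

Lemma holo_mult theta F F' G G' : holo theta F F' -> holo theta G G' ->
  holo theta (fun s => F s * G s) (fun s => F' s * G s + F s * G' s).
Proof. intros HF HG s Hs. apply cderiv_mult; auto. Qed.

Lemma holo_mono theta theta' F F' : (theta <= theta')%R -> holo theta F F' -> holo theta' F F'.
Proof. intros H HF s Hs. apply HF. lra. Qed.

Lemma segment_mvt theta F F' z w M : holo theta F F' -> (theta < Re z)%R -> (theta < Re w)%R ->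
  (forall t, (0 <= t <= 1)%R -> (Cmod (F' (z + (w - z) * RtoC t)%C) <= M)%R) ->
  (Cmod (F w - F z) <= M * Cmod (w - z))%R.
Proof.
  intros HF Hz Hw HM.
  assert (Hin : forall t, (0 <= t <= 1)%R -> (theta < Re (z + (w - z) * RtoC t))%R).
  { intros t Ht. rewrite re_plus, re_scal_r, re_sub. destruct (Rle_or_lt (Re z) (Re w)); nra. }
  destruct (holo_deriv theta F F' HF) as [F'' HF'].
  assert (L : forall t, rdiff (fun t => z + (w - z) * RtoC t) t) by (intros t; eexists; apply rderiv_line).
  pose proof (path_mvt (fun t => F (z + (w - z) * RtoC t)) (fun t => F' (z + (w - z) * RtoC t) * (w - z)) 0 1 (M * Cmod (w - z))) as K.
  cbv beta in K. replace (z + (w - z) * 1) with w in K by ring. replace (z + (w - z) * 0) with z in K by ring.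
  rewrite Rminus_0_r, Rmult_1_r in K. apply K.
  - lra.
  - intros t Ht. apply (cderiv_rderiv_comp F); [apply rderiv_line|apply HF, Hin, Ht].
  - intros t Ht. apply rdiff_mult; [|apply rdiff_const]. apply (rdiff_comp F' _ _ _ (HF' _ (Hin t Ht)) (L t)).
  - intros t Ht. apply Cmod_mult_le; [apply HM, Ht|lra].
Qed.

Lemma holo_const theta F z w : holo theta F (fun _ => 0) -> (theta < Re z)%R -> (theta < Re w)%R -> F w = F z.
Proof.
  intros HF Hz Hw. apply Ceq_minus, Cmod_eq_0, Rle_antisym; [|apply Cmod_ge_0].
  eapply Rle_trans; [apply (segment_mvt theta F (fun _ => 0) z w 0 HF Hz Hw)|].
  - intros; rewrite Cmod_0; lra.
  - lra.
Qed.

(** * Vertical means and bounds for coefficients *)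

Definition cpw (l : R) (s : C) : C := Cexp (RtoC l * s + 0).

Lemma cderiv_cpw l s : cderiv (cpw l) s (RtoC l * cpw l s).
Proof. apply cderiv_Cexp_lin. Qed.

Lemma Cmod_cpw l s : Cmod (cpw l s) = exp (l * Re s).
Proof. unfold cpw. rewrite Cmod_Cexp, Cplus_0_r, re_scal_l. reflexivity. Qed.

Lemma cpw_plus l m s : cpw l s * cpw m s = cpw (l + m) s.
Proof. unfold cpw. rewrite <- Cexp_plus. f_equal. rewrite RtoC_plus. ring. Qed.

Lemma dexp_cpw n s : dexp n s = cpw (- lnS n) s.
Proof. unfold dexp, cpw. f_equal. rewrite RtoC_opp. ring. Qed.

Lemma rdiff_cpw_vertical l x t : rdiff (fun t => cpw l (x, t)) t.
Proof.
  apply (rdiff_comp (cpw l) (fun t => (x, t)) t _ (cderiv_cpw l (x, t))). eexists; apply rderiv_vertical.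
Qed.

(** At a large [T] a slope [A > B] would beat the constant [K]; this extracts the leading
    coefficient of estimates over growing segments. *)
Lemma lin_growth_le A B K : (forall T, (0 < T)%R -> (A * T <= B * T + K)%R) -> (A <= B)%R.
Proof.
  intros H. apply Rnot_lt_le. intros Hlt.
  specialize (H ((Rabs K + 1) / (A - B))%R ltac:(apply Rdiv_lt_0_compat; [pose proof (Rabs_pos K)|]; lra)).
  set (T := ((Rabs K + 1) / (A - B))%R) in *.
  assert (E : ((A - B) * T = Rabs K + 1)%R) by (unfold T; field; lra).
  pose proof (Rle_abs K). lra.
Qed.

(* Used with [l = ln n - ln m], for the mean of [m^(-s) n^s] on the line [Re s = x]. *)
Lemma vertical_mean_term (c : C) l x : exists K, forall T, (0 < T)%R ->
  (Cmod (CI (fun t => (c * cpw l (x, t))%C) (- T) T - (if Req_EM_T l 0 then RtoC (2 * T) * c else 0)) <= K)%R.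
Proof.
  destruct (Req_EM_T l 0) as [->|Hl].
  - exists 0%R. intros T HT. rewrite (CI_ext _ (fun _ => c)).
    + rewrite CI_const. replace (T - - T)%R with (2 * T)%R by ring.
      replace (RtoC (2 * T) * c - RtoC (2 * T) * c) with (RtoC 0) by ring. rewrite Cmod_0; lra.
    + lra.
    + intros t _. unfold cpw. rewrite Cmult_0_l, Cplus_0_r, Cexp_0. ring.
  - assert (Nl : RtoC l <> 0) by (intros E; apply RtoC_inj in E; lra).
    exists (2 * (Cmod (/ Ci) * (Cmod (/ RtoC l) * (Cmod c * exp (l * x)))))%R. intros T HT.
    rewrite (CI_FTC (fun t => / Ci * (/ RtoC l * (c * cpw l (x, t))))).
    + replace (/ Ci * (/ RtoC l * (c * cpw l (x, T))) - / Ci * (/ RtoC l * (c * cpw l (x, (- T)%R))) - 0)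
       with (/ Ci * (/ RtoC l * (c * cpw l (x, T))) + - (/ Ci * (/ RtoC l * (c * cpw l (x, (- T)%R))))) by ring.
      eapply Rle_trans; [apply Cmod_triangle|]. rewrite Cmod_opp, !Cmod_mult, !Cmod_cpw. cbn [Re fst]. lra.
    + lra.
    + intros t _. eapply rderiv_eq.
      * apply rderiv_scal, rderiv_scal, rderiv_scal. apply (cderiv_rderiv_comp (cpw l) (fun t => (x, t))); [apply rderiv_vertical|apply cderiv_cpw].
      * field. split; [exact Nl|apply Ci_nz].
    + intros t _. apply rdiff_scal, rdiff_cpw_vertical.
Qed.

Lemma lnS_inj m n : lnS m = lnS n -> m = n.
Proof.
  intros H. apply ln_inv in H; try apply INR_S_pos. apply INR_eq in H. lia.
Qed.

(** Orthogonality of the exponentials: only the term with index [n] has a nonoscillating integrand,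
    so once [n < N] the integral is [2 * T * a n] up to an error independent of [T]. *)
Lemma vertical_mean_partial a n x N : exists K, forall T, (0 < T)%R ->
  (Cmod (CI (fun t => (csum (dirichlet_term a (x, t)) N * cpw (lnS n) (x, t))%C) (- T) T
    - (if Nat.ltb n N then RtoC (2 * T) * a n else 0)) <= K)%R.
Proof.
  assert (DT : forall m t, rdiff (fun t => dirichlet_term a (x, t) m * cpw (lnS n) (x, t)) t).
  { intros m t. apply (rdiff_ext (fun t => a m * cpw (- lnS m) (x, t) * cpw (lnS n) (x, t))).
    - intros y. rewrite dirichlet_term_dexp, dexp_cpw. reflexivity.
    - apply rdiff_mult; [apply rdiff_scal|]; apply rdiff_cpw_vertical. }
  assert (DS : forall N t, rdiff (fun t => csum (dirichlet_term a (x, t)) N * cpw (lnS n) (x, t)) t).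
  { induction N0 as [|M IH]; intros t; simpl.
    - apply rdiff_mult; [apply rdiff_const|apply rdiff_cpw_vertical].
    - apply (rdiff_ext (fun t => csum (dirichlet_term a (x, t)) M * cpw (lnS n) (x, t) + dirichlet_term a (x, t) M * cpw (lnS n) (x, t))).
      + intros y; ring.
      + rdiff_auto. }
  induction N as [|N [K IH]].
  - exists 0%R. intros T HT. rewrite (CI_ext _ (fun _ => 0)); [|lra|intros; simpl; ring].
    rewrite CI_const. simpl. replace (RtoC (T - - T) * 0 - 0) with (RtoC 0) by ring. rewrite Cmod_0; lra.
  - destruct (vertical_mean_term (a N) (- lnS N + lnS n) x) as [K' HK'].
    exists (K + K')%R. intros T HT. specialize (IH T HT). specialize (HK' T HT).
    rewrite (CI_ext _ (fun t => csum (dirichlet_term a (x, t)) N * cpw (lnS n) (x, t) + dirichlet_term a (x, t) N * cpw (lnS n) (x, t))); [|lra|intros; simpl; ring].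
    rewrite CI_plus by (lra || (intros t _; auto)).
    rewrite (CI_ext (fun t => dirichlet_term a (x, t) N * cpw (lnS n) (x, t)) (fun t => a N * cpw (- lnS N + lnS n) (x, t))); [|lra|].
    2:{ intros t _. rewrite dirichlet_term_dexp, dexp_cpw, <- cpw_plus. ring. }
    set (I1 := CI (fun t => csum (dirichlet_term a (x, t)) N * cpw (lnS n) (x, t)) (- T) T) in *.
    set (I2 := CI (fun t => a N * cpw (- lnS N + lnS n) (x, t)) (- T) T) in *.
    set (P := if Nat.ltb n N then RtoC (2 * T) * a n else 0) in *.
    set (Q := if Req_EM_T (- lnS N + lnS n) 0 then RtoC (2 * T) * a N else 0) in *.
    assert (E : (if Nat.ltb n (S N) then RtoC (2 * T) * a n else 0) = P + Q).
    { unfold P, Q. destruct (Req_EM_T (- lnS N + lnS n) 0) as [E|E].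
      - assert (N = n) by (apply lnS_inj; lra). subst N.
        rewrite Nat.ltb_irrefl. replace (Nat.ltb n (S n)) with true by (symmetry; apply Nat.ltb_lt; lia). ring.
      - assert (Hne : N <> n) by (intros ->; lra).
        replace (Nat.ltb n (S N)) with (Nat.ltb n N); [ring|].
        destruct (Nat.ltb_spec n N), (Nat.ltb_spec n (S N)); auto; lia. }
    rewrite E. pose proof (Cmod_split (I1 + I2 - (P + Q)) (I1 - P) (I2 - Q) ltac:(ring)). lra.
Qed.

Section Growth.
Variables (a : nat -> C) (f f' : C -> C) (M : R).
Hypothesis Hf : holo 0 f f'.
Hypothesis Hrep : represents a f.
Hypothesis HM : forall s, (1 <= Re s)%R -> (Cmod (f' s) <= M)%R.

(* The mean of [f' n^s] over the line [Re s = 1] equals that over a line far to the right,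
   by Goursat's theorem; there [f' n^s] is, up to a derivative, [- ln n f n^s]. *)
Lemma coefficient_bound n : (Cmod (a n) * lnS n <= M * exp (lnS n))%R.
Proof.
  destruct (in_D_poly_bounded a (represents_in_D a f Hrep)) as [K [k Ha]].
  destruct (represents_sum a f Hrep) as [theta Hth].
  pose proof (poly_bounded_nonneg a K k Ha) as HK.
  (* On the line [Re s = X] the function is its series, with explicit bounds, and the line lies to
     the right of [Re s = 1]. *)
  set (X := (Rmax (Rmax theta (k + 2)) 1 + 1)%R).
  assert (HX : (theta < X /\ k + 2 < X /\ 2 <= X)%R).
  { unfold X. max_bounds. lra. }
  destruct (holo_deriv 0 f f' Hf) as [f'' Hf'].
  set (L := lnS n). pose proof (lnS_pos n) as HL. fold L in HL.
  assert (HM0 : (0 <= M)%R).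
  { eapply Rle_trans; [apply Cmod_ge_0|]. apply (HM 1). simpl; lra. }
  set (W := fun s => f' s * cpw L s).
  assert (HW : holo 0 W (fun s => f'' s * cpw L s + f' s * (RtoC L * cpw L s))).
  { apply (holo_mult 0 f' f'' (cpw L)); [exact Hf'|intros s _; apply cderiv_cpw]. }
  assert (HfX : forall t, (Cmod (f (X, t)) <= Cmod (a 0%nat) + K)%R).
  { intros t. rewrite Hth by (cbn; lra).
    destruct (dirichlet_sum_facts a K k Ha (X, t) ltac:(cbn; lra)) as [_ [H _]].
    pose proof (Cmod_le_sub (dirichlet_sum a (X, t)) (a 0%nat)).
    assert (exp (- (Re (X, t) - k - 2) * ln 2) <= 1)%R.
    { rewrite <- exp_0. apply exp_le_compat. cbn. pose proof ln2_pos. nra. }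
    nra. }
  set (eX := exp (L * X)). assert (HeX : (0 < eX)%R) by apply exp_pos.
  set (B := (Cmod (a 0%nat) + K)%R) in *.
  assert (DWv : forall x T, (0 < x)%R -> rdiff_on (fun y => W (x, y)) (- T) T).
  { intros x T Hx t _. eapply rdiff_vertical; [exact HW|exact Hx]. }
  assert (DWh : forall y, rdiff_on (fun x => W (x, y)) 1 X).
  { intros y t Ht. eapply rdiff_horizontal; [exact HW|lra]. }
  assert (Dfe : forall T, rdiff_on (fun t => f (X, t) * cpw L (X, t)) (- T) T).
  { intros T t _. apply rdiff_mult; [eapply rdiff_vertical; [exact Hf|lra]|apply rdiff_cpw_vertical]. }
  (* The term [2 * T * (M * exp L)] comes from the line [Re s = 1]; the horizontal sides of the
     rectangle, of length [X - 1], and the boundary values of the integration by parts are bounded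
     independently of [T]. *)
  assert (S1 : forall T, (0 < T)%R ->
     (L * Cmod (CI (fun t => (f (X, t) * cpw L (X, t))%C) (- T) T) <= 2 * T * (M * exp L) + (2 * (M * eX * (X - 1)) + 2 * (B * eX)))%R).
  { intros T HT.
    pose proof (goursat 0 W _ 1 X (- T) T HW ltac:(lra) ltac:(lra) ltac:(lra)) as G.
    unfold rect_int in G.
    set (V1 := CI (fun y => W (1%R, y)) (- T) T) in *. set (VX := CI (fun y => W (X, y)) (- T) T) in *.
    set (H1 := CI (fun x => W (x, (- T)%R)) 1 X) in *. set (H2 := CI (fun x => W (x, T)) 1 X) in *.
    set (m := CI (fun t => f (X, t) * cpw L (X, t)) (- T) T).
    assert (BV1 : (Cmod V1 <= M * exp L * (T - - T))%R).
    { apply CI_bound; [lra|apply DWv; lra|]. intros t _. apply Cmod_mult_le; [apply HM; cbn; lra|].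
      rewrite Cmod_cpw. rewrite Rmult_1_r. lra. }
    assert (BH : forall y, (Cmod (CI (fun x => W (x, y)) 1 X) <= M * eX * (X - 1))%R).
    { intros y. apply CI_bound; [lra|apply DWh|]. intros x Hx. apply Cmod_mult_le; [apply HM; cbn; lra|].
      rewrite Cmod_cpw. cbn [Re fst]. apply exp_le_compat. nra. }
    assert (BVX : (Cmod VX <= M * exp L * (2 * T) + 2 * (M * eX * (X - 1)))%R).
    { assert (E : Ci * VX = Ci * V1 + (H2 - H1)).
      { replace (Ci * VX) with (H1 + Ci * VX - H2 - Ci * V1 + (Ci * V1 + (H2 - H1))) by ring. rewrite G. ring. }
      replace (Cmod VX) with (Cmod (Ci * VX)) by (rewrite Cmod_mult, Cmod_Ci; ring). rewrite E.
      eapply Rle_trans; [apply Cmod_triangle|]. rewrite Cmod_mult, Cmod_Ci.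
      pose proof (Cmod_triangle H2 (- H1)) as T1. rewrite Cmod_opp in T1. fold (H2 - H1) in T1.
      pose proof (BH (- T)%R) as B1. pose proof (BH T) as B2. fold H1 in B1. fold H2 in B2. lra. }
    (* The derivative of [f * cpw L] is [(f' + L f) * cpw L]; it is integrated along the line
       [Re s = X]. *)
    assert (E : Ci * (VX + RtoC L * m) = f (X, T) * cpw L (X, T) - f (X, (- T)%R) * cpw L (X, (- T)%R)).
    { unfold VX, m. rewrite <- CI_scal by (lra || apply Dfe). rewrite <- CI_plus; [|lra|apply DWv; lra|].
      2:{ intros t Ht. apply rdiff_scal, (Dfe T t Ht). }
      rewrite <- CI_scal; [|lra|].
      2:{ intros t Ht. apply rdiff_plus; [apply (DWv X T ltac:(lra) t Ht)|apply rdiff_scal, (Dfe T t Ht)]. }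
      apply (CI_FTC (fun t => f (X, t) * cpw L (X, t))); [lra| |].
      - intros t _. eapply rderiv_eq.
        + apply rderiv_mult.
          * apply (cderiv_rderiv_comp f (fun t => (X, t))); [apply rderiv_vertical|apply Hf; cbn; lra].
          * apply (cderiv_rderiv_comp (cpw L) (fun t => (X, t))); [apply rderiv_vertical|apply cderiv_cpw].
        + unfold W. ring.
      - intros t Ht. apply rdiff_scal, rdiff_plus; [apply (DWv X T ltac:(lra) t Ht)|apply rdiff_scal, (Dfe T t Ht)]. }
    assert (BE : (Cmod (VX + RtoC L * m) <= 2 * (B * eX))%R).
    { replace (Cmod (VX + RtoC L * m)) with (Cmod (Ci * (VX + RtoC L * m))) by (rewrite (Cmod_mult Ci), Cmod_Ci; ring).
      rewrite E. eapply Rle_trans; [apply Cmod_triangle|]. rewrite Cmod_opp, !Cmod_mult, !Cmod_cpw. cbn [Re fst].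
      fold eX. pose proof (HfX T). pose proof (HfX (- T)%R). nra. }
    replace (L * Cmod m)%R with (Cmod (RtoC L * m)) by (rewrite Cmod_mult, Cmod_R, Rabs_pos_eq; lra).
    pose proof (Cmod_split (RtoC L * m) (VX + RtoC L * m) (- VX) ltac:(ring)) as T1. rewrite Cmod_opp in T1. lra. }
  (* Replacing [f] by its partial sum of length [N] costs at most [K / N * eX] per unit of length,
     and the mean of that sum isolates [a n]. First [T] tends to infinity with [N] fixed, and [N]
     afterwards. *)
  assert (S2 : forall N, (n < N)%nat -> (Cmod (a n) * L <= M * exp L + L * (K / INR N * eX))%R).
  { intros N HN. destruct (vertical_mean_partial a n X N) as [KN HKN].
    apply (lin_growth_le _ _ ((2 * (M * eX * (X - 1)) + 2 * (B * eX)) / 2 + L * KN / 2)). intros T HT.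
    specialize (S1 T HT). specialize (HKN T HT). replace (Nat.ltb n N) with true in HKN by (symmetry; apply Nat.ltb_lt; lia).
    set (m := CI (fun t => f (X, t) * cpw L (X, t)) (- T) T) in *.
    fold L in HKN. set (mN := CI (fun t => csum (dirichlet_term a (X, t)) N * cpw L (X, t)) (- T) T) in *.
    assert (DmN : rdiff_on (fun t => csum (dirichlet_term a (X, t)) N * cpw L (X, t)) (- T) T).
    { intros t _. apply rdiff_mult; [|apply rdiff_cpw_vertical].
      clear. induction N as [|N IH]; simpl; [apply rdiff_const|]. apply rdiff_plus; [exact IH|].
      apply (rdiff_ext (fun t => a N * cpw (- lnS N) (X, t))).
      - intros y. rewrite dirichlet_term_dexp, dexp_cpw. reflexivity.
      - apply rdiff_scal, rdiff_cpw_vertical. }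
    assert (D : (Cmod (m - mN) <= K / INR N * eX * (T - - T))%R).
    { unfold m, mN. rewrite <- CI_minus by (lra || apply Dfe || exact DmN).
      apply CI_bound; [lra| |].
      - intros t Ht. apply rdiff_minus; [apply (Dfe T t Ht)|apply (DmN t Ht)].
      - intros t _. replace (f (X, t) * cpw L (X, t) - csum (dirichlet_term a (X, t)) N * cpw L (X, t))
          with ((f (X, t) - csum (dirichlet_term a (X, t)) N) * cpw L (X, t)) by ring.
        apply Cmod_mult_le.
        + rewrite Hth by (cbn; lra). apply (dirichlet_sum_facts a K k Ha (X, t) ltac:(cbn; lra)). lia.
        + rewrite Cmod_cpw. cbn [Re fst]. unfold eX. lra. }
    assert (T1 : (Cmod (RtoC (2 * T) * a n) <= Cmod m + Cmod (m - mN) + Cmod (mN - RtoC (2 * T) * a n))%R).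
    { pose proof (Cmod_le_sub (RtoC (2 * T) * a n) mN) as Q1. rewrite (Cmod_sub_sym _ mN) in Q1.
      pose proof (Cmod_le_sub mN m) as Q2. rewrite (Cmod_sub_sym mN) in Q2. lra. }
    rewrite Cmod_mult, Cmod_R, (Rabs_pos_eq (2 * T)) in T1 by lra.
    assert (L * (2 * T * Cmod (a n)) <= L * Cmod m + L * (K / INR N * eX * (T - - T)) + L * KN)%R.
    { rewrite <- !Rmult_plus_distr_l. apply Rmult_le_compat_l; lra. }
    lra. }
  apply Rle_eps. intros eps He.
  assert (HC : (0 <= L * K * eX)%R) by (repeat apply Rmult_le_pos; lra).
  destruct (inv_INR_small _ eps HC He) as [N0 [_ HN]].
  specialize (S2 (max N0 (S n)) ltac:(lia)). specialize (HN (max N0 (S n)) ltac:(lia)). lra.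
Qed.

(** [ln 2 > 1 / 2] turns the coefficient bound into [2 * M]. Then [5 * M] is [2 * M] for the
    nonconstant terms at [s + 3], which lies in the half-plane of convergence, plus [3 * M] for the
    derivative over the segment of length [3] back to [s]. *)
Lemma dirichlet_growth : poly_bounded a (2 * M) 1 /\
  (forall s, (3 < Re s)%R -> f s = dirichlet_sum a s) /\
  (forall s, (1 <= Re s)%R -> (Cmod (f s - a 0%nat) <= 5 * M)%R).
Proof.
  assert (HM0 : (0 <= M)%R).
  { eapply Rle_trans; [apply Cmod_ge_0|]. apply (HM 1). simpl; lra. }
  assert (Hpb : poly_bounded a (2 * M) 1).
  { intros n Hn. pose proof (coefficient_bound n) as H. pose proof (lnS_ge n Hn). pose proof ln_lt_2.
    rewrite Rmult_1_l. pose proof (Cmod_ge_0 (a n)). nra. }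
  assert (Heq : forall s, (3 < Re s)%R -> f s = dirichlet_sum a s).
  { destruct (represents_sum a f Hrep) as [theta Hth].
    apply (identity_eq 3 f f' (dirichlet_sum a) (dirichlet_sum (dirichlet_deriv a)) theta).
    - apply (holo_mono 0); [lra|exact Hf].
    - apply (dirichlet_sum_holo a (2 * M) 1 Hpb).
    - exact Hth. }
  split; [exact Hpb|]. split; [exact Heq|]. intros s Hs.
  assert (H1 : (Cmod (f (s + 3)%C - a 0%nat) <= 2 * M)%R).
  { rewrite Heq by (rewrite re_plus, re_RtoC; lra).
    destruct (dirichlet_sum_facts a (2 * M) 1 Hpb (s + 3)) as [_ [H _]]; [rewrite re_plus, re_RtoC; lra|].
    assert (exp (- (Re (s + 3) - 1 - 2) * ln 2) <= 1)%R.
    { apply Rle_trans with (exp 0); [|rewrite exp_0; lra]. apply exp_le_compat. rewrite re_plus, re_RtoC. pose proof ln2_pos.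
      assert (0 <= (Re s + 3 - 1 - 2) * ln 2)%R by (apply Rmult_le_pos; lra). lra. }
    nra. }
  assert (H2 : (Cmod (f s - f (s + 3)%C) <= M * Cmod (s - (s + 3)))%R).
  { apply (segment_mvt 0 f f'); [exact Hf|rewrite re_plus, re_RtoC; lra|lra|]. intros t Ht. apply HM.
    rewrite re_plus, re_scal_r, re_sub, re_plus. rewrite re_RtoC. nra. }
  replace (s - (s + 3)) with (- (3)) in H2 by ring. rewrite Cmod_opp, Cmod_R, Rabs_pos_eq in H2 by lra.
  pose proof (Cmod_sub_split (f s) (f (s + 3)) (a 0%nat)). lra.
Qed.

End Growth.

(** * The Volterra operator *)

Lemma is_RInt_gen_primitive (u V : R -> C) (l : C) :
  (forall x, (0 <= x)%R -> rderiv V x (u x)) -> (forall x, (0 <= x)%R -> rdiff u x) ->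
  (forall eps, (0 < eps)%R -> exists X, forall x, (X <= x)%R -> (Cmod (V x - l) <= eps)%R) ->
  is_RInt_gen (V := C_R_NormedModule) u (at_point 0%R) (Rbar_locally p_infty) (l - V 0%R).
Proof.
  intros HV Hu Hl P HP.
  assert (HP' : locally (T := C_UniformSpace) (l - V 0%R) P) by exact HP.
  apply locally_C in HP'. destruct HP' as [e He].
  destruct (Hl (e / 2)%R) as [X HX]; [pose proof (cond_pos e); lra|].
  exists (fun a => a = 0%R) (fun b => (Rmax 0 X < b)%R).
  - reflexivity.
  - exists (Rmax 0 X). intros x Hx; exact Hx.
  - intros a b -> Hb.
    max_bounds.
    exists (V b - V 0%R). split.
    + apply is_RInt_rderiv; [lra| |].
      * intros t Ht; apply HV; lra.
      * intros t Ht; apply Hu; lra.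
    + apply He. change (Cmod (V b - V 0%R - (l - V 0%R)) < e)%R.
      replace (V b - V 0%R - (l - V 0%R)) with (V b - l) by ring.
      specialize (HX b ltac:(lra)). pose proof (cond_pos e). lra.
Qed.

Lemma is_RInt_gen_at_infty_unique (u : R -> C) l l' :
  is_RInt_gen (V := C_R_NormedModule) u (at_point 0%R) (Rbar_locally p_infty) l ->
  is_RInt_gen (V := C_R_NormedModule) u (at_point 0%R) (Rbar_locally p_infty) l' -> l = l'.
Proof.
  intros H H'.
  rewrite <- (is_RInt_gen_unique (V := C_R_CompleteNormedModule) u l H).
  apply (is_RInt_gen_unique (V := C_R_CompleteNormedModule) u l' H').
Qed.

Lemma volterra_unique g f h h' : volterra g f h -> volterra g f h' ->
  exists theta, forall s, (theta < Re s)%R -> h s = h' s.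
Proof.
  intros [t1 H1] [t2 H2]. exists (Rmax t1 t2). intros s Hs.
  max_bounds.
  specialize (H1 s ltac:(unfold half_plane; lra)). specialize (H2 s ltac:(unfold half_plane; lra)).
  pose proof (is_RInt_gen_at_infty_unique _ _ _ H1 H2) as E.
  replace (h s) with (- - h s) by ring. rewrite E. ring.
Qed.

Lemma C_derive_dirichlet_sum g K k s : poly_bounded g K k -> (k + 2 < Re s)%R ->
  C_derive (dirichlet_sum g) s = dirichlet_sum (dirichlet_deriv g) s.
Proof. intros Hg Hs. apply cderiv_C_derive, (dirichlet_sum_holo g K k Hg), Hs. Qed.

Lemma dirichlet_sum_infty a K k s : poly_bounded a K k -> (k + 2 < Re s)%R ->
  forall eps, (0 < eps)%R -> exists X, forall x, (X <= x)%R ->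
   (Cmod (dirichlet_sum a (s + RtoC x) - a 0%nat) <= eps)%R.
Proof.
  intros Ha Hs eps He. pose proof (poly_bounded_nonneg a K k Ha) as HK. pose proof ln2_pos as Hl2.
  (* By [exp y >= 1 + y] at [y = x * ln 2], this threshold makes the exponential at most
     [eps / (K + 1)]. *)
  exists (Rmax 0 ((K + 1) / eps / ln 2)). intros x Hx.
  max_bounds.
  destruct (dirichlet_sum_facts a K k Ha (s + RtoC x)) as [_ [H1 _]]; [rewrite re_plus, re_RtoC; lra|].
  eapply Rle_trans; [exact H1|]. rewrite re_plus, re_RtoC.
  assert (Hy : ((K + 1) / eps <= x * ln 2)%R).
  { replace ((K + 1) / eps)%R with ((K + 1) / eps / ln 2 * ln 2)%R by (field; lra). apply Rmult_le_compat_r; lra. }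
  assert (H2 : (exp (- (Re s + x - k - 2) * ln 2) <= exp (- (x * ln 2)))%R) by (apply exp_le_compat; nra).
  rewrite exp_Ropp in H2.
  assert (H3 : ((K + 1) / eps <= exp (x * ln 2))%R).
  { pose proof (exp_ineq1_le (x * ln 2)). lra. }
  assert (H4 : (0 < (K + 1) / eps)%R) by (apply Rdiv_lt_0_compat; lra).
  apply Rinv_le_contravar in H3; [|exact H4].
  replace (/ ((K + 1) / eps))%R with (eps / (K + 1))%R in H3 by (field; lra).
  apply Rle_trans with ((K + 1) * (eps / (K + 1)))%R.
  - apply Rmult_le_compat; try lra. left; apply exp_pos.
  - right; field; lra.
Qed.

(** Along the half-line the sum of the series is itself a primitive of its derivative, and its limit
    at infinity is the constant coefficient. *)
Lemma volterra_one g h : in_D g -> volterra g (fun _ => 1) h ->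
  exists theta, forall s, (theta < Re s)%R -> h s + g 0%nat = dirichlet_sum g s.
Proof.
  intros Hg [t Ht]. destruct (in_D_poly_bounded g Hg) as [K [k Hpb]].
  exists (Rmax t (k + 2)). intros s Hs. max_bounds.
  specialize (Ht s ltac:(unfold half_plane; lra)).
  pose proof (dirichlet_sum_holo g K k Hpb) as HG.
  destruct (holo_deriv _ _ _ HG) as [G'' HG'].
  assert (Hin : forall x, (0 <= x)%R -> (k + 2 < Re (s + RtoC x))%R) by (intros; rewrite re_plus, re_RtoC; lra).
  assert (Hline : forall x, rderiv (fun x => s + RtoC x) x 1).
  { intros x. apply (rderiv_ext (fun x => s + 1 * RtoC x)); [intros; ring|apply rderiv_line]. }
  assert (I : is_RInt_gen (V := C_R_NormedModule)
      (fun x : R => 1 * C_derive (dirichlet_sum g) (s + RtoC x))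
      (at_point 0%R) (Rbar_locally p_infty) (g 0%nat - dirichlet_sum g (s + 0))).
  { apply (is_RInt_gen_primitive _ (fun x => dirichlet_sum g (s + RtoC x))).
    - intros x Hx. rewrite (C_derive_dirichlet_sum g K k _ Hpb (Hin x Hx)), Cmult_comm.
      apply (cderiv_rderiv_comp (dirichlet_sum g)); [apply Hline|apply HG, Hin, Hx].
    - intros x Hx.
      apply rdiff_scal. apply (rdiff_comp (C_derive (dirichlet_sum g)) _ _ (G'' (s + RtoC x))); [|eexists; apply Hline].
      apply (cderiv_ext_loc (dirichlet_sum (dirichlet_deriv g)) _ _ _ (Re (s + RtoC x) - (k + 2))).
      + specialize (Hin x Hx); lra.
      + intros w Hw. symmetry. apply (C_derive_dirichlet_sum g K k w Hpb).
        apply (half_plane_open _ _ (Hin x Hx) _ Hw).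
      + apply HG', Hin, Hx.
    - apply (dirichlet_sum_infty g K k); auto; lra. }
  pose proof (is_RInt_gen_at_infty_unique _ _ _ Ht I) as E.
  replace (h s) with (- - h s) by ring. rewrite E, Cplus_0_r. ring.
Qed.

Lemma poly_bounded_all a K k : poly_bounded a K k ->
  forall n, (Cmod (a n) <= Rmax K (Cmod (a 0%nat)) * exp (k * lnS n))%R.
Proof.
  intros H [|n].
  - rewrite lnS_0, Rmult_0_r, exp_0, Rmult_1_r. apply Rmax_r.
  - eapply Rle_trans; [apply H; lia|]. apply Rmult_le_compat_r; [left; apply exp_pos|apply Rmax_l].
Qed.

(** [volterra] is stated with [C_derive (dirichlet_sum g)], which is meaningful only far to the
    right; there it is matched with the derivative of the analytic extension [G]. *)
Lemma represents_deriv g G G' : holo 0 G G' -> represents g G -> exists K k theta,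
  poly_bounded g K k /\ (k + 2 <= theta)%R /\ forall s, (theta < Re s)%R ->
   G s = dirichlet_sum g s /\ G' s = dirichlet_sum (dirichlet_deriv g) s /\ C_derive (dirichlet_sum g) s = G' s.
Proof.
  intros HG Hrep.
  destruct (in_D_poly_bounded g (represents_in_D g G Hrep)) as [K [k Hg]].
  destruct (represents_sum g G Hrep) as [t Ht].
  exists K, k, (Rmax 0 (Rmax t (k + 2))).
  max_bounds.
  split; [exact Hg|]. split; [lra|]. intros s Hs.
  assert (E : G' s = dirichlet_sum (dirichlet_deriv g) s).
  { apply (cderiv_unique (dirichlet_sum g) s); [|apply (dirichlet_sum_holo g K k Hg); lra].
    apply (cderiv_ext_loc G _ _ _ (Re s - t)); [lra| |apply HG; lra].
    intros w Hw. apply Ht. apply (half_plane_open t s ltac:(lra) w Hw). }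
  split; [apply Ht; lra|]. split; [exact E|]. rewrite E.
  apply (C_derive_dirichlet_sum g K k); auto; lra.
Qed.

Lemma represents_mult a b f g : represents a f -> represents b g -> represents (dconv a b) (fun s => f s * g s).
Proof.
  intros Ra Rb.
  destruct (in_D_poly_bounded a (represents_in_D a f Ra)) as [K1 [k1 Ha]].
  destruct (in_D_poly_bounded b (represents_in_D b g Rb)) as [K2 [k2 Hb]].
  destruct (represents_sum a f Ra) as [t1 H1]. destruct (represents_sum b g Rb) as [t2 H2].
  set (k := Rmax k1 k2). set (K := Rmax K1 K2).
  pose proof (poly_bounded_all a K k (poly_bounded_weaken a K1 K k1 k (Rmax_l _ _) (Rmax_l _ _) Ha)) as Pa.
  pose proof (poly_bounded_all b K k (poly_bounded_weaken b K2 K k2 k (Rmax_r _ _) (Rmax_r _ _) Hb)) as Pb.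
  set (K' := Rmax (Rmax K (Cmod (a 0%nat))) (Rmax K (Cmod (b 0%nat)))).
  assert (Pa' : forall n, (Cmod (a n) <= K' * exp (k * lnS n))%R).
  { intros n. eapply Rle_trans; [apply Pa|]. apply Rmult_le_compat_r; [left; apply exp_pos|apply Rmax_l]. }
  assert (Pb' : forall n, (Cmod (b n) <= K' * exp (k * lnS n))%R).
  { intros n. eapply Rle_trans; [apply Pb|]. apply Rmult_le_compat_r; [left; apply exp_pos|apply Rmax_r]. }
  apply (poly_bounded_represents _ (K' * K') (k + 2) _ (Rmax (k + 3) (Rmax t1 t2))).
  - apply dconv_poly_bounded; auto.
  - intros s Hs. max_bounds.
    rewrite (dirichlet_product a b K' k) by (auto; lra). rewrite H1, H2 by lra. reflexivity.
Qed.

Lemma dirichlet_deriv_poly_bounded g K k : poly_bounded g K k -> poly_bounded (dirichlet_deriv g) K (k + 1).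
Proof.
  intros H n Hn. unfold dirichlet_deriv. rewrite Cmod_mult, Cmod_opp, Cmod_R, Rabs_pos_eq by apply lnS_pos.
  replace ((k + 1) * lnS n)%R with (lnS n + k * lnS n)%R by ring. rewrite exp_plus.
  replace (K * (exp (lnS n) * exp (k * lnS n)))%R with (exp (lnS n) * (K * exp (k * lnS n)))%R by ring.
  apply Rmult_le_compat; [apply lnS_pos|apply Cmod_ge_0| |apply H, Hn].
  pose proof (exp_ineq1_le (lnS n)). lra.
Qed.

(** Termwise integration divides by [- lnS n], which is possible because the constant coefficient is
    zero; the result has the same derivative as [U] on a half-plane, hence differs from [U] by a
    constant. *)
Lemma represents_primitive w W U : represents w W -> w 0%nat = 0 -> holo 0 U W ->
  exists (c : nat -> C) (const : C), c 0%nat = 0 /\ represents c (fun s => U s - const).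
Proof.
  intros Rw w0 HU.
  destruct (in_D_poly_bounded w (represents_in_D w W Rw)) as [K [k Hw]].
  destruct (represents_sum w W Rw) as [t Ht].
  (* At index [0] the divisor [lnS 0] is zero, but the factor [w 0 = 0] makes the value [0]
     anyway. *)
  set (c := fun n => - / RtoC (lnS n) * w n).
  assert (c0 : c 0%nat = 0) by (unfold c; rewrite w0; ring).
  assert (Hc : poly_bounded c (2 * K) k).
  { intros n Hn. pose proof (lnS_ge n Hn). pose proof ln_lt_2.
    assert (N : RtoC (lnS n) <> 0) by (intros E; apply RtoC_inj in E; lra).
    unfold c. rewrite Cmod_mult, Cmod_opp, Cmod_inv, Cmod_R, Rabs_pos_eq by (auto; lra).
    rewrite Rmult_assoc. apply Rmult_le_compat; [left; apply Rinv_0_lt_compat; lra|apply Cmod_ge_0| |apply Hw, Hn].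
    replace 2%R with (/ / 2)%R by field. apply Rinv_le_contravar; lra. }
  assert (Hdc : forall s, (k + 2 < Re s)%R -> dirichlet_sum (dirichlet_deriv c) s = dirichlet_sum w s).
  { intros s Hs. apply dirichlet_sum_clim.
    apply (clim_ext (csum (dirichlet_term w s))); [|apply (dirichlet_sum_facts w K k Hw); lra].
    intros N. apply csum_ext. intros n _. rewrite !dirichlet_term_dexp. unfold dirichlet_deriv, c.
    destruct n as [|n].
    - rewrite lnS_0, w0. ring.
    - pose proof (lnS_ge (S n) ltac:(lia)). pose proof ln2_pos.
      assert (N' : RtoC (lnS (S n)) <> 0) by (intros E; apply RtoC_inj in E; lra). field. exact N'. }
  set (theta := Rmax 0 (Rmax t (k + 2))).
  assert (Hth : (0 <= theta /\ t <= theta /\ k + 2 <= theta)%R).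
  { unfold theta. max_bounds. lra. }
  assert (H0 : holo theta (fun s => U s - dirichlet_sum c s) (fun _ => 0)).
  { intros s Hs. eapply cderiv_eq.
    - apply cderiv_minus; [apply HU; lra|apply (dirichlet_sum_holo c (2 * K) k Hc); lra].
    - rewrite Hdc, Ht by lra. ring. }
  set (s0 := RtoC (theta + 1)).
  exists c, (U s0 - dirichlet_sum c s0). split; [exact c0|].
  apply (poly_bounded_represents c (2 * K) k _ theta Hc).
  intros s Hs. rewrite <- (holo_const theta _ s0 s H0); [ring| |exact Hs].
  unfold s0. rewrite re_RtoC. lra.
Qed.

(** The series of [G'] has no constant term since [lnS 0 = 0], so neither has that of [f * G']. A
    primitive of [f * G'] on the whole half-plane can thus be normalized to tend to [0] at infinity,
    and that is [T_g f]. *)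
Theorem volterra_exists g G G' a f f' : holo 0 G G' -> represents g G -> holo 0 f f' -> represents a f ->
  exists (h : C -> C) (c : nat -> C), holo 0 h (fun s => f s * G' s) /\ represents c h /\ c 0%nat = 0 /\ volterra g f h.
Proof.
  intros HG Rg Hf Ra.
  destruct (represents_deriv g G G' HG Rg) as [Kg [kg [tg [Hg [Htg HgE]]]]].
  destruct (holo_deriv 0 G G' HG) as [G'' HG'].
  pose proof (holo_mult 0 f f' G' G'' Hf HG') as HfG.
  assert (RG' : represents (dirichlet_deriv g) G').
  { apply (poly_bounded_represents _ Kg (kg + 1) _ tg).
    - apply dirichlet_deriv_poly_bounded, Hg.
    - intros s Hs. apply (HgE s Hs). }
  pose proof (represents_mult _ _ _ _ Ra RG') as Rw.
  assert (w0 : dconv a (dirichlet_deriv g) 0%nat = 0).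
  { unfold dconv. simpl. unfold dirichlet_deriv. rewrite lnS_0. ring. }
  destruct (primitive_exists 0 _ _ HfG) as [U HU].
  destruct (represents_primitive _ _ _ Rw w0 HU) as [c [const [c0 Rc]]].
  exists (fun s => U s - const), c.
  assert (Hh : holo 0 (fun s => U s - const) (fun s => f s * G' s)).
  { intros s Hs. eapply cderiv_eq; [apply cderiv_minus; [apply HU, Hs|apply cderiv_const]|ring]. }
  split; [exact Hh|]. split; [exact Rc|]. split; [exact c0|].
  destruct (in_D_poly_bounded c (represents_in_D _ _ Rc)) as [Kc [kc Hc]].
  destruct (represents_sum _ _ Rc) as [tc Htc].
  exists (Rmax (Rmax 0 tg) (Rmax tc (kc + 2))). intros s Hs. unfold half_plane in Hs.
  assert (Hs' : (0 < Re s /\ tg < Re s /\ tc < Re s /\ kc + 2 < Re s)%R).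
  { max_bounds. lra. }
  assert (Hline : forall x, rderiv (fun x => s + RtoC x) x 1).
  { intros x. apply (rderiv_ext (fun x => s + 1 * RtoC x)); [intros; ring|apply rderiv_line]. }
  assert (Hre : forall x, Re (s + RtoC x) = (Re s + x)%R) by (intros; rewrite re_plus, re_RtoC; reflexivity).
  set (h := fun s => U s - const) in *.
  replace (- (U s - const)) with (0 - h (s + RtoC 0)) by (unfold h; rewrite Cplus_0_r; ring).
  apply (is_RInt_gen_ext (V := C_R_NormedModule) (fun x => f (s + RtoC x) * G' (s + RtoC x))).
  { exists (fun a => a = 0%R) (fun b => (0 < b)%R).
    - reflexivity.
    - exists 0%R. intros x Hx; exact Hx.
    - intros x y -> Hy z Hz. cbn [fst snd] in Hz. rewrite Rmin_left, Rmax_right in Hz by lra.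
      f_equal. symmetry. apply HgE. rewrite Hre. lra. }
  apply (is_RInt_gen_primitive (fun x => f (s + RtoC x) * G' (s + RtoC x)) (fun x => h (s + RtoC x)) 0).
  - intros x Hx. rewrite <- (Cmult_1_r (f (s + RtoC x) * G' (s + RtoC x))).
    apply (cderiv_rderiv_comp h); [apply Hline|]. apply Hh. rewrite Hre; lra.
  - intros x Hx. apply (rdiff_comp (fun s => f s * G' s) (fun x => s + RtoC x) x _ (HfG (s + RtoC x) ltac:(rewrite Hre; lra))).
    eexists; apply Hline.
  - intros eps He. destruct (dirichlet_sum_infty c Kc kc s Hc ltac:(lra) eps He) as [X HX].
    exists (Rmax X 0). intros x Hx. max_bounds.
    change (Cmod (U (s + RtoC x)%C - const - 0) <= eps)%R.
    rewrite Htc by (rewrite Hre; lra). specialize (HX x ltac:(lra)). rewrite c0 in HX. exact HX.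
Qed.

(** [volterra] constrains [h] only far to the right; there [h] agrees with the extension already
    constructed, and the identity principle carries the agreement to all of [Re s > 0]. *)
Lemma volterra_deriv g G G' a f f' h h' : holo 0 G G' -> represents g G -> holo 0 f f' -> represents a f ->
  holo 0 h h' -> volterra g f h -> forall s, (0 < Re s)%R -> cderiv h s (f s * G' s).
Proof.
  intros HG Rg Hf Ra Hh Vh s Hs.
  destruct (volterra_exists g G G' a f f' HG Rg Hf Ra) as [h0 [c [Hh0 [_ [_ Vh0]]]]].
  destruct (volterra_unique g f h h0 Vh Vh0) as [t Ht].
  apply (cderiv_ext_loc h0 _ _ _ (Re s)); [exact Hs| |apply Hh0, Hs].
  symmetry. apply (identity_eq 0 h h' h0 _ t Hh Hh0 Ht).
  apply (half_plane_open 0 s Hs). lra.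
Qed.

(** * Bloch spaces *)

Lemma sup_on_le S (u : C -> R) (M : R) : (forall s, S s -> (u s <= M)%R) -> Rbar_le (sup_on S u) M.
Proof.
  intros H. apply Lub_Rbar_correct. intros x [s [Hs ->]]. apply H, Hs.
Qed.

Lemma sup_on_ge S (u : C -> R) s : S s -> Rbar_le (u s) (sup_on S u).
Proof. intros Hs. apply Lub_Rbar_correct. exists s; auto. Qed.

Lemma bloch_norm_le f (A B : R) :
  (forall s, (0 < Re s)%R -> (Re s * Cmod (C_derive f s) <= A)%R) -> (Cmod (f 1) <= B)%R ->
  Rbar_le (bloch_norm f) (A + B)%R.
Proof.
  intros HA HB.
  change (Finite (A + B)) with (Rbar_plus (Finite A) (Finite B)).
  apply Rbar_plus_le_compat; [apply sup_on_le; exact HA|exact HB].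
Qed.

Lemma bloch_norm_le_inv f (M : R) : Rbar_le (bloch_norm f) M ->
  (forall s, (0 < Re s)%R -> (Re s * Cmod (C_derive f s) <= M)%R) /\ (Cmod (f 1) <= M)%R.
Proof.
  unfold bloch_norm. intros H.
  pose proof (sup_on_ge (half_plane 0) (fun s => (Re s * Cmod (C_derive f s))%R)) as G.
  destruct (sup_on (half_plane 0) (fun s => (Re s * Cmod (C_derive f s))%R)) as [x| |].
  - simpl in H. pose proof (Cmod_ge_0 (f 1)). split.
    + intros s Hs. specialize (G s Hs). simpl in G. lra.
    + specialize (G 1 ltac:(unfold half_plane; simpl; lra)). simpl in G.
      pose proof (Cmod_ge_0 (C_derive f 1)). lra.
  - contradiction.
  - exfalso. apply (G 1). unfold half_plane; simpl; lra.
Qed.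

Lemma bloch_norm_finite f : Rbar_lt (bloch_norm f) p_infty -> exists M : R, Rbar_le (bloch_norm f) M.
Proof.
  destruct (bloch_norm f) as [x| |]; simpl; intros H; try contradiction.
  - exists x; simpl; lra.
  - exists 0%R; exact I.
Qed.

Lemma bloch_holo f : analytic_on (half_plane 0) f -> holo 0 f (C_derive f).
Proof. intros H s Hs. apply (analytic_cderiv _ _ _ H Hs). Qed.

(** * Null sets, and pointwise bounds from the essential supremum *)

Definition overlap (a b x y : R) : R := Rmax 0 (Rmin b y - Rmax a x).

Lemma overlap_add a b x y : (a <= b)%R -> (x <= y)%R ->
  overlap a b x y = (overlap a ((a + b) / 2) x y + overlap ((a + b) / 2) b x y)%R.
Proof.
  unfold overlap.
  unfold Rmax, Rmin. repeat destruct Rle_dec; lra.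
Qed.

Lemma overlap_nonneg a b x y : (0 <= overlap a b x y)%R.
Proof. apply Rmax_l. Qed.

Lemma overlap_le a b x y : (x <= y)%R -> (overlap a b x y <= y - x)%R.
Proof. unfold overlap, Rmax, Rmin. repeat destruct Rle_dec; lra. Qed.

Lemma overlap_inside a b x y : (a <= b)%R -> (x <= a)%R -> (b <= y)%R -> overlap a b x y = (b - a)%R.
Proof. unfold overlap, Rmax, Rmin. repeat destruct Rle_dec; lra. Qed.

Lemma sum_n_mono (u : nat -> R) m n : (forall k, (0 <= u k)%R) -> (m <= n)%nat -> (sum_n u m <= sum_n u n)%R.
Proof.
  intros Hu H. induction H as [|n H IH]; [lra|].
  rewrite sum_Sn. change (plus (sum_n u n) (u (S n))) with (sum_n u n + u (S n))%R. specialize (Hu (S n)). lra.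
Qed.

Lemma sum_n_ge_term (u : nat -> R) n : (forall k, (0 <= u k)%R) -> (u n <= sum_n u n)%R.
Proof.
  intros Hu. destruct n as [|n]; [rewrite sum_O; lra|].
  rewrite sum_Sn. change (plus (sum_n u n) (u (S n))) with (sum_n u n + u (S n))%R.
  pose proof (sum_n_mono u 0 n Hu ltac:(lia)). rewrite sum_O in H. pose proof (Hu 0%nat). lra.
Qed.

Lemma sum_n_le_compat (u v : nat -> R) n : (forall k, (u k <= v k)%R) -> (sum_n u n <= sum_n v n)%R.
Proof. intros H. apply sum_n_m_le. exact H. Qed.

Lemma sum_n_plus_R (u v : nat -> R) n : sum_n (fun k => u k + v k)%R n = (sum_n u n + sum_n v n)%R.
Proof. apply (sum_n_plus (G := R_AbelianMonoid)). Qed.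

Lemma sum_n_geom_le eps N : (0 <= eps)%R -> (sum_n (fun n => eps * (/ 2) ^ (S n))%R N <= eps)%R.
Proof.
  assert (H : (sum_n (fun n => eps * (/ 2) ^ (S n))%R N = eps * (1 - (/ 2) ^ (S N)))%R).
  { induction N as [|N IH].
    - rewrite sum_O. simpl. field.
    - rewrite sum_Sn, IH. change (eps * (1 - (/ 2) ^ S N) + eps * (/ 2) ^ S (S N) = eps * (1 - (/ 2) ^ S (S N)))%R.
      simpl. field. }
  assert (0 <= (/ 2) ^ (S N))%R by (apply pow_le; lra). nra.
Qed.

(** Heine-Borel by bisection: each point has a neighbourhood inside one enlarged rectangle, so
    finitely many of these carry the area of the square, measured by the additive lengths [overlap].
    With [e = d^2 / 4] this would give [d^2 <= 2 e]. *)
Lemma null_set_no_square A x0 y0 d : null_set A -> (0 < d)%R ->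
  (forall s, (x0 <= Re s <= x0 + d)%R -> (y0 <= Im s <= y0 + d)%R -> A s) -> False.
Proof.
  intros HA Hd Hsq.
  set (e := (d * d / 4)%R). assert (He : (0 < e)%R) by (unfold e; nra).
  destruct (HA (mkposreal e He)) as [a [b [c [f [Hord [Hcov Hsum]]]]]].
  (* Moving all four sides outwards by [eta n <= 1] adds at most
     [eta n * (2 * (width + height + 2))] to the area, hence at most [e / 2^(n+1)], and these sum to
     at most [e]. *)
  set (eta := fun n => Rmin 1 (e * (/ 2) ^ (S n) / (2 * ((b n - a n) + (f n - c n) + 2)))).
  assert (Hp : forall n, (0 < (/ 2) ^ (S n))%R) by (intros; apply pow_lt; lra).
  assert (Heta : forall n, (0 < eta n <= 1)%R).
  { intros n. destruct (Hord n). split; [|apply Rmin_l]. apply Rmin_pos; [lra|].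
    apply Rdiv_lt_0_compat; [|lra]. apply Rmult_lt_0_compat; auto. }
  assert (Harea : forall n, ((b n + eta n - (a n - eta n)) * (f n + eta n - (c n - eta n)) <= (b n - a n) * (f n - c n) + e * (/ 2) ^ (S n))%R).
  { intros n. destruct (Hord n). specialize (Heta n).
    assert (T : (eta n * (2 * ((b n - a n) + (f n - c n) + 2)) <= e * (/ 2) ^ (S n))%R).
    { apply Rle_trans with (e * (/ 2) ^ (S n) / (2 * ((b n - a n) + (f n - c n) + 2)) * (2 * ((b n - a n) + (f n - c n) + 2)))%R.
      - apply Rmult_le_compat_r; [lra|apply Rmin_r].
      - right; field; lra. }
    nra. }
  set (cell := fun x y z w n => (overlap x y (a n - eta n) (b n + eta n) * overlap z w (c n - eta n) (f n + eta n))%R).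
  assert (Hcell : forall x y z w n, (0 <= cell x y z w n)%R) by (intros; apply Rmult_le_pos; apply overlap_nonneg).
  destruct (bisection (fun x y z w => exists N, ((y - x) * (w - z) <= sum_n (cell x y z w) N)%R)) with (A := x0) (B := (x0 + d)%R) (C := y0) (D := (y0 + d)%R) as [N HN].
  - intros x y z w Hxy Hzw [N1 H1] [N2 H2] [N3 H3] [N4 H4].
    exists (max (max N1 N2) (max N3 N4)).
    set (N := max (max N1 N2) (max N3 N4)). set (m := ((x + y) / 2)%R) in *. set (n := ((z + w) / 2)%R) in *.
    assert (E : sum_n (cell x y z w) N = (sum_n (cell x m z n) N + sum_n (cell m y z n) N + (sum_n (cell x m n w) N + sum_n (cell m y n w) N))%R).
    { rewrite <- !sum_n_plus_R. apply sum_n_ext. intros i. unfold cell.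
      destruct (Hord i). specialize (Heta i). rewrite (overlap_add x y), (overlap_add z w) by lra. fold m n.
      match goal with |- @eq _ ?p ?q => change (@eq R p q) end. ring. }
    pose proof (sum_n_mono (cell x m z n) N1 N (Hcell _ _ _ _) ltac:(lia)).
    pose proof (sum_n_mono (cell m y z n) N2 N (Hcell _ _ _ _) ltac:(lia)).
    pose proof (sum_n_mono (cell x m n w) N3 N (Hcell _ _ _ _) ltac:(lia)).
    pose proof (sum_n_mono (cell m y n w) N4 N (Hcell _ _ _ _) ltac:(lia)).
    lra.
  - lra.
  - lra.
  - intros x y Hx Hy. destruct (Hcov (x, y) (Hsq (x, y) Hx Hy)) as [n Hn]. cbn [Re Im fst snd] in Hn.
    specialize (Heta n). exists (eta n). split; [lra|].
    exists n.
    eapply Rle_trans; [|apply sum_n_ge_term, Hcell]. unfold cell.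
    rewrite !overlap_inside by lra. lra.
  - assert (T : (sum_n (cell x0 (x0 + d) y0 (y0 + d))%R N <= e + e)%R).
    { apply Rle_trans with (sum_n (fun n => (b n - a n) * (f n - c n) + e * (/ 2) ^ (S n))%R N).
      - apply sum_n_le_compat. intros n. eapply Rle_trans; [|apply Harea].
        destruct (Hord n). specialize (Heta n).
        apply Rmult_le_compat; try apply overlap_nonneg; apply overlap_le; lra.
      - rewrite sum_n_plus_R. apply Rplus_le_compat; [apply Hsum|apply sum_n_geom_le; lra]. }
    unfold e in T. nra.
Qed.

Definition weight (sigma : R) : R := (sigma * (1 + ln (1 / sigma)))%R.

Lemma ln_inv_nonneg x : (0 < x <= 1)%R -> (0 <= ln (1 / x))%R.
Proof.
  intros H. unfold Rdiv. rewrite Rmult_1_l, ln_Rinv by lra.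
  assert (ln x <= ln 1)%R by (apply ln_le; lra). rewrite ln_1 in H0. lra.
Qed.

Lemma weight_ge x : (0 < x <= 1)%R -> (x <= weight x)%R.
Proof. intros H. pose proof (ln_inv_nonneg x H). unfold weight. nra. Qed.

Lemma weight_continuous x : (0 < x)%R -> forall eps, (0 < eps)%R -> exists d, (0 < d)%R /\
  forall y, (Rabs (y - x) < d)%R -> (Rabs (weight y - weight x) < eps)%R.
Proof.
  intros Hx eps He.
  assert (C : continuous weight x).
  { apply (ex_derive_continuous weight x). unfold weight. auto_derive. split; [lra|]. split; [|trivial].
    apply Rdiv_lt_0_compat; lra. }
  destruct (proj1 (filterlim_locally (F := locally x) weight (weight x)) C (mkposreal eps He)) as [d Hd].
  exists d; split; [apply cond_pos|]. intros y Hy. apply Hd, Hy.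
Qed.

(** For negative [M] the exceptional set contains a whole square of the strip. *)
Lemma ess_bound_nonneg (G : C -> C) (M : R) :
  null_set (fun s => strip s /\ (M < weight (Re s) * Cmod (C_derive G s))%R) -> (0 <= M)%R.
Proof.
  intros HN. apply Rnot_lt_le. intros HM.
  apply (null_set_no_square _ (1 / 4) 0 (1 / 2) HN); [lra|]. unfold strip. split; [lra|].
  pose proof (weight_ge (Re s) ltac:(lra)). pose proof (Cmod_ge_0 (C_derive G s)). nra.
Qed.

(* A point where [w |G'|] exceeds [M] has a whole square of such points to its left. *)
Lemma ess_sup_bound (G G' : C -> C) (M : R) : holo 0 G G' ->
  null_set (fun s => strip s /\ (M < weight (Re s) * Cmod (C_derive G s))%R) ->
  forall s, strip s -> (weight (Re s) * Cmod (G' s) <= M)%R.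
Proof.
  intros HG HN s Hs. apply Rnot_lt_le. intros Hlt.
  destruct (holo_deriv 0 G G' HG) as [G'' HG'].
  assert (HGd : forall z, (0 < Re z)%R -> C_derive G z = G' z) by (intros z Hz; apply cderiv_C_derive, HG, Hz).
  pose proof (ess_bound_nonneg G M HN) as HM.
  assert (Hw : (0 < weight (Re s))%R) by (pose proof (weight_ge (Re s) Hs); unfold strip in Hs; lra).
  assert (Hm : (0 < Cmod (G' s))%R).
  { pose proof (Cmod_ge_0 (G' s)). destruct (Req_dec (Cmod (G' s)) 0) as [E|E]; [rewrite E in Hlt|]; lra. }
  (* Lowering both factors of the product by [e] loses at most [e] times their sum, hence at most
     [gap], half of the excess over [M]. *)
  set (gap := ((weight (Re s) * Cmod (G' s) - M) / 2)%R).
  set (e := Rmin (Rmin (weight (Re s)) (Cmod (G' s))) (gap / (weight (Re s) + Cmod (G' s) + 1))).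
  assert (He : (0 < e)%R) by (repeat apply Rmin_pos; [lra|lra|apply Rdiv_lt_0_compat; unfold gap; lra]).
  assert (He1 : (e <= weight (Re s) /\ e <= Cmod (G' s))%R).
  { pose proof (Rmin_l (Rmin (weight (Re s)) (Cmod (G' s))) (gap / (weight (Re s) + Cmod (G' s) + 1))) as H0.
    pose proof (Rmin_l (weight (Re s)) (Cmod (G' s))). pose proof (Rmin_r (weight (Re s)) (Cmod (G' s))).
    fold e in H0. lra. }
  assert (He2 : (e * (weight (Re s) + Cmod (G' s) + 1) <= gap)%R).
  { apply Rle_trans with (gap / (weight (Re s) + Cmod (G' s) + 1) * (weight (Re s) + Cmod (G' s) + 1))%R.
    - apply Rmult_le_compat_r; [lra|apply Rmin_r].
    - right; field; lra. }
  destruct (cderiv_cont G' s _ (HG' s (proj1 Hs)) e He) as [d1 [Hd1 H1]].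
  destruct (weight_continuous (Re s) (proj1 Hs) e He) as [d2 [Hd2 H2]].
  set (d := (Rmin (Rmin d1 d2) (Re s) / 4)%R).
  assert (Hd : (0 < d /\ 4 * d <= d1 /\ 4 * d <= d2 /\ 4 * d <= Re s)%R).
  { unfold d. unfold strip in Hs. pose proof (Rmin_l (Rmin d1 d2) (Re s)). pose proof (Rmin_r (Rmin d1 d2) (Re s)).
    pose proof (Rmin_l d1 d2). pose proof (Rmin_r d1 d2).
    assert (0 < Rmin (Rmin d1 d2) (Re s))%R by (repeat apply Rmin_pos; lra). lra. }
  (* The abscissas stay at most [Re s], so the square remains in [strip] even if [Re s = 1]. *)
  apply (null_set_no_square _ (Re s - d) (Im s) d HN); [lra|].
  intros z Hz1 Hz2. unfold strip in *. split; [lra|]. rewrite HGd by lra.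
  assert (Hz3 : (Cmod (z - s) < d1)%R).
  { apply Rle_lt_trans with (d + d)%R; [|lra]. eapply Rle_trans; [apply Cmod_le_sum|]. rewrite re_sub, im_sub.
    apply Rplus_le_compat; apply Rabs_le; lra. }
  specialize (H1 z Hz3). specialize (H2 (Re z) ltac:(apply Rabs_def1; lra)). apply Rabs_def2 in H2.
  assert (Hz4 : (Cmod (G' s) - e <= Cmod (G' z))%R).
  { pose proof (Cmod_le_sub (G' s) (G' z)). rewrite (Cmod_sub_sym (G' s)) in H. lra. }
  assert (K : ((weight (Re s) - e) * (Cmod (G' s) - e) <= weight (Re z) * Cmod (G' z))%R).
  { apply Rmult_le_compat; lra. }
  unfold gap in *. nra.
Qed.

(* In the coordinate [x = exp (- tau)] a Bloch function is Lipschitz along horizontal lines. *)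
Lemma bloch_log_growth f f' M s : holo 0 f f' ->
  (forall s, (0 < Re s)%R -> (Re s * Cmod (f' s) <= M)%R) -> (0 < Re s <= 1)%R ->
  (Cmod (f s - f (1%R, Im s)) <= M * ln (1 / Re s))%R.
Proof.
  intros Hf HM Hs. destruct (holo_deriv 0 f f' Hf) as [f'' Hf'].
  pose proof (path_mvt (fun t => f (exp (- t), Im s)) (fun t => f' (exp (- t), Im s) * (- exp (- t), 0)%R) 0 (ln (1 / Re s)) M) as K.
  cbv beta in K. rewrite Ropp_0, exp_0, Rminus_0_r in K.
  replace (exp (- ln (1 / Re s))) with (Re s) in K.
  2:{ rewrite exp_Ropp, exp_ln by (apply Rdiv_lt_0_compat; lra). field; lra. }
  rewrite <- C_pair in K.
  assert (P : forall t, rderiv (fun t => (exp (- t), Im s)) t (- exp (- t), 0)%R).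
  { intros t. apply (rderiv_is_derive_pair (fun t => exp (- t)) (fun _ => Im s)).
    - auto_derive; [trivial|ring].
    - auto_derive; [trivial|ring]. }
  apply K.
  - apply ln_inv_nonneg, Hs.
  - intros t _. apply (cderiv_rderiv_comp f (fun t => (exp (- t), Im s))); [apply P|apply Hf, exp_pos].
  - intros t _. apply rdiff_mult.
    + apply (rdiff_comp f' (fun t => (exp (- t), Im s)) t (f'' (exp (- t), Im s)));
       [apply Hf', exp_pos|eexists; apply P].
    + apply (rdiff_ext (fun t => (- (1)) * ((exp (- t), 0%R) : C))).
      * intros x. apply injective_projections; simpl; ring.
      * apply rdiff_scal. eexists. apply (rderiv_is_derive_pair (fun t => exp (- t)) (fun _ => 0%R)).
        -- auto_derive; [trivial|reflexivity].
        -- auto_derive; [trivial|reflexivity].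
  - intros t _. rewrite Cmod_mult. change ((- exp (- t), 0)%R) with (RtoC (- exp (- t))).
    rewrite Cmod_R, Rabs_Ropp, Rabs_pos_eq by (left; apply exp_pos).
    specialize (HM (exp (- t), Im s) (exp_pos _)). cbn [Re fst] in HM. lra.
Qed.

(** * Growth of Bloch functions with a Dirichlet series *)

Section BlochGrowth.
Variables (a : nat -> C) (f f' : C -> C) (M : R).
Hypothesis Hf : holo 0 f f'.
Hypothesis Hrep : represents a f.
Hypothesis HM : forall s, (0 < Re s)%R -> (Re s * Cmod (f' s) <= M)%R.
Hypothesis H1 : (Cmod (f 1) <= M)%R.

Lemma bloch_deriv_right s : (1 <= Re s)%R -> (Cmod (f' s) <= M)%R.
Proof. intros Hs. specialize (HM s ltac:(lra)). pose proof (Cmod_ge_0 (f' s)). nra. Qed.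

Lemma bloch_coef_0 : (Cmod (a 0%nat) <= 6 * M)%R.
Proof.
  destruct (dirichlet_growth a f f' M Hf Hrep bloch_deriv_right) as [_ [_ H]].
  specialize (H 1 ltac:(simpl; lra)). pose proof (Cmod_le_sub (a 0%nat) (f 1)) as T.
  rewrite (Cmod_sub_sym (a 0%nat)) in T. lra.
Qed.

(** [11] is [5] from the growth of [f - a 0] plus [6] from the constant coefficient, itself compared
    with [f 1]. *)
Lemma bloch_growth_right s : (1 <= Re s)%R -> (Cmod (f s) <= 11 * M)%R.
Proof.
  intros Hs. destruct (dirichlet_growth a f f' M Hf Hrep bloch_deriv_right) as [_ [_ H]].
  specialize (H s Hs). pose proof bloch_coef_0. pose proof (Cmod_le_sub (f s) (a 0%nat)). lra.
Qed.

Lemma bloch_growth_left s : (0 < Re s <= 1)%R -> (Cmod (f s) <= 11 * M * (1 + ln (1 / Re s)))%R.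
Proof.
  intros Hs. pose proof (bloch_log_growth f f' M s Hf HM Hs) as H.
  pose proof (bloch_growth_right (1%R, Im s) ltac:(cbn; lra)).
  pose proof (Cmod_le_sub (f s) (f (1%R, Im s))). pose proof (ln_inv_nonneg _ Hs).
  pose proof (Cmod_ge_0 (f 1)). nra.
Qed.

(* The logarithmic growth of [f] is what turns [Re s] into [weight (Re s)]. *)
Lemma bloch_mult_bound G' B s : (forall s, (0 < Re s <= 1)%R -> (weight (Re s) * Cmod (G' s) <= B)%R) ->
  (forall s, (1 <= Re s)%R -> (Re s * Cmod (G' s) <= B)%R) -> (0 < Re s)%R ->
  (Re s * Cmod (f s * G' s) <= 11 * M * B)%R.
Proof.
  intros HB1 HB2 Hs. rewrite Cmod_mult. pose proof (Cmod_ge_0 (G' s)) as HG. pose proof (Cmod_ge_0 (f 1)).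
  destruct (Rle_or_lt (Re s) 1) as [Hl|Hl].
  - specialize (HB1 s ltac:(lra)). pose proof (bloch_growth_left s ltac:(lra)) as Hg.
    apply Rle_trans with (Re s * (11 * M * (1 + ln (1 / Re s)) * Cmod (G' s)))%R.
    + apply Rmult_le_compat_l; [lra|]. apply Rmult_le_compat_r; lra.
    + replace (Re s * (11 * M * (1 + ln (1 / Re s)) * Cmod (G' s)))%R with (11 * M * (weight (Re s) * Cmod (G' s)))%R by (unfold weight; ring).
      apply Rmult_le_compat_l; lra.
  - specialize (HB2 s ltac:(lra)). pose proof (bloch_growth_right s ltac:(lra)) as Hg.
    apply Rle_trans with (Re s * (11 * M * Cmod (G' s)))%R.
    + apply Rmult_le_compat_l; [lra|]. apply Rmult_le_compat_r; lra.
    + replace (Re s * (11 * M * Cmod (G' s)))%R with (11 * M * (Re s * Cmod (G' s)))%R by ring.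
      apply Rmult_le_compat_l; lra.
Qed.

End BlochGrowth.

(** Both summands of the norm are first bounded below, because [Rbar_plus] of opposite infinities is
    a default real value and finiteness of the sum alone would not separate them. *)
Lemma bloch_w_norm_finite G : Rbar_lt (bloch_w_norm weight G) p_infty ->
  exists M B : R, null_set (fun s => strip s /\ (M < weight (Re s) * Cmod (C_derive G s))%R) /\
   forall s, (1 < Re s)%R -> (Cmod (G s) <= B)%R.
Proof.
  unfold bloch_w_norm. intros H.
  pose proof (sup_on_ge (half_plane 1) (fun s => Cmod (G s))) as HS.
  set (S := sup_on (half_plane 1) (fun s => Cmod (G s))) in *.
  set (E := ess_sup_on strip (fun s => (weight (Re s) * Cmod (C_derive G s))%R)) in *.
  destruct (Glb_Rbar_correct (fun M : R => null_set (fun s => strip s /\ (M < weight (Re s) * Cmod (C_derive G s))%R))) as [G1 G2].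
  assert (HE0 : Rbar_le 0 E).
  { apply G2. intros M HM. apply (ess_bound_nonneg G M HM). }
  assert (HS0 : exists x : R, Rbar_le x S).
  { exists (Cmod (G 2)). apply HS. unfold half_plane; simpl; lra. }
  destruct HS0 as [x0 HS0].
  assert (HEf : exists e : R, E = Finite e).
  { destruct E as [e| |]; [exists e; reflexivity| |simpl in HE0; contradiction].
    destruct S; simpl in *; contradiction. }
  destruct HEf as [e HEf].
  assert (HSf : exists y : R, S = Finite y).
  { rewrite HEf in H. destruct S as [y| |]; [exists y; reflexivity| |]; simpl in *; contradiction. }
  destruct HSf as [y HSf].
  (* An empty set of essential bounds would have infimum [p_infty]. *)
  assert (HX : exists M, null_set (fun s => strip s /\ (M < weight (Re s) * Cmod (C_derive G s))%R)).
  { apply NNPP. intros N. assert (Rbar_le p_infty E).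
    { apply G2. intros M HM. apply N. exists M. exact HM. }
    rewrite HEf in H0. exact H0. }
  destruct HX as [M HM]. exists M, y. split; [exact HM|].
  intros s Hs. specialize (HS s Hs). rewrite HSf in HS. exact HS.
Qed.

(** For [Re s >= 1], Cauchy's estimate on a disc of radius [Re s - 1 / 2] yields decay like
    [1 / Re s], as [Re s <= 2 (Re s - 1 / 2)]. It rests on a bound of [G] on [Re s >= 1 / 2],
    obtained from the strip. *)
Lemma bloch_w_deriv_bounds G : Bloch_w weight G -> exists B : R,
  (forall s, (0 < Re s <= 1)%R -> (weight (Re s) * Cmod (C_derive G s) <= B)%R) /\
  (forall s, (1 <= Re s)%R -> (Re s * Cmod (C_derive G s) <= B)%R).
Proof.
  intros [HA Hn]. pose proof (bloch_holo G HA) as HG.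
  destruct (bloch_w_norm_finite G Hn) as [M [B [HM HB]]].
  pose proof (ess_bound_nonneg G M HM) as HM0.
  assert (HB0 : (0 <= B)%R).
  { eapply Rle_trans; [apply Cmod_ge_0|apply (HB 2)]. simpl; lra. }
  assert (K1 : forall s, (0 < Re s <= 1)%R -> (weight (Re s) * Cmod (C_derive G s) <= M)%R).
  { intros s Hs. apply (ess_sup_bound G (C_derive G) M HG HM s Hs). }
  (* On [1 / 2 <= Re s <= 1] the weight is at least [1 / 2], so the derivative is at most [2 * M];
     the extra [1] passes by continuity from [Re s > 1] to the line [Re s = 1]. *)
  assert (K2 : forall s, (1 / 2 <= Re s)%R -> (Cmod (G s) <= 2 * M + B + 1)%R).
  { intros s Hs. destruct (Rlt_or_le 1 (Re s)) as [Hl|Hl]; [specialize (HB s Hl); lra|].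
    set (p := (1%R, Im s) : C).
    assert (Gp : (Cmod (G p) <= B + 1)%R).
    { destruct (cderiv_cont G p _ (HG p ltac:(unfold p; cbn; lra)) 1 Rlt_0_1) as [d [Hd Hc]].
      specialize (Hc (p + RtoC (d / 2))). specialize (HB (p + RtoC (d / 2))).
      replace (p + RtoC (d / 2) - p) with (RtoC (d / 2)) in Hc by ring.
      rewrite Cmod_R, Rabs_pos_eq in Hc by lra. rewrite re_plus, re_RtoC in HB. unfold p at 1 in HB. cbn [Re fst] in HB.
      pose proof (Cmod_le_sub (G p) (G (p + RtoC (d / 2)))) as T. rewrite (Cmod_sub_sym (G p)) in T. lra. }
    assert (T : (Cmod (G s - G p) <= 2 * M * Cmod (s - p))%R).
    { apply (segment_mvt 0 G (C_derive G)); [exact HG|unfold p; cbn; lra|lra|]. intros t Ht.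
      set (z := p + (s - p) * RtoC t).
      assert (Hz : (1 / 2 <= Re z <= 1)%R).
      { unfold z. rewrite re_plus, re_scal_r, re_sub. unfold p; cbn [Re fst]. nra. }
      specialize (K1 z ltac:(lra)). pose proof (weight_ge (Re z) ltac:(lra)). nra. }
    assert (D : (Cmod (s - p) <= 1)%R).
    { replace (s - p) with (RtoC (Re s - 1)).
      - rewrite Cmod_R, Rabs_left1; lra.
      - unfold p. apply injective_projections; unfold Re, Im; simpl; ring. }
    pose proof (Cmod_le_sub (G s) (G p)). nra. }
  exists (Rmax M (2 * (2 * M + B + 1))). split.
  - intros s Hs. eapply Rle_trans; [apply K1, Hs|apply Rmax_l].
  - intros s Hs. eapply Rle_trans; [|apply Rmax_r].
    assert (Hr : (0 < Re s - 1 / 2)%R) by lra.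
    pose proof (cauchy_estimate 0 G (C_derive G) HG s (Re s - 1 / 2) (2 * M + B + 1) Hr ltac:(lra)) as E.
    assert (E' : (Cmod (C_derive G s) <= (2 * M + B + 1) / (Re s - 1 / 2))%R).
    { apply E. intros w Hw. apply K2. pose proof (re_le_Cmod (w - s)) as T. rewrite re_sub in T. apply Rabs_le_between in T. lra. }
    apply (Rmult_le_compat_l (Re s - 1 / 2)) in E'; [|lra].
    replace ((Re s - 1 / 2) * ((2 * M + B + 1) / (Re s - 1 / 2)))%R with (2 * M + B + 1)%R in E' by (field; lra).
    nra.
Qed.

Lemma Bloch_D_data f : Bloch_D f -> exists a M, represents a f /\ holo 0 f (C_derive f) /\ Rbar_le (bloch_norm f) (Finite M).
Proof.
  intros [[HA Hn] [a Ha]]. destruct (bloch_norm_finite f Hn) as [M HM].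
  exists a, M. split; [exact Ha|]. split; [apply bloch_holo, HA|exact HM].
Qed.

Lemma volterra_maps_Bloch_D g G f : represents g G -> Bloch_w weight G -> Bloch_D f ->
  exists h, Bloch_D h /\ volterra g f h.
Proof.
  intros Rg HG Hf. destruct (Bloch_D_data f Hf) as [a [M [Ra [Hfh HM]]]].
  apply bloch_norm_le_inv in HM. destruct HM as [HM1 HM2].
  destruct (bloch_w_deriv_bounds G HG) as [B [HB1 HB2]].
  destruct (volterra_exists g G (C_derive G) a f (C_derive f) (bloch_holo G (proj1 HG)) Rg Hfh Ra) as [h [c [Hh [Rc [_ Vh]]]]].
  exists h. split; [|exact Vh]. split; [split|exists c; exact Rc].
  - apply (cderiv_analytic _ _ _ Hh).
  - assert (T : Rbar_le (bloch_norm h) (11 * M * B + Cmod (h 1))%R).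
    { apply bloch_norm_le; [|lra]. intros s Hs. rewrite (cderiv_C_derive h s _ (Hh s Hs)).
      apply (bloch_mult_bound a f (C_derive f) M); auto. }
    destruct (bloch_norm h); simpl in *; auto.
Qed.

(** * Montel's theorem for Bloch functions with a Dirichlet series *)

Definition incr (phi : nat -> nat) : Prop := forall k, (phi k < phi (S k))%nat.

Lemma incr_lt phi : incr phi -> forall m n, (m < n)%nat -> (phi m < phi n)%nat.
Proof. intros H m n Hmn. induction Hmn as [|n Hmn IH]; [apply H|]. specialize (H n). lia. Qed.

Lemma incr_ge phi : incr phi -> forall n, (n <= phi n)%nat.
Proof. induction n as [|n IH]; [lia|]. specialize (H n). lia. Qed.

Lemma incr_comp phi psi : incr phi -> incr psi -> incr (fun k => phi (psi k)).
Proof. intros H1 H2 k. apply incr_lt; auto. Qed.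

(** Each index is picked beyond the previous one and within [1 / (k + 1)] of an adherent value of
    the sequence. *)
Lemma real_subsequence (v : nat -> R) B : (forall k, (Rabs (v k) <= B)%R) ->
  exists psi, incr psi /\ exists l, forall eps, (0 < eps)%R -> exists N, forall k, (N <= k)%nat -> (Rabs (v (psi k) - l) < eps)%R.
Proof.
  intros HB.
  destruct (Bolzano_Weierstrass v (fun x => (- B <= x <= B)%R) (compact_P3 (- B) B)) as [l Hl].
  { intros n. apply Rabs_le_between, HB. }
  set (P := fun N k p => (N <= p)%nat /\ (Rabs (v p - l) < / INR (S k))%R).
  assert (HP : forall N k, exists p, P N k p).
  { intros N k. destruct (Hl (fun x => (Rabs (x - l) < / INR (S k))%R) N) as [p Hp].
    - exists (mkposreal _ (Rinv_0_lt_compat _ (INR_S_pos k))). intros x Hx. exact Hx.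
    - exists p. exact Hp. }
  set (pick := fun N k => epsilon (inhabits 0%nat) (P N k)).
  assert (Hpick : forall N k, P N k (pick N k)) by (intros; apply epsilon_spec, HP).
  set (psi := fix psi k := match k with O => pick 0%nat 0%nat | S j => pick (S (psi j)) (S j) end).
  exists psi. split.
  - intros k. change (psi (S k)) with (pick (S (psi k)) (S k)). destruct (Hpick (S (psi k)) (S k)). lia.
  - exists l. intros eps He. destruct (archimed_cor1 eps He) as [N [HN1 HN2]]. exists N. intros k Hk.
    assert (Hv : (Rabs (v (psi k) - l) < / INR (S k))%R).
    { destruct k as [|k]; [apply (Hpick 0%nat 0%nat)|apply (Hpick (S (psi k)) (S k))]. }
    apply Rlt_trans with (1 := Hv). apply Rle_lt_trans with (2 := HN1).
    apply Rinv_le_contravar; [apply lt_0_INR; lia|apply le_INR; lia].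
Qed.

Lemma complex_subsequence (u : nat -> C) B : (forall k, (Cmod (u k) <= B)%R) ->
  exists psi, incr psi /\ exists l, clim (fun k => u (psi k)) l.
Proof.
  intros HB.
  destruct (real_subsequence (fun k => Re (u k)) B) as [p [Hp [x Hx]]].
  { intros k. eapply Rle_trans; [apply re_le_Cmod|apply HB]. }
  destruct (real_subsequence (fun k => Im (u (p k))) B) as [q [Hq [y Hy]]].
  { intros k. eapply Rle_trans; [apply Cmod_im_le|apply HB]. }
  exists (fun k => p (q k)). split; [apply incr_comp; auto|]. exists (x, y). intros eps He.
  destruct (Hx (eps / 2)%R ltac:(lra)) as [N1 H1]. destruct (Hy (eps / 2)%R ltac:(lra)) as [N2 H2].
  exists (max N1 N2). intros n Hn. pose proof (incr_ge q Hq n).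
  specialize (H1 (q n) ltac:(lia)). specialize (H2 n ltac:(lia)).
  eapply Rle_trans; [apply Cmod_le_sum|]. rewrite re_sub, im_sub. cbn [Re Im fst snd]. lra.
Qed.

Lemma diagonal_subsequence (u : nat -> nat -> C) (B : nat -> R) : (forall n k, (Cmod (u n k) <= B n)%R) ->
  exists phi, incr phi /\ forall n, exists l, clim (fun k => u n (phi k)) l.
Proof.
  intros HB.
  set (P := fun n (phi psi : nat -> nat) => incr psi /\ exists l, clim (fun k => u n (phi (psi k))) l).
  assert (HP : forall n phi, exists psi, P n phi psi).
  { intros n phi. apply (complex_subsequence (fun k => u n (phi k)) (B n)). intros; apply HB. }
  set (E := fun n phi => epsilon (inhabits (fun k : nat => k)) (P n phi)).
  assert (HE : forall n phi, P n phi (E n phi)) by (intros; apply epsilon_spec, HP).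
  set (F := fix F (j : nat) : nat -> nat := match j with O => fun k => k | S i => fun k => F i (E i (F i) k) end).
  assert (FS : forall j k, F (S j) k = F j (E j (F j) k)) by reflexivity.
  assert (Fincr : forall j, incr (F j)).
  { induction j as [|j IH]; [intros k; simpl; lia|].
    change (incr (fun k => F j (E j (F j) k))). apply incr_comp; [exact IH|apply HE]. }
  exists (fun k => F k k). split.
  - intros k. rewrite FS. apply incr_lt; [apply Fincr|].
    pose proof (incr_ge _ (proj1 (HE k (F k))) (S k)). lia.
  - intros n. destruct (HE n (F n)) as [Hpsi [l Hl]]. exists l.
    (* [F k] refines [F (S n)] as soon as [k > n], so from then on the diagonal runs through a
       sequence along which row [n] converges, at positions at least [k]. *)
    assert (Htail : forall d k, exists m, (k <= m)%nat /\ F (d + S n)%nat k = F (S n) m).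
    { induction d as [|d IH]; intros k; [exists k; auto|].
      destruct (IH (E (d + S n)%nat (F (d + S n)%nat) k)) as [m [Hm1 Hm2]]. exists m. split; [|exact Hm2].
      pose proof (incr_ge _ (proj1 (HE (d + S n)%nat (F (d + S n)%nat))) k). lia. }
    intros eps He. destruct (Hl eps He) as [N HN]. exists (max N (S n)). intros k Hk.
    destruct (Htail (k - S n)%nat k) as [m [Hm1 Hm2]].
    replace (k - S n + S n)%nat with k in Hm2 by lia. rewrite Hm2, FS. apply HN. lia.
Qed.

Lemma represents_ext a f g : (forall s, f s = g s) -> represents a f -> represents a g.
Proof. intros E [t H]. exists t. intros s Hs. rewrite <- E. apply H, Hs. Qed.

Lemma represents_linear (c : C) a b f g : represents a f -> represents b g ->
  represents (fun n => a n + c * b n) (fun s => f s + c * g s).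
Proof.
  intros [t1 H1] [t2 H2]. exists (Rmax t1 t2). intros s Hs. unfold half_plane in *.
  max_bounds.
  specialize (H1 s ltac:(lra)). specialize (H2 s ltac:(lra)).
  apply is_series_clim in H1. apply is_series_clim in H2. apply is_series_clim.
  apply (clim_ext (fun N => csum (dirichlet_term a s) N + c * csum (dirichlet_term b s) N)).
  - intros N. rewrite <- csum_scal, <- csum_plus. apply csum_ext. intros n _. rewrite !dirichlet_term_dexp. ring.
  - apply clim_plus; [|apply clim_scal]; assumption.
Qed.

Section Montel.
Variables (a : nat -> nat -> C) (F F' : nat -> C -> C) (M : R).
Hypothesis HF : forall k, holo 0 (F k) (F' k).
Hypothesis Hrep : forall k, represents (a k) (F k).
Hypothesis HM : forall k s, (0 < Re s)%R -> (Re s * Cmod (F' k s) <= M)%R.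
Hypothesis H1 : forall k, (Cmod (F k 1) <= M)%R.

Let Hgrowth k := dirichlet_growth (a k) (F k) (F' k) M (HF k) (Hrep k) (bloch_deriv_right (F' k) M (HM k)).

Lemma montel_M_nonneg : (0 <= M)%R.
Proof. eapply Rle_trans; [apply Cmod_ge_0|apply (H1 0%nat)]. Qed.

Lemma montel_bound d : (0 < d <= 1)%R -> forall k s, (d <= Re s)%R -> (Cmod (F k s) <= 11 * M * (1 + ln (1 / d)))%R.
Proof.
  intros Hd k s Hs. pose proof montel_M_nonneg. pose proof (ln_inv_nonneg d Hd).
  destruct (Rle_or_lt (Re s) 1).
  - eapply Rle_trans; [apply (bloch_growth_left (a k) (F k) (F' k) M); auto; lra|].
    apply Rmult_le_compat_l; [lra|]. apply Rplus_le_compat_l. apply ln_le; [apply Rdiv_lt_0_compat; lra|].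
    unfold Rdiv. rewrite !Rmult_1_l. apply Rinv_le_contravar; lra.
  - eapply Rle_trans; [apply (bloch_growth_right (a k) (F k) (F' k) M); auto; lra|]. nra.
Qed.

Variable al : nat -> C.
Hypothesis Hal : forall n, clim (fun k => a k n) (al n).

Lemma montel_partial P : forall eps, (0 < eps)%R -> exists N, forall k s, (N <= k)%nat -> (0 <= Re s)%R ->
  (Cmod (csum (dirichlet_term (a k) s) P - csum (dirichlet_term al s) P) <= eps)%R.
Proof.
  induction P as [|P IH]; intros eps He.
  - exists 0%nat. intros k s _ _. simpl. replace (0 - 0) with (RtoC 0) by ring. rewrite Cmod_0; lra.
  - destruct (IH (eps / 2)%R ltac:(lra)) as [N1 HN1]. destruct (Hal P (eps / 2)%R ltac:(lra)) as [N2 HN2].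
    exists (max N1 N2). intros k s Hk Hs. specialize (HN1 k s ltac:(lia) Hs). specialize (HN2 k ltac:(lia)).
    simpl csum. rewrite !dirichlet_term_dexp.
    pose proof (Cmod_split (csum (dirichlet_term (a k) s) P + a k P * dexp P s - (csum (dirichlet_term al s) P + al P * dexp P s))
      (csum (dirichlet_term (a k) s) P - csum (dirichlet_term al s) P) ((a k P - al P) * dexp P s) ltac:(ring)) as T.
    assert (T2 : (Cmod ((a k P - al P) * dexp P s) <= eps / 2 * 1)%R).
    { apply Cmod_mult_le; [exact HN2|]. rewrite Cmod_dexp. apply Rle_trans with (exp 0); [|rewrite exp_0; lra].
      apply exp_le_compat. pose proof (lnS_pos P). nra. }
    lra.
Qed.

Lemma montel_coef_bound : poly_bounded al (2 * M) 1.
Proof.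
  intros n Hn. apply (clim_Cmod_le (fun k => a k n)); [apply Hal|]. exists 0%nat. intros k _.
  apply (Hgrowth k), Hn.
Qed.

(** Tails beyond [P] are at most [2 * M / P] for every [k] and for the limit alike, thanks to the
    common coefficient bound; the first [P] terms converge uniformly because the exponentials have
    modulus at most [1]. *)
Lemma montel_right : forall eps, (0 < eps)%R -> exists N, forall k s, (N <= k)%nat -> (4 <= Re s)%R ->
  (Cmod (F k s - dirichlet_sum al s) <= eps)%R.
Proof.
  intros eps He. pose proof montel_M_nonneg as HM0.
  destruct (inv_INR_small (2 * M) (eps / 4)) as [P [HP1 HP]]; [lra|lra|]. specialize (HP P (le_n _)).
  destruct (montel_partial P (eps / 2)%R ltac:(lra)) as [N HN]. exists N. intros k s Hk Hs.
  destruct (Hgrowth k) as [Hpb [Heq _]]. rewrite Heq by lra.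
  destruct (dirichlet_sum_facts (a k) (2 * M) 1 Hpb s ltac:(lra)) as [_ [_ T1]]. specialize (T1 P ltac:(lia)).
  destruct (dirichlet_sum_facts al (2 * M) 1 montel_coef_bound s ltac:(lra)) as [_ [_ T2]]. specialize (T2 P ltac:(lia)).
  specialize (HN k s Hk ltac:(lra)).
  pose proof (Cmod_sub_split (dirichlet_sum (a k) s) (csum (dirichlet_term (a k) s) P) (dirichlet_sum al s)) as T3.
  pose proof (Cmod_sub_split (csum (dirichlet_term (a k) s) P) (csum (dirichlet_term al s) P) (dirichlet_sum al s)) as T4.
  rewrite (Cmod_sub_sym (csum (dirichlet_term al s) P)) in T4. lra.
Qed.

(* Discs centred on [Re s = 6] carry the convergence from [Re s >= 4] to the left. *)
Lemma montel_cauchy d : (0 < d <= 1)%R -> forall eps, (0 < eps)%R -> exists N, forall j k s,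
  (N <= j)%nat -> (N <= k)%nat -> (d <= Re s)%R -> (Cmod (F j s - F k s) <= eps)%R.
Proof.
  intros Hd eps He.
  set (B := (2 * (11 * M * (1 + ln (1 / (d / 2)))))%R).
  assert (HB : (0 <= B)%R).
  { unfold B. pose proof montel_M_nonneg. pose proof (ln_inv_nonneg (d / 2) ltac:(lra)).
    assert (0 <= 11 * M * (1 + ln (1 / (d / 2))))%R by (apply Rmult_le_pos; lra). lra. }
  (* For a centre on [Re s = 6], the circle of radius [1] lies in [Re s >= 4], the disc of radius
     [6 - d] reaches abscissa [d], and the circle of radius [6 - d / 2] stays in [Re s >= d / 2],
     where all functions share the bound [B / 2]. *)
  destruct (small_on_larger_disc B 1 (6 - d) (6 - d / 2) eps HB) as [eta [Heta K]]; [lra|lra|exact He|].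
  set (e := Rmin eta eps). assert (Hmin : (e <= eta /\ e <= eps)%R) by (split; [apply Rmin_l|apply Rmin_r]).
  assert (Hep : (0 < e)%R) by (apply Rmin_pos; lra).
  destruct (montel_right (e / 2)%R ltac:(lra)) as [N HN]. exists N. intros j k s Hj Hk Hs.
  assert (Hright : forall z, (4 <= Re z)%R -> (Cmod (F j z - F k z) <= e)%R).
  { intros z Hz. pose proof (HN j z Hj Hz) as T1. pose proof (HN k z Hk Hz) as T2. rewrite Cmod_sub_sym in T2.
    pose proof (Cmod_sub_split (F j z) (dirichlet_sum al z) (F k z)). lra. }
  destruct (Rle_or_lt 4 (Re s)) as [Hs4|Hs4]; [specialize (Hright s Hs4); lra|].
  set (c := (6%R, Im s) : C).
  assert (Hcirc : forall r t, (0 <= r)%R -> (6 - r <= Re (c + circ r t))%R).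
  { intros r t Hr. rewrite re_plus. pose proof (re_le_Cmod (circ r t)) as T. rewrite Cmod_circ in T by exact Hr.
    apply Rabs_le_between in T. unfold c; cbn [Re fst]. lra. }
  replace s with (c + (s - c)) by ring.
  apply (K 0%R (fun z => F j z - F k z) (fun z => F' j z - F' k z)).
  - apply holo_minus; auto.
  - unfold c; cbn [Re fst]; lra.
  - intros t _. unfold B, Cminus. eapply Rle_trans; [apply Cmod_triangle|]. rewrite Cmod_opp.
    assert (Hc : (d / 2 <= Re (c + circ (6 - d / 2) t))%R) by (pose proof (Hcirc (6 - d / 2)%R t ltac:(lra)); lra).
    pose proof (montel_bound (d / 2) ltac:(lra) j _ Hc). pose proof (montel_bound (d / 2) ltac:(lra) k _ Hc). lra.
  - intros t _. apply Rle_trans with e; [|lra]. apply Hright. pose proof (Hcirc 1%R t ltac:(lra)). lra.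
  - replace (s - c) with (RtoC (Re s - 6)).
    + rewrite Cmod_R, Rabs_left1; lra.
    + apply injective_projections; unfold c, Re, Im; simpl; ring.
Qed.

Lemma montel_limit : exists f f', holo 0 f f' /\ represents al f /\
  (forall s, (0 < Re s)%R -> (Re s * Cmod (f' s) <= M)%R) /\ (Cmod (f 1) <= M)%R /\
  forall d, (0 < d <= 1)%R -> forall eps, (0 < eps)%R -> exists N, forall k s,
    (N <= k)%nat -> (d <= Re s)%R -> (Cmod (F k s - f s) <= eps)%R.
Proof.
  set (f := fun s => epsilon (inhabits (RtoC 0)) (fun l => clim (fun k => F k s) l)).
  assert (Hf : forall s, (0 < Re s)%R -> clim (fun k => F k s) (f s)).
  { intros s Hs. apply epsilon_spec. apply clim_cauchy. intros eps He.
    assert (Hd : (0 < Rmin (Re s) 1 <= 1)%R) by (split; [apply Rmin_pos; lra|apply Rmin_r]).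
    destruct (montel_cauchy _ Hd eps He) as [N HN]. exists N. intros m n Hm Hn. apply HN; auto. apply Rmin_l. }
  destruct (weierstrass 0 F F' f HF) as [f' [Hf1 Hf2]].
  - intros c Hc. set (d := Rmin (Re c / 2) 1).
    assert (Hd : (0 < d <= 1)%R) by (split; [apply Rmin_pos; lra|apply Rmin_r]).
    exists (Re c / 2)%R, (11 * M * (1 + ln (1 / d)))%R. split; [lra|]. split; [lra|].
    intros n w Hw. apply (montel_bound d Hd). pose proof (re_le_Cmod (w - c)) as T. rewrite re_sub in T.
    apply Rabs_le_between in T. pose proof (Rmin_l (Re c / 2) 1). fold d in H. lra.
  - exact Hf.
  - exists f, f'. split; [exact Hf1|]. split; [|split; [|split]].
    + apply (poly_bounded_represents al (2 * M) 1 f 4 montel_coef_bound). intros s Hs.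
      apply (clim_unique (fun k => F k s)); [apply Hf; lra|]. intros eps He.
      destruct (montel_right eps He) as [N HN]. exists N. intros n Hn. apply HN; auto; lra.
    + intros s Hs. apply (Rmult_le_reg_l (/ Re s)); [apply Rinv_0_lt_compat, Hs|].
      rewrite <- Rmult_assoc, Rinv_l, Rmult_1_l by lra.
      apply (clim_Cmod_le _ _ _ (Hf2 s Hs)). exists 0%nat. intros k _. pose proof (HM k s Hs) as HMk.
      apply (Rmult_le_reg_l (Re s)); [exact Hs|]. rewrite <- Rmult_assoc, Rinv_r, Rmult_1_l by lra. exact HMk.
    + apply (clim_Cmod_le _ _ _ (Hf 1 ltac:(simpl; lra))). exists 0%nat. intros k _. apply H1.
    + intros d Hd eps He. destruct (montel_cauchy d Hd eps He) as [N HN]. exists N. intros k s Hk Hs.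
      apply (clim_Cmod_le (fun j => F k s - F j s)).
      * apply clim_minus; [apply clim_const|apply Hf; lra].
      * exists N. intros j Hj. apply HN; auto.
Qed.

End Montel.

Theorem montel_dirichlet (a : nat -> nat -> C) (F F' : nat -> C -> C) M :
  (forall k, holo 0 (F k) (F' k)) -> (forall k, represents (a k) (F k)) ->
  (forall k s, (0 < Re s)%R -> (Re s * Cmod (F' k s) <= M)%R) -> (forall k, (Cmod (F k 1) <= M)%R) ->
  exists phi al f f', incr phi /\ holo 0 f f' /\ represents al f /\
  (forall s, (0 < Re s)%R -> (Re s * Cmod (f' s) <= M)%R) /\ (Cmod (f 1) <= M)%R /\
  forall d, (0 < d <= 1)%R -> forall eps, (0 < eps)%R -> exists N, forall k s,
    (N <= k)%nat -> (d <= Re s)%R -> (Cmod (F (phi k) s - f s) <= eps)%R.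
Proof.
  intros HF Hrep HM H1.
  (* The constant coefficients are bounded through the values at [1], the others through the
     coefficient estimate. *)
  destruct (diagonal_subsequence (fun n k => a k n) (fun n => Rmax (6 * M) (2 * M * exp (1 * lnS n)))) as [phi [Hphi Hl]].
  { intros [|n] k.
    - eapply Rle_trans; [|apply Rmax_l]. apply (bloch_coef_0 (a k) (F k) (F' k) M); auto.
    - eapply Rle_trans; [|apply Rmax_r].
      destruct (dirichlet_growth (a k) (F k) (F' k) M (HF k) (Hrep k) (bloch_deriv_right (F' k) M (HM k))) as [Hpb _].
      apply Hpb. lia. }
  set (al := fun n => epsilon (inhabits (RtoC 0)) (fun l => clim (fun k => a (phi k) n) l)).
  assert (Hal : forall n, clim (fun k => a (phi k) n) (al n)) by (intros n; apply epsilon_spec, Hl).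
  destruct (montel_limit (fun k => a (phi k)) (fun k => F (phi k)) (fun k => F' (phi k)) M
    (fun k => HF (phi k)) (fun k => Hrep (phi k)) (fun k => HM (phi k)) (fun k => H1 (phi k)) al Hal) as [f [f' Hf]].
  exists phi, al, f, f'. split; [exact Hphi|exact Hf].
Qed.

(** * Sufficiency *)

Lemma Rbar_mult_lt_inv (x y e : R) (V : Rbar) : (0 < x)%R -> Rbar_le y V -> Rbar_lt (Rbar_mult x V) e -> (x * y < e)%R.
Proof.
  intros Hx Hy H. destruct V as [v| |].
  - simpl in *. nra.
  - exfalso. revert H. unfold Rbar_mult, Rbar_mult'. destruct (Rle_dec 0 x) as [H0|H0]; [|lra].
    destruct (Rle_lt_or_eq_dec 0 x H0); simpl; [auto|lra].
  - contradiction.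
Qed.

Lemma Rbar_mult_le_lt (x y e : R) (V : Rbar) : (0 < x)%R -> Rbar_le 0 V -> Rbar_le V y -> (x * y < e)%R -> Rbar_lt (Rbar_mult x V) e.
Proof.
  destruct V as [v| |]; simpl in *; try contradiction. nra.
Qed.

Lemma Bloch_w0_little_o G : Bloch_w0 weight G -> forall eps, (0 < eps)%R -> exists d, (0 < d <= 1)%R /\
  forall s, (0 < Re s < d)%R -> (weight (Re s) * Cmod (C_derive G s) <= eps)%R.
Proof.
  intros [_ H] eps He. destruct (H (mkposreal eps He)) as [d Hd]. pose proof (cond_pos d) as Hdp.
  exists (Rmin d 1). split; [split; [apply Rmin_pos; lra|apply Rmin_r]|].
  intros s Hs. pose proof (Rmin_l d 1). pose proof (Rmin_r d 1).
  assert (Hb : ball 0%R d (Re s)).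
  { change (Rabs (Re s - 0) < d)%R. rewrite Rminus_0_r, Rabs_pos_eq; lra. }
  specialize (Hd (Re s) Hb (proj1 Hs)). left.
  apply (Rbar_mult_lt_inv _ _ _ (vertical_sup G (Re s))); [| |exact Hd].
  - pose proof (weight_ge (Re s) ltac:(lra)). lra.
  - apply (sup_on_ge (fun z => Re z = Re s) (fun z => Cmod (C_derive G z))). reflexivity.
Qed.

Lemma volterra_minus g f1 f2 h1 h2 : volterra g f1 h1 -> volterra g f2 h2 ->
  volterra g (fun s => f1 s - f2 s) (fun s => h1 s - h2 s).
Proof.
  intros [t1 H1] [t2 H2]. exists (Rmax t1 t2). intros s Hs. unfold half_plane in *.
  max_bounds.
  specialize (H1 s ltac:(lra)). specialize (H2 s ltac:(lra)).
  pose proof (is_RInt_gen_minus (V := C_R_NormedModule) _ _ _ _ H1 H2) as H3.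
  replace (- (h1 s - h2 s)) with (minus (- h1 s : C_R_NormedModule) (- h2 s)).
  - eapply (is_RInt_gen_ext (V := C_R_NormedModule)); [|exact H3].
    apply filter_forall. intros p x _.
    change (f1 (s + RtoC x) * C_derive (dirichlet_sum g) (s + RtoC x) - f2 (s + RtoC x) * C_derive (dirichlet_sum g) (s + RtoC x)
     = (f1 (s + RtoC x) - f2 (s + RtoC x)) * C_derive (dirichlet_sum g) (s + RtoC x)). ring.
  - change (- h1 s - - h2 s = - (h1 s - h2 s)). ring.
Qed.

(* [T_g u] is controlled at 1 by the growth lemma, as its Dirichlet series has no constant term. *)
Lemma volterra_at_1 g G G' a u u' h M : holo 0 G G' -> represents g G -> holo 0 u u' -> represents a u ->
  holo 0 h (fun s => u s * G' s) -> volterra g u h ->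
  (forall s, (1 <= Re s)%R -> (Cmod (u s * G' s) <= M)%R) -> (Cmod (h 1) <= 5 * M)%R.
Proof.
  intros HG Rg Hu Ra Hh Vh HM.
  destruct (volterra_exists g G G' a u u' HG Rg Hu Ra) as [h0 [c [Hh0 [Rc [c0 Vh0]]]]].
  destruct (volterra_unique g u h h0 Vh Vh0) as [t Ht].
  rewrite (identity_eq 0 h _ h0 _ t Hh Hh0 Ht 1) by (simpl; lra).
  destruct (dirichlet_growth c h0 _ M Hh0 Rc HM) as [_ [_ H]].
  specialize (H 1 ltac:(simpl; lra)). rewrite c0 in H. replace (h0 1 - 0) with (h0 1) in H by ring. exact H.
Qed.

Lemma compact_of_Bloch_w0 g : belongs_to g (Bloch_w0 weight) -> compact_operator Bloch_D bloch_norm (volterra g).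
Proof.
  intros [G [HG Rg]]. split.
  { intros f Hf. apply (volterra_maps_Bloch_D g G f Rg (proj1 HG) Hf). }
  intros f h Hfh [M HM].
  pose proof (bloch_holo G (proj1 (proj1 HG))) as HGh. set (G' := C_derive G) in *.
  destruct (bloch_w_deriv_bounds G (proj1 HG)) as [B [HB1 HB2]]. fold G' in HB1, HB2.
  assert (HB0 : (0 <= B)%R).
  { specialize (HB2 1 ltac:(simpl; lra)). pose proof (Cmod_ge_0 (G' 1)). simpl in HB2. lra. }
  assert (Hdata : forall k, exists a, represents a (f k)) by (intros k; apply (Hfh k)).
  set (a := fun k => epsilon (inhabits (fun _ : nat => RtoC 0)) (fun a => represents a (f k))).
  assert (Ra : forall k, represents (a k) (f k)) by (intros k; apply epsilon_spec, Hdata).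
  assert (Hf : forall k, holo 0 (f k) (C_derive (f k))) by (intros k; apply bloch_holo, (Hfh k)).
  assert (Hh : forall k, holo 0 (h k) (fun s => f k s * G' s)).
  { intros k s Hs. apply (volterra_deriv g G G' (a k) (f k) (C_derive (f k)) (h k) (C_derive (h k))); auto.
    - apply bloch_holo, (Hfh k).
    - apply (Hfh k). }
  assert (HM1 : forall k s, (0 < Re s)%R -> (Re s * Cmod (C_derive (f k) s) <= M)%R) by (intros k; apply (bloch_norm_le_inv (f k) M (HM k))).
  assert (HM2 : forall k, (Cmod (f k 1) <= M)%R) by (intros k; apply (bloch_norm_le_inv (f k) M (HM k))).
  assert (HM0 : (0 <= M)%R) by (eapply Rle_trans; [apply Cmod_ge_0|apply (HM2 0%nat)]).
  destruct (montel_dirichlet a f (fun k => C_derive (f k)) M Hf Ra HM1 HM2) as [phi [al [f0 [f0' [Hphi [Hf0 [Ral [Hf0M [Hf01 Hconv]]]]]]]]].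
  assert (HX0 : Bloch_D f0).
  { split; [split; [apply (cderiv_analytic _ _ _ Hf0)|]|exists al; exact Ral].
    assert (T : Rbar_le (bloch_norm f0) (M + M)%R).
    { apply bloch_norm_le; [|exact Hf01]. intros s Hs. rewrite (cderiv_C_derive f0 s _ (Hf0 s Hs)). apply Hf0M, Hs. }
    destruct (bloch_norm f0); simpl in *; auto. }
  destruct (volterra_maps_Bloch_D g G f0 Rg (proj1 HG) HX0) as [l [HXl Vl]].
  assert (Hl : holo 0 l (fun s => f0 s * G' s)).
  { intros s Hs. apply (volterra_deriv g G G' al f0 f0' l (C_derive l)); auto. apply bloch_holo, HXl. }
  exists phi, l. split; [exact Hphi|]. split; [exact HXl|]. intros eps.
  pose proof (cond_pos eps) as He.
  (* The difference of [f (phi k)] and its limit has Bloch bounds [2 * M], so its logarithmic growth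
     constant is [11 * (2 * M)]. *)
  destruct (Bloch_w0_little_o G HG (eps / 4 / (22 * M + 1))%R) as [d [Hd Hlo]]; [apply Rdiv_lt_0_compat; lra|]. fold G' in Hlo.
  (* [eta] will bound that difference on [Re s >= d], where [Re s] times the derivative of [G] is at
     most [B]; the value at [1] costs five times [eta * B]. *)
  set (eta := (eps / 4 / (5 * B + 1))%R).
  assert (Heta : (0 < eta)%R) by (apply Rdiv_lt_0_compat; lra).
  assert (HetaB : (5 * (eta * B) <= eps / 4)%R).
  { apply Rle_trans with (eta * (5 * B + 1))%R; [nra|]. unfold eta. right; field; lra. }
  destruct (Hconv d Hd eta Heta) as [N HN]. exists N. intros k Hk.
  set (u := fun s => f (phi k) s - f0 s).
  assert (Hu : holo 0 u (fun s => C_derive (f (phi k)) s - f0' s)) by (apply holo_minus; auto).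
  assert (Ru : represents (fun n => a (phi k) n + - (1) * al n) u).
  { apply (represents_ext _ (fun s => f (phi k) s + - (1) * f0 s)); [intros s; unfold u; ring|]. apply represents_linear; auto. }
  assert (Hu1 : forall s, (0 < Re s)%R -> (Re s * Cmod (C_derive (f (phi k)) s - f0' s) <= 2 * M)%R).
  { intros s Hs. specialize (HM1 (phi k) s Hs). specialize (Hf0M s Hs).
    pose proof (Cmod_triangle (C_derive (f (phi k)) s) (- f0' s)) as T. rewrite Cmod_opp in T.
    fold (C_derive (f (phi k)) s - f0' s) in T. nra. }
  assert (Hu2 : (Cmod (u 1) <= 2 * M)%R).
  { unfold u. pose proof (Cmod_triangle (f (phi k) 1) (- f0 1)) as T. rewrite Cmod_opp in T.
    specialize (HM2 (phi k)). fold (f (phi k) 1 - f0 1) in T. lra. }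
  assert (Hul : holo 0 (fun s => h (phi k) s - l s) (fun s => u s * G' s)).
  { intros s Hs. eapply cderiv_eq; [apply cderiv_minus; [apply Hh, Hs|apply Hl, Hs]|unfold u; ring]. }
  assert (Hfar : forall s, (d <= Re s)%R -> (Re s * Cmod (G' s) <= B)%R).
  { intros s Hs. destruct (Rle_or_lt (Re s) 1); [|apply HB2; lra].
    specialize (HB1 s ltac:(lra)). pose proof (weight_ge (Re s) ltac:(lra)). nra. }
  assert (Hsup : forall s, (0 < Re s)%R -> (Re s * Cmod (C_derive (fun s => (h (phi k) s - l s)%C) s) <= eps / 4)%R).
  { intros s Hs. rewrite (cderiv_C_derive _ _ _ (Hul s Hs)). rewrite Cmod_mult.
    pose proof (Cmod_ge_0 (G' s)) as Hg0.
    destruct (Rlt_or_le (Re s) d) as [Hsd|Hsd].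
    - pose proof (bloch_growth_left _ u _ (2 * M) Hu Ru Hu1 Hu2 s ltac:(lra)) as Hg.
      specialize (Hlo s ltac:(lra)).
      apply Rle_trans with (Re s * (11 * (2 * M) * (1 + ln (1 / Re s)) * Cmod (G' s)))%R.
      + apply Rmult_le_compat_l; [lra|]. apply Rmult_le_compat_r; lra.
      + replace (Re s * (11 * (2 * M) * (1 + ln (1 / Re s)) * Cmod (G' s)))%R with (22 * M * (weight (Re s) * Cmod (G' s)))%R by (unfold weight; ring).
        apply Rle_trans with ((22 * M + 1) * (eps / 4 / (22 * M + 1)))%R.
        * apply Rmult_le_compat; try lra. apply Rmult_le_pos; [|lra]. pose proof (weight_ge (Re s) ltac:(lra)). lra.
        * right; field; lra.
    - specialize (HN k s Hk Hsd). fold (u s) in HN. specialize (Hfar s Hsd).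
      apply Rle_trans with (eta * B)%R; [|lra].
      replace (Re s * (Cmod (u s) * Cmod (G' s)))%R with (Cmod (u s) * (Re s * Cmod (G' s)))%R by ring.
      apply Rmult_le_compat; try lra; [apply Cmod_ge_0|apply Rmult_le_pos; lra]. }
  assert (Hat1 : (Cmod (h (phi k) 1 - l 1) <= eps / 4)%R).
  { eapply Rle_trans; [|exact HetaB].
    apply (volterra_at_1 g G G' (fun n => a (phi k) n + - (1) * al n) u _ (fun s => h (phi k) s - l s) (eta * B) HGh Rg Hu Ru Hul).
    - apply volterra_minus; [apply (Hfh (phi k))|exact Vl].
    - intros s Hs. apply Cmod_mult_le; [apply HN; [exact Hk|lra]|].
      specialize (HB2 s Hs). nra. }
  pose proof (bloch_norm_le (fun s => h (phi k) s - l s) _ _ Hsup Hat1) as T.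
  eapply Rbar_le_lt_trans; [exact T|]. simpl. lra.
Qed.

(** * Necessity *)

Lemma represents_scal c a f : represents a f -> represents (fun n => c * a n) (fun s => c * f s).
Proof.
  intros [t H]. exists t. intros s Hs. specialize (H s Hs). apply is_series_clim in H. apply is_series_clim.
  apply (clim_ext (fun N => c * csum (dirichlet_term a s) N)).
  - intros N. rewrite <- csum_scal. apply csum_ext. intros n _. rewrite !dirichlet_term_dexp. ring.
  - apply clim_scal, H.
Qed.

Lemma represents_dexp m : represents (fun n => if Nat.eqb n m then 1 else 0) (dexp m).
Proof.
  exists 0%R. intros s _. apply is_series_clim. exists (S m). intros N HN.
  rewrite (csum_extend _ (S m) N HN).
  - simpl csum. rewrite csum_zero.
    + rewrite dirichlet_term_dexp, Nat.eqb_refl.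
      replace (0 + 1 * dexp m s - dexp m s) with (RtoC 0) by ring. rewrite Cmod_0; lra.
    + intros k Hk. rewrite dirichlet_term_dexp. destruct (Nat.eqb_spec k m); [lia|ring].
  - intros k Hk. rewrite dirichlet_term_dexp. destruct (Nat.eqb_spec k m); [lia|ring].
Qed.

Lemma represents_const (c : C) : exists a, represents a (fun _ => c).
Proof.
  eexists. apply (represents_ext _ (fun s => c * dexp 0 s)).
  - intros s. rewrite dexp_0. ring.
  - apply represents_scal, represents_dexp.
Qed.

Lemma represents_pow f n : (exists a, represents a f) -> exists a, represents a (fun s => f s ^ n).
Proof.
  intros [a Ha]. induction n as [|n [b Hb]].
  - apply (represents_const 1).
  - eexists. apply (represents_mult _ _ f (fun s => f s ^ n) Ha Hb).
Qed.

(** The truncation at degree [N] of [- ln (1 - z)]; its derivative [geom_poly] truncates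
    [1 / (1 - z)]. *)
Definition log_poly (z : C) (N : nat) : C := csum (fun m => / RtoC (INR (S m)) * z ^ S m) N.
Definition geom_poly (z : C) (N : nat) : C := csum (fun m => z ^ m) N.

Fixpoint harmonic (N : nat) : R :=
  match N with O => 0%R | S n => (harmonic n + / INR (S n))%R end.

Lemma INR_S_neq_0 m : RtoC (INR (S m)) <> 0.
Proof. intros E; apply RtoC_inj in E. pose proof (INR_S_pos m). lra. Qed.

Lemma cderiv_monomial n z : cderiv (fun z => z ^ S n) z (RtoC (INR (S n)) * z ^ n).
Proof.
  induction n as [|n IH].
  - apply (cderiv_ext (fun z => z)); [intros; simpl; ring|].
    eapply cderiv_eq; [apply cderiv_id|simpl; ring].
  - apply (cderiv_ext (fun z => z * z ^ S n)); [intros; reflexivity|].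
    eapply cderiv_eq; [apply (cderiv_mult (fun z => z)); [apply cderiv_id|exact IH]|].
    rewrite (S_INR (S n)), RtoC_plus, Cpow_S. ring.
Qed.

Lemma cderiv_log_poly N z : cderiv (fun z => log_poly z N) z (geom_poly z N).
Proof.
  induction N as [|N IH]; [apply (cderiv_const 0)|].
  eapply cderiv_eq; [apply cderiv_plus; [exact IH|apply cderiv_scal, cderiv_monomial]|].
  change (geom_poly z (S N)) with (geom_poly z N + z ^ N). rewrite Cmult_assoc, Cinv_l by apply INR_S_neq_0. ring.
Qed.

Lemma harmonic_pos N : (1 <= N)%nat -> (1 <= harmonic N)%R.
Proof.
  intros H. induction H as [|N H IH]; [simpl; rewrite Rinv_1; lra|].
  change (harmonic (S N)) with (harmonic N + / INR (S N))%R.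
  pose proof (Rinv_0_lt_compat _ (INR_S_pos N)). lra.
Qed.

(** Each increment of the logarithm is [ln (1 + 1 / n) <= 1 / n]. *)
Lemma harmonic_ge_ln N : (ln (INR (S N)) <= harmonic N)%R.
Proof.
  induction N as [|N IH]; [simpl; rewrite ln_1; lra|]. change (harmonic (S N)) with (harmonic N + / INR (S N))%R.
  pose proof (INR_S_pos N) as Hp.
  replace (INR (S (S N))) with (INR (S N) * (1 + / INR (S N)))%R by (rewrite (S_INR (S N)); field; lra).
  pose proof (Rinv_0_lt_compat _ Hp). rewrite ln_mult by lra.
  assert (ln (1 + / INR (S N)) <= / INR (S N))%R; [|lra].
  rewrite <- (ln_exp (/ INR (S N))) at 2. apply ln_le; [lra|]. apply exp_ineq1_le.
Qed.

Lemma Cmod_log_term z m : Cmod (/ RtoC (INR (S m)) * z ^ S m) = (/ INR (S m) * Cmod z ^ S m)%R.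
Proof.
  rewrite Cmod_mult, Cmod_pow, Cmod_inv, Cmod_R, Rabs_pos_eq by (apply INR_S_neq_0 || (left; apply INR_S_pos)). reflexivity.
Qed.

Lemma log_poly_le_harmonic z N : (Cmod z <= 1)%R -> (Cmod (log_poly z N) <= harmonic N)%R.
Proof.
  intros Hz. induction N as [|N IH]; [unfold log_poly; simpl; rewrite Cmod_0; lra|].
  change (log_poly z (S N)) with (log_poly z N + / RtoC (INR (S N)) * z ^ S N). change (harmonic (S N)) with (harmonic N + / INR (S N))%R.
  eapply Rle_trans; [apply Cmod_triangle|]. rewrite Cmod_log_term.
  pose proof (Rinv_0_lt_compat _ (INR_S_pos N)).
  assert (Cmod z ^ S N <= 1)%R by (rewrite <- (pow1 (S N)); apply pow_incr; split; [apply Cmod_ge_0|exact Hz]).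
  nra.
Qed.

(** Replacing the coefficients [1 / m] by [1] leaves a geometric sum, whose closed form
    [x (1 - x^N) / (1 - x)], with [x = Cmod z], is carried through the induction. *)
Lemma log_poly_bound z N : (Cmod z < 1)%R -> (Cmod (log_poly z N) * (1 - Cmod z) <= Cmod z)%R.
Proof.
  intros Hz. pose proof (Cmod_ge_0 z) as H0.
  assert (H : (Cmod (log_poly z N) * (1 - Cmod z) <= Cmod z * (1 - Cmod z ^ N))%R).
  { induction N as [|N IH]; [unfold log_poly; simpl; rewrite Cmod_0; lra|].
    change (log_poly z (S N)) with (log_poly z N + / RtoC (INR (S N)) * z ^ S N).
    pose proof (Cmod_triangle (log_poly z N) (/ RtoC (INR (S N)) * z ^ S N)) as T. rewrite Cmod_log_term in T.
    assert (Hi : (/ INR (S N) <= 1)%R).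
    { rewrite <- Rinv_1. apply Rinv_le_contravar; [lra|]. apply (le_INR 1); lia. }
    assert (Hp : (0 <= Cmod z ^ S N)%R) by (apply pow_le; lra).
    assert (T2 : (/ INR (S N) * Cmod z ^ S N <= Cmod z ^ S N)%R) by nra.
    simpl pow in *. nra. }
  assert (0 <= Cmod z ^ N)%R by (apply pow_le; lra). nra.
Qed.

Lemma geom_poly_bound z N : (Cmod z < 1)%R -> (Cmod (geom_poly z N) * (1 - Cmod z) <= 1)%R.
Proof.
  intros Hz. pose proof (Cmod_ge_0 z) as H0.
  assert (H : (Cmod (geom_poly z N) * (1 - Cmod z) <= 1 - Cmod z ^ N)%R).
  { induction N as [|N IH]; [unfold geom_poly; simpl; rewrite Cmod_0; lra|].
    change (geom_poly z (S N)) with (geom_poly z N + z ^ N).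
    pose proof (Cmod_triangle (geom_poly z N) (z ^ N)) as T. rewrite Cmod_pow in T.
    simpl pow in *. nra. }
  assert (0 <= Cmod z ^ N)%R by (apply pow_le; lra). lra.
Qed.

Lemma log_poly_lower x N : (0 <= x <= 1)%R -> exists y : R, log_poly (RtoC x) N = RtoC y /\ (x ^ N * harmonic N <= y)%R.
Proof.
  intros Hx.
  (* The exponent [K] is decoupled from the length of the sum, so that every power in it is bounded
     below by the same [x ^ K]. *)
  assert (K : forall K, (N <= K)%nat -> exists y : R, log_poly (RtoC x) N = RtoC y /\ (x ^ K * harmonic N <= y)%R).
  { intros K. induction N as [|N IH]; intros HK.
    - exists 0%R. split; [reflexivity|simpl; lra].
    - destruct (IH ltac:(lia)) as [y [E H]]. exists (y + / INR (S N) * x ^ S N)%R. split.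
      + change (log_poly (RtoC x) (S N)) with (log_poly (RtoC x) N + / RtoC (INR (S N)) * RtoC x ^ S N).
        pose proof (INR_S_pos N). rewrite E, RtoC_plus, RtoC_mult, RtoC_inv, RtoC_pow by lra. reflexivity.
      + change (harmonic (S N)) with (harmonic N + / INR (S N))%R. pose proof (Rinv_0_lt_compat _ (INR_S_pos N)).
        assert (x ^ K <= x ^ S N)%R; [|nra].
        replace K with ((K - S N) + S N)%nat by lia. rewrite pow_add.
        assert (0 <= x ^ S N)%R by (apply pow_le; lra).
        assert (x ^ (K - S N) <= 1)%R by (rewrite <- (pow1 (K - S N)); apply pow_incr; lra). nra. }
  apply (K N). lia.
Qed.

(* [log_poly (2^(-(s - i t))) N ^ 2 / H_N]: of bounded Bloch norm, at least [H_N / 4] at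
   [sigma + i t] if [N sigma <= 1], and pointwise [O(1 / H_N)]. *)
Definition test_base (t : R) (s : C) : C := Cexp (Ci * RtoC (t * ln 2)) * dexp 1 s.
Definition test_fun (t : R) (N : nat) (s : C) : C :=
  / RtoC (harmonic N) * (log_poly (test_base t s) N * log_poly (test_base t s) N).

Lemma lnS_1 : lnS 1 = ln 2.
Proof. reflexivity. Qed.

Lemma Cmod_test_base t s : Cmod (test_base t s) = exp (- (Re s * ln 2)).
Proof.
  unfold test_base. rewrite Cmod_mult, Cmod_Cexp, Cmod_dexp, lnS_1, Re_Ci_mult, exp_0, Rmult_1_l. f_equal; ring.
Qed.

Lemma cderiv_test_base t s : cderiv (test_base t) s (- RtoC (ln 2) * test_base t s).
Proof.
  eapply cderiv_eq; [apply cderiv_scal, cderiv_dexp|]. unfold test_base. rewrite lnS_1. ring.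
Qed.

Lemma log_poly_represents f N : (exists a, represents a f) -> exists a, represents a (fun s => log_poly (f s) N).
Proof.
  intros Hf. induction N as [|N [b Hb]]; [apply (represents_const 0)|].
  destruct (represents_pow f (S N) Hf) as [p Hp].
  eexists. apply (represents_linear (/ RtoC (INR (S N))) _ _ _ _ Hb Hp).
Qed.

Lemma test_fun_represents t N : exists a, represents a (test_fun t N).
Proof.
  destruct (log_poly_represents (test_base t) N) as [b Hb].
  { eexists. apply represents_scal, represents_dexp. }
  eexists. apply represents_scal. apply (represents_mult _ _ _ _ Hb Hb).
Qed.

Section TestFunction.
Variables (t : R) (N : nat).
Hypothesis HN : (1 <= N)%nat.

Let H := harmonic N.

Lemma test_harmonic : (1 <= H)%R.
Proof. apply harmonic_pos, HN. Qed.

Lemma cderiv_test_fun s : cderiv (test_fun t N) s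
  (/ RtoC H * (2 * (log_poly (test_base t s) N * (geom_poly (test_base t s) N * (- RtoC (ln 2) * test_base t s))))).
Proof.
  assert (D : cderiv (fun s => log_poly (test_base t s) N) s (geom_poly (test_base t s) N * (- RtoC (ln 2) * test_base t s))).
  { apply (cderiv_comp (fun z => log_poly z N) (test_base t)); [apply cderiv_test_base|apply cderiv_log_poly]. }
  eapply cderiv_eq; [apply cderiv_scal, cderiv_mult; exact D|]. unfold H. ring.
Qed.

(** With [y = Re s * ln 2] the second part is [y exp (- y) <= 1 - exp (- y)], that is
    [exp y >= 1 + y]. *)
Lemma test_base_lt_1 s : (0 < Re s)%R -> (Cmod (test_base t s) < 1)%R /\
  (Re s * ln 2 * Cmod (test_base t s) <= 1 - Cmod (test_base t s))%R.
Proof.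
  intros Hs. rewrite Cmod_test_base. pose proof ln2_pos. set (y := (Re s * ln 2)%R).
  assert (Hy : (0 < y)%R) by (unfold y; nra).
  split.
  - rewrite <- exp_0. apply exp_increasing. lra.
  - pose proof (exp_ineq1_le y).
    assert (E : (exp (- y) * exp y = 1)%R) by (rewrite <- exp_plus, Rplus_opp_l; apply exp_0). nra.
Qed.

Lemma Cmod_inv_H : Cmod (/ RtoC H) = (/ H)%R.
Proof.
  pose proof test_harmonic. rewrite Cmod_inv, Cmod_R, Rabs_pos_eq; [reflexivity|lra|].
  intros E; apply RtoC_inj in E; lra.
Qed.

(** The [2] comes from differentiating the square. The factor [log_poly / H] has modulus at most
    [1], and [geom_poly] at most [1 / (1 - x)], with [x] the modulus of the base, which absorbs
    [Re s * ln 2 * x]. *)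
Lemma test_fun_bloch s : (0 < Re s)%R -> (Re s * Cmod (C_derive (test_fun t N) s) <= 2)%R.
Proof.
  intros Hs. rewrite (cderiv_C_derive _ _ _ (cderiv_test_fun s)).
  destruct (test_base_lt_1 s Hs) as [H1 H2]. pose proof test_harmonic as HH. pose proof ln2_pos.
  rewrite !Cmod_mult, Cmod_inv_H, Cmod_opp, !Cmod_R, (Rabs_pos_eq 2), (Rabs_pos_eq (ln 2)) by lra.
  pose proof (log_poly_le_harmonic (test_base t s) N ltac:(lra)) as HL. fold H in HL.
  pose proof (geom_poly_bound (test_base t s) N H1) as HG.
  set (x := Cmod (test_base t s)) in *. set (l := Cmod (log_poly (test_base t s) N)) in *.
  set (ge := Cmod (geom_poly (test_base t s) N)) in *.
  assert (0 <= l)%R by apply Cmod_ge_0. assert (0 <= ge)%R by apply Cmod_ge_0.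
  assert (A : (/ H * l <= 1)%R).
  { apply (Rmult_le_reg_l H); [lra|]. rewrite <- Rmult_assoc, Rinv_r by lra. lra. }
  assert (B : (ge * (Re s * ln 2 * x) <= 1)%R).
  { apply Rle_trans with (ge * (1 - x))%R; [apply Rmult_le_compat_l; lra|lra]. }
  assert (0 <= / H * l)%R by (apply Rmult_le_pos; [left; apply Rinv_0_lt_compat; lra|lra]).
  nra.
Qed.

(** With [x] the modulus of the base, [x / (1 - x) <= 1 / (Re s * ln 2)] bounds both logarithmic
    factors independently of [N], leaving [1 / H]. *)
Lemma test_fun_small s : (0 < Re s)%R -> (Cmod (test_fun t N s) <= / H * (/ (Re s * ln 2) * / (Re s * ln 2)))%R.
Proof.
  intros Hs. destruct (test_base_lt_1 s Hs) as [H1 H2]. pose proof ln2_pos.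
  assert (Hy : (0 < Re s * ln 2)%R) by nra.
  assert (HL : (Cmod (log_poly (test_base t s) N) <= / (Re s * ln 2))%R).
  { pose proof (log_poly_bound (test_base t s) N H1) as HB.
    apply (Rmult_le_reg_r (Re s * ln 2)); [exact Hy|]. rewrite Rinv_l by lra.
    nra. }
  unfold test_fun. fold H. apply Cmod_mult_le; [rewrite Cmod_inv_H; lra|]. apply Cmod_mult_le; exact HL.
Qed.

(** [6] is [2] for the seminorm plus [4] for the value at [1], where [1 / ln 2 <= 2] and
    [1 / H <= 1]. *)
Lemma test_fun_in_Bloch_D : Bloch_D (test_fun t N) /\ Rbar_le (bloch_norm (test_fun t N)) 6%R.
Proof.
  assert (T : Rbar_le (bloch_norm (test_fun t N)) 6%R).
  { replace 6%R with (2 + 4)%R by ring. apply bloch_norm_le; [apply test_fun_bloch|].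
    eapply Rle_trans; [apply test_fun_small; simpl; lra|].
    rewrite Rmult_1_l. pose proof test_harmonic. pose proof ln_lt_2.
    assert (/ H <= 1)%R by (rewrite <- Rinv_1; apply Rinv_le_contravar; lra).
    assert (/ ln 2 <= 2)%R by (replace 2%R with (/ / 2)%R at 2 by field; apply Rinv_le_contravar; lra).
    assert (0 < / ln 2)%R by (apply Rinv_0_lt_compat; lra).
    nra. }
  split; [|exact T]. split; [split|].
  - eexists. apply cderiv_is_derive, cderiv_test_fun.
  - destruct (bloch_norm (test_fun t N)); simpl in *; auto.
  - apply test_fun_represents.
Qed.

(** At [(sigma, t)] the rotation cancels and the base is the real number [2^(- sigma)];
    [N * sigma <= 1] makes its [N]-th power at least [1 / 2], so the truncated logarithm is at least
    [H / 2]. *)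
Lemma test_fun_large sigma : (0 < sigma)%R -> (INR N * sigma <= 1)%R ->
  (H / 4 <= Cmod (test_fun t N (sigma, t)))%R.
Proof.
  intros Hs HNs. pose proof test_harmonic as HH. pose proof ln2_pos.
  assert (E : test_base t (sigma, t) = RtoC (exp (- (sigma * ln 2)))).
  { unfold test_base, dexp. rewrite lnS_1, <- Cexp_plus, <- Cexp_R. f_equal.
    apply injective_projections; simpl; ring. }
  unfold test_fun. fold H. rewrite E. set (x := exp (- (sigma * ln 2))).
  assert (Hx : (0 <= x <= 1)%R).
  { split; [left; apply exp_pos|]. rewrite <- exp_0. apply exp_le_compat. nra. }
  destruct (log_poly_lower x N Hx) as [y [Ey Hy]]. rewrite Ey. fold H in Hy.
  assert (HxN : (/ 2 <= x ^ N)%R).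
  { assert (Ex : forall n, (x ^ n = exp (- (INR n * sigma * ln 2)))%R).
    { induction n as [|n IH]; [simpl; rewrite !Rmult_0_l, Ropp_0, exp_0; reflexivity|].
      simpl pow. rewrite IH. unfold x. rewrite <- exp_plus. f_equal. rewrite S_INR. ring. }
    rewrite Ex. replace (/ 2)%R with (exp (- ln 2)) by (rewrite exp_Ropp, exp_ln; lra).
    apply exp_le_compat. nra. }
  assert (Hy2 : (H / 2 <= y)%R) by nra.
  rewrite !Cmod_mult, Cmod_inv_H, Cmod_R, Rabs_pos_eq by lra.
  apply (Rmult_le_reg_l H); [lra|]. rewrite <- Rmult_assoc, Rinv_r by lra. nra.
Qed.

End TestFunction.

(** * The little-o condition from compactness *)

Lemma null_set_empty (A : C -> Prop) : (forall s, ~ A s) -> null_set A.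
Proof.
  intros HA eps. exists (fun _ => 0%R), (fun _ => 0%R), (fun _ => 0%R), (fun _ => 0%R). split; [|split].
  - intros; lra.
  - intros s Hs. exfalso. apply (HA s Hs).
  - intros N. rewrite sum_n_const. pose proof (cond_pos eps). lra.
Qed.

(** On [Re s >= d] the weight exceeds [Re s] only by the bounded factor [1 + ln (1 / d)], so the
    unweighted bound suffices there; nearer to the axis the little-o hypothesis at [1] takes over.
    The bound obtained holds at every point, so the exceptional set is empty. *)
Lemma Bloch_w0_intro G : analytic_on (half_plane 0) G ->
  (exists M, forall s, (0 < Re s)%R -> (Re s * Cmod (C_derive G s) <= M)%R) ->
  (exists B, forall s, (1 < Re s)%R -> (Cmod (G s) <= B)%R) ->
  (forall eps, (0 < eps)%R -> exists d, (0 < d <= 1)%R /\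
     forall s, (0 < Re s < d)%R -> (weight (Re s) * Cmod (C_derive G s) <= eps)%R) ->
  Bloch_w0 weight G.
Proof.
  intros HA [M HM] [B HB] Hlo. split; [split; [exact HA|]|].
  - destruct (Hlo 1%R Rlt_0_1) as [d [Hd H1]].
    set (K := Rmax 1 ((1 + ln (1 / d)) * M)).
    assert (HK : forall s, strip s -> (weight (Re s) * Cmod (C_derive G s) <= K)%R).
    { intros s Hs. unfold strip in Hs. destruct (Rlt_or_le (Re s) d) as [Hsd|Hsd].
      - eapply Rle_trans; [apply H1; lra|apply Rmax_l].
      - eapply Rle_trans; [|apply Rmax_r]. specialize (HM s (proj1 Hs)).
        pose proof (ln_inv_nonneg (Re s) Hs). pose proof (Cmod_ge_0 (C_derive G s)).
        assert (ln (1 / Re s) <= ln (1 / d))%R.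
        { apply ln_le; [apply Rdiv_lt_0_compat; lra|]. unfold Rdiv. rewrite !Rmult_1_l. apply Rinv_le_contravar; lra. }
        replace (weight (Re s) * Cmod (C_derive G s))%R with ((1 + ln (1 / Re s)) * (Re s * Cmod (C_derive G s)))%R by (unfold weight; ring).
        apply Rmult_le_compat; try lra. apply Rmult_le_pos; lra. }
    assert (T1 : Rbar_le (ess_sup_on strip (fun s => (weight (Re s) * Cmod (C_derive G s))%R)) K).
    { apply Glb_Rbar_correct. apply null_set_empty. intros s [Hs Hlt]. specialize (HK s Hs). lra. }
    assert (T2 : Rbar_le (sup_on (half_plane 1) (fun s => Cmod (G s))) B) by (apply sup_on_le; exact HB).
    eapply Rbar_le_lt_trans; [apply (Rbar_plus_le_compat _ _ _ _ T1 T2)|]. exact I.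
  (* [eps / 2] keeps the inequality strict after the supremum is taken. *)
  - intros eps. destruct (Hlo (eps / 2)%R) as [d [Hd H1]]; [pose proof (cond_pos eps); lra|].
    exists (mkposreal d (proj1 Hd)). intros sigma Hb Hs.
    change (Rabs (sigma - 0) < d)%R in Hb. rewrite Rminus_0_r, Rabs_pos_eq in Hb by lra.
    assert (Hw : (0 < weight sigma)%R) by (pose proof (weight_ge sigma ltac:(lra)); lra).
    apply (Rbar_mult_le_lt _ (eps / 2 / weight sigma)).
    + exact Hw.
    + eapply Rbar_le_trans; [|apply (sup_on_ge _ (fun z => Cmod (C_derive G z)) (sigma, 0%R)); reflexivity].
      apply Cmod_ge_0.
    + apply sup_on_le. intros s Es. specialize (H1 s ltac:(rewrite Es; lra)). rewrite Es in H1.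
      apply (Rmult_le_reg_l (weight sigma)); [exact Hw|].
      replace (weight sigma * (eps / 2 / weight sigma))%R with (eps / 2)%R by (field; lra). exact H1.
    + pose proof (cond_pos eps). replace (weight sigma * (eps / 2 / weight sigma))%R with (eps / 2)%R by (field; lra). lra.
Qed.

Lemma Bloch_D_one : Bloch_D (fun _ => 1).
Proof.
  assert (E : forall s, C_derive (fun _ => RtoC 1) s = 0) by (intros; apply cderiv_C_derive, cderiv_const).
  split; [split|apply represents_const].
  - eexists. apply cderiv_is_derive, cderiv_const.
  - assert (T : Rbar_le (bloch_norm (fun _ => 1)) (0 + 1)%R).
    { apply bloch_norm_le; [|rewrite Cmod_1; lra]. intros s _. rewrite E, Cmod_0. lra. }
    destruct (bloch_norm (fun _ => 1)); simpl in *; auto.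
Qed.

Section Necessity.
Variables (g : nat -> C) (G : C -> C).
Hypothesis Hcomp : compact_operator Bloch_D bloch_norm (volterra g).
Hypothesis HG : holo 0 G (C_derive G).
Hypothesis Rg : represents g G.

Lemma compact_little_o eps : (0 < eps)%R -> exists d, (0 < d <= 1)%R /\
  forall s, (0 < Re s < d)%R -> (weight (Re s) * Cmod (C_derive G s) <= eps)%R.
Proof.
  apply NNPP. intros Hno.
  (* The failure is used at [d = 1 / (k + 1)], so the bad points approach the imaginary axis. *)
  assert (Hex : forall k : nat, exists s, (0 < Re s < / INR (S k))%R /\ (eps < weight (Re s) * Cmod (C_derive G s))%R).
  { intros k. apply NNPP. intros Hk. apply Hno. exists (/ INR (S k))%R. split.
    - split; [apply Rinv_0_lt_compat, INR_S_pos|]. rewrite <- Rinv_1. apply Rinv_le_contravar; [lra|].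
      apply (le_INR 1); lia.
    - intros s Hs. apply Rnot_lt_le. intros Hlt. apply Hk. exists s. split; assumption. }
  set (sk := fun k => epsilon (inhabits (RtoC 0)) (fun s => (0 < Re s < / INR (S k))%R /\ (eps < weight (Re s) * Cmod (C_derive G s))%R)).
  assert (Hsk : forall k, (0 < Re (sk k) < / INR (S k))%R /\ (eps < weight (Re (sk k)) * Cmod (C_derive G (sk k)))%R).
  { intros k. apply epsilon_spec, Hex. }
  assert (Hsk1 : forall k, (0 < Re (sk k) < 1)%R).
  { intros k. destruct (Hsk k) as [H1 _]. split; [lra|]. eapply Rlt_le_trans; [apply H1|].
    rewrite <- Rinv_1. apply Rinv_le_contravar; [lra|]. apply (le_INR 1); lia. }
  (* The integer part of [1 / Re s] gives both [N * Re s <= 1], for the lower bound of the test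
     function, and [N + 1 > 1 / Re s], which compares the harmonic number with the logarithm. *)
  assert (HexN : forall k, exists N, (INR N <= / Re (sk k) < INR N + 1)%R).
  { intros k. destruct (nfloor_ex (/ Re (sk k))) as [N HN].
    - left; apply Rinv_0_lt_compat, Hsk1.
    - exists N; exact HN. }
  set (Nk := fun k => epsilon (inhabits 0%nat) (fun N => (INR N <= / Re (sk k) < INR N + 1)%R)).
  assert (HNk : forall k, (INR (Nk k) <= / Re (sk k) < INR (Nk k) + 1)%R) by (intros k; unfold Nk; apply epsilon_spec, HexN).
  assert (Hinv1 : forall k, (1 < / Re (sk k))%R).
  { intros k. specialize (Hsk1 k). rewrite <- Rinv_1. apply Rinv_lt_contravar; lra. }
  assert (HNk1 : forall k, (1 <= Nk k)%nat).
  { intros k. specialize (HNk k). specialize (Hinv1 k). destruct (Nk k); [simpl in HNk; lra|lia]. }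
  assert (Hharm : forall k, (ln (1 / Re (sk k)) <= harmonic (Nk k))%R).
  { intros k. eapply Rle_trans; [|apply harmonic_ge_ln]. specialize (HNk k). specialize (Hsk1 k).
    unfold Rdiv. rewrite Rmult_1_l, S_INR. apply ln_le; [apply Rinv_0_lt_compat|]; lra. }
  set (fk := fun k => test_fun (Im (sk k)) (Nk k)).
  assert (Hfk : forall k, Bloch_D (fk k) /\ Rbar_le (bloch_norm (fk k)) 6%R) by (intros k; apply test_fun_in_Bloch_D, HNk1).
  destruct Hcomp as [Hmap Hseq].
  set (hk := fun k => epsilon (inhabits (fun _ : C => RtoC 0)) (fun h => Bloch_D h /\ volterra g (fk k) h)).
  assert (Hhk : forall k, Bloch_D (hk k) /\ volterra g (fk k) (hk k)).
  { intros k. apply epsilon_spec. apply Hmap, Hfk. }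
  destruct (Hseq fk hk) as [phi [l [Hphi [Hl Hconv]]]].
  { split; [apply Hfk|apply Hhk]. }
  { exists 6%R. intros k; apply Hfk. }
  assert (Hder : forall k s, (0 < Re s)%R -> cderiv (hk k) s (fk k s * C_derive G s)).
  { intros k s Hs. destruct (test_fun_represents (Im (sk k)) (Nk k)) as [a Ra].
    apply (volterra_deriv g G (C_derive G) a (fk k) (C_derive (fk k)) (hk k) (C_derive (hk k))); auto.
    - apply bloch_holo, Hfk.
    - apply bloch_holo, Hhk.
    - apply Hhk. }
  assert (Hlh : holo 0 l (C_derive l)) by apply bloch_holo, Hl.
  (* The Bloch norm controls the derivatives at all points at once, which allows evaluation at
     points that move with the index. *)
  assert (Hdiff : forall e, (0 < e)%R -> exists N, forall k s, (N <= k)%nat -> (0 < Re s)%R ->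
     (Re s * Cmod (fk (phi k) s * C_derive G s - C_derive l s) <= e)%R).
  { intros e Hep. destruct (Hconv (mkposreal e Hep)) as [N HN]. exists N. intros k s Hk Hs.
    specialize (HN k Hk). apply Rbar_lt_le, bloch_norm_le_inv in HN. destruct HN as [HN _]. specialize (HN s Hs).
    rewrite (cderiv_C_derive _ s (fk (phi k) s * C_derive G s - C_derive l s)) in HN; [exact HN|].
    apply cderiv_minus; [apply Hder, Hs|apply Hlh, Hs]. }
  assert (Hharm_inf : forall K, exists N, forall k, (N <= k)%nat -> (K <= harmonic (Nk (phi k)))%R).
  { intros K. destruct (nfloor_ex (exp K)) as [N HN]; [left; apply exp_pos|]. exists N. intros k Hk.
    eapply Rle_trans; [|apply Hharm]. rewrite <- (ln_exp K) at 1. apply ln_le; [apply exp_pos|].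
    unfold Rdiv. rewrite Rmult_1_l. destruct (Hsk (phi k)) as [Hs _].
    apply Rle_trans with (INR (S (phi k))).
    - left. eapply Rlt_le_trans; [apply HN|]. rewrite <- S_INR. apply le_INR.
      pose proof (incr_ge phi Hphi k). lia.
    - rewrite <- (Rinv_inv (INR (S (phi k)))). apply Rinv_le_contravar; lra. }
  (* At a fixed [s] the test functions are at most a constant over their harmonic numbers, which
     tend to infinity, so the derivatives of the images tend to [0] there. *)
  assert (Hl0 : forall s, (0 < Re s)%R -> C_derive l s = 0).
  { intros s Hs. apply Cmod_eq_0, Rle_antisym; [|apply Cmod_ge_0]. apply Rle_eps. intros e Hep.
    set (q := (/ (Re s * ln 2) * / (Re s * ln 2) * Cmod (C_derive G s))%R).
    pose proof ln2_pos.
    assert (Hq : (0 <= q)%R).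
    { assert (0 < / (Re s * ln 2))%R by (apply Rinv_0_lt_compat; nra). pose proof (Cmod_ge_0 (C_derive G s)).
      repeat apply Rmult_le_pos; lra. }
    destruct (Hdiff (Re s * (e / 2))%R ltac:(nra)) as [N1 HN1].
    destruct (Hharm_inf (Rmax 1 (2 * q / e))) as [N2 HN2].
    set (k := max N1 N2). specialize (HN1 k s ltac:(lia) Hs). specialize (HN2 k ltac:(lia)).
    apply (Rmult_le_reg_l (Re s)) in HN1; [|exact Hs].
    pose proof (test_fun_small (Im (sk (phi k))) (Nk (phi k)) (HNk1 (phi k)) s Hs) as Hsm.
    set (Hk := harmonic (Nk (phi k))) in *.
    max_bounds.
    assert (T : (Cmod (fk (phi k) s * C_derive G s) <= e / 2)%R).
    { rewrite Cmod_mult. apply Rle_trans with (/ Hk * q)%R.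
      - unfold q. rewrite <- !Rmult_assoc. apply Rmult_le_compat_r; [apply Cmod_ge_0|]. rewrite !Rmult_assoc. exact Hsm.
      - apply (Rmult_le_reg_l Hk); [lra|].
        apply Rle_trans with (2 * q / e * (e / 2))%R; [right; field; lra|]. apply Rmult_le_compat_r; lra. }
    pose proof (Cmod_le_sub (C_derive l s) (fk (phi k) s * C_derive G s)) as T2.
    rewrite (Cmod_sub_sym (C_derive l s)) in T2. lra. }
  destruct (Hdiff (eps / 16)%R ltac:(lra)) as [N HN].
  set (k := phi N). set (s := sk k) in *.
  specialize (HN N s (le_n _) (proj1 (Hsk1 k))). rewrite (Hl0 s (proj1 (Hsk1 k))) in HN. fold k in HN.
  replace (fk k s * C_derive G s - 0) with (fk k s * C_derive G s) in HN by ring. rewrite Cmod_mult in HN.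
  destruct (Hsk k) as [_ Hbig]. fold s in Hbig.
  pose proof (Hsk1 k) as Hs1. pose proof (HNk k) as HNks. fold s in Hs1, HNks.
  assert (Hlarge : (harmonic (Nk k) / 4 <= Cmod (fk k s))%R).
  { rewrite (C_pair s) at 1. apply test_fun_large; [apply HNk1|lra|].
    apply Rle_trans with (/ Re s * Re s)%R; [apply Rmult_le_compat_r; lra|]. rewrite Rinv_l; lra. }
  pose proof (harmonic_pos (Nk k) (HNk1 k)) as Hh1. pose proof (Hharm k) as Hhl. fold s in Hhl.
  pose proof (Cmod_ge_0 (C_derive G s)) as Hg0.
  (* Both [1] and [ln (1 / Re s)] are at most the harmonic number, itself at most four times the
     modulus of the test function, whence [8]; with the earlier [eps / 16] this leaves [eps / 2],
     against the choice of the point. *)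
  assert (W : (weight (Re s) * Cmod (C_derive G s) <= 8 * (Re s * (Cmod (fk k s) * Cmod (C_derive G s))))%R).
  { replace (8 * (Re s * (Cmod (fk k s) * Cmod (C_derive G s))))%R with ((8 * Cmod (fk k s)) * (Re s * Cmod (C_derive G s)))%R by ring.
    replace (weight (Re s) * Cmod (C_derive G s))%R with ((1 + ln (1 / Re s)) * (Re s * Cmod (C_derive G s)))%R by (unfold weight; ring).
    apply Rmult_le_compat_r; [apply Rmult_le_pos; lra|lra]. }
  lra.
Qed.

End Necessity.

(** Compactness enters twice: through the image of the constant [1], which provides the analytic
    extension of [g] to [Re s > 0] together with its Bloch bound, and through [compact_little_o]. *)
Lemma Bloch_w0_of_compact g : in_D g -> compact_operator Bloch_D bloch_norm (volterra g) -> belongs_to g (Bloch_w0 weight).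
Proof.
  intros Hg Hcomp. destruct (proj1 Hcomp _ Bloch_D_one) as [h [Hh Vh]].
  destruct (volterra_one g h Hg Vh) as [t Ht].
  destruct (Bloch_D_data h Hh) as [c [M [Rc [Hhh HM]]]]. apply bloch_norm_le_inv in HM.
  set (G := fun s => h s + g 0%nat).
  assert (HG0 : holo 0 G (C_derive h)).
  { intros s Hs. eapply cderiv_eq; [apply cderiv_plus; [apply Hhh, Hs|apply cderiv_const]|ring]. }
  assert (HGd : forall s, (0 < Re s)%R -> C_derive G s = C_derive h s) by (intros s Hs; apply cderiv_C_derive, HG0, Hs).
  assert (HG : holo 0 G (C_derive G)) by (intros s Hs; rewrite HGd by exact Hs; apply HG0, Hs).
  destruct (in_D_poly_bounded g Hg) as [K [k Hpb]].
  assert (Rg : represents g G) by (apply (poly_bounded_represents g K k G t Hpb Ht)).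
  assert (HM' : forall s, (0 < Re s)%R -> (Re s * Cmod (C_derive G s) <= M)%R) by (intros s Hs; rewrite HGd by exact Hs; apply HM, Hs).
  exists G. split; [|exact Rg]. apply Bloch_w0_intro.
  - apply (cderiv_analytic _ _ _ HG).
  - exists M. exact HM'.
  - destruct (dirichlet_growth g G (C_derive G) M HG Rg (bloch_deriv_right _ M HM')) as [_ [_ HB]].
    exists (Cmod (g 0%nat) + 5 * M)%R. intros s Hs. specialize (HB s ltac:(lra)).
    pose proof (Cmod_le_sub (G s) (g 0%nat)). lra.
  - intros eps He. apply (compact_little_o g G Hcomp HG Rg eps He).
Qed.

Theorem theorem4p3 (g : nat -> C) (hg : in_D g) :
  compact_operator Bloch_D bloch_norm (volterra g) <->
  belongs_to g (Bloch_w0 (fun sigma : R => (sigma * (1 + ln (1 / sigma)))%R)).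
Proof.
  split.
  - apply (Bloch_w0_of_compact g hg).
  - apply (compact_of_Bloch_w0 g).
Qed.
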